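(* For every $\alpha\in(1,2)$, almost surely the stable looptree $\mathscr{L}_\alpha$ is a compact metric space of Hausdorff dimension $\alpha$.
   Context: Fix $\alpha\in(1,2)$. Let $X$ be the spectrally positive $\alpha$-stable Lévy process normalized so that $\mathbb{E}[\exp(-\lambda X_t)]=\exp(t\lambda^\alpha)$ for all $\lambda>0,t\ge 0$ (its Lévy measure is $\frac{\alpha(\alpha-1)}{\Gamma(2-\alpha)}r^{-\alpha-1}\mathbf 1_{(0,\infty)}(r)\,dr$). Let $\underline g_1=\sup\{s\le 1: X_s=\inf_{[0,s]}X\}$, $\underline d_1=\inf\{s>1:X_s=\inf_{[0,s]}X\}$ and define the normalized excursion $X^{\mathrm{exc}}_s=(\underline d_1-\underline g_1)^{-1/\alpha}(X_{\underline g_1+s(\underline d_1-\underline g_1)}-X_{\underline g_1})$, $s\in[0,1]$. Write $\Delta_t=X^{\mathrm{exc}}_t-X^{\mathrm{exc}}_{t-}$ for $t\in(0,1]$, $\Delta_0=0$, $X^{\mathrm{exc}}_{0-}=0$, and $I_s^t=\inf_{[s,t]}X^{\mathrm{exc}}$. For $s,t\in[0,1]$ write $s\preccurlyeq t$ if $s\le t$ and $X^{\mathrm{exc}}_{s-}\le I_s^t$; $s\prec t$ if $s\preccurlyeq t$ and $s\neq t$; $s\wedge t$ denotes the most recent common ancestor of $s$ and $t$ for the partial order $\preccurlyeq$. For $s\preccurlyeq t$ set $x_s^t=I_s^t-X^{\mathrm{exc}}_{s-}\in[0,\Delta_s]$. For $a,b\in[0,\Delta_t]$ set $\delta_t(a,b)=\min(|a-b|,\Delta_t-|a-b|)$.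 For $s\preccurlyeq t$ set $d_0(s,t)=\sum_{s\prec r\preccurlyeq t}\delta_r(0,x_r^t)$, and for $s,t\in[0,1]$ set $d(s,t)=\delta_{s\wedge t}(x^s_{s\wedge t},x^t_{s\wedge t})+d_0(s\wedge t,s)+d_0(s\wedge t,t)$. Almost surely $d$ is a continuous pseudo-distance on $[0,1]$, and the stable looptree of index $\alpha$ is the quotient metric space $\mathscr{L}_\alpha=([0,1]/\sim,d)$ where $x\sim y$ iff $d(x,y)=0$. *)

(* Defs.v *)
From HB Require Import structures.
From mathcomp Require Import all_boot all_order all_algebra.
From mathcomp Require Import all_classical all_reals all_analysis.
Set Implicit Arguments. Unset Strict Implicit. Unset Printing Implicit Defensive.
Import Order.TTheory GRing.Theory Num.Theory.
Import numFieldNormedType.Exports.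
Local Open Scope classical_set_scope.
Local Open Scope ring_scope.

Section Looptree.
Variable R : realType.
Implicit Types (f : R -> R) (alpha s t r a b : R).

Definition cadlag f : Prop :=
  (forall t, 0 <= t -> f x @[x --> t^'+] --> f t) /\
  (forall t, 0 < t -> cvg (f x @[x --> t^'-])).

(** Law of the spectrally positive alpha-stable Lévy process normalized by
    E[exp(-lam X_t)] = exp(t lam^alpha): for all times 0 <= t_0 <= ... <= t_n
    and lam_i > 0, the joint Laplace transform of the increments factorizes
    (independent, stationary increments with the prescribed marginals). *)
Definition stable_laplace (d : measure_display) (T : measurableType d)
  (P : probability T R) (alpha : R) (X : R -> T -> R) : Prop :=
  forall (n : nat) (t lam : nat -> R),
    0 <= t 0%N -> (forall i, t i <= t i.+1) -> (forall i, 0 < lam i) ->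
    (\int[P]_w (expR (- \sum_(i < n) lam i * (X (t i.+1) w - X (t i) w)))%:E
      = (expR (\sum_(i < n) (t i.+1 - t i) * lam i `^ alpha))%:E)%E.

Definition infI f a b : R := inf [set f u | u in `[a, b]].

(** last zero before 1 / first zero after 1 of the reflected process *)
Definition g1 f : R := sup [set s | 0 <= s <= 1 /\ f s = infI f 0 s].
Definition d1 f : R := inf [set s | 1 < s /\ f s = infI f 0 s].

Definition Xexc alpha f (s : R) : R :=
  (d1 f - g1 f) `^ (- alpha^-1) * (f (g1 f + s * (d1 f - g1 f)) - f (g1 f)).

Definition Xexcm alpha f (s : R) : R :=
  if s == 0 then 0 else lim (Xexc alpha f x @[x --> s^'-]).

Definition Jump alpha f t : R := Xexc alpha f t - Xexcm alpha f t.

Definition Iexc alpha f s t : R := inf [set Xexc alpha f u | u in `[s, t]].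

Definition anc alpha f s t : Prop := s <= t /\ Xexcm alpha f s <= Iexc alpha f s t.
Definition sanc alpha f s t : Prop := anc alpha f s t /\ s <> t.

Definition xpos alpha f s t : R := Iexc alpha f s t - Xexcm alpha f s.

Definition delta alpha f t a b : R :=
  Num.min `|a - b| (Jump alpha f t - `|a - b|).

Definition is_mrca alpha f s t r : Prop :=
  0 <= r <= 1 /\ anc alpha f r s /\ anc alpha f r t /\
  forall r', anc alpha f r' s -> anc alpha f r' t -> anc alpha f r' r.
Definition mrca alpha f s t : R := xget 0 [set r | is_mrca alpha f s t r].

Definition d0 alpha f s t : \bar R :=
  \esum_(r in [set r | sanc alpha f s r /\ anc alpha f r t])
     (delta alpha f r 0 (xpos alpha f r t))%:E.

Definition ltdist alpha f s t : \bar R :=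
  let m := mrca alpha f s t in
  ((delta alpha f m (xpos alpha f m s) (xpos alpha f m t))%:E
    + d0 alpha f m s + d0 alpha f m t)%E.

(** ---- metric notions for ([0,1]/~, D) with D : R -> R -> \bar R ---- *)
Definition unit_I : set R := `[0, 1].

Definition is_pseudo_dist (D : R -> R -> \bar R) : Prop :=
  forall x y z, x \in unit_I -> y \in unit_I -> z \in unit_I ->
    [/\ D x y \is a fin_num, (0 <= D x y)%E, D x x = 0%E, D x y = D y x
      & (D x z <= D x y + D y z)%E].

Definition dopen (D : R -> R -> \bar R) (U : set R) : Prop :=
  U `<=` unit_I /\
  forall x, U x -> exists2 e : R, 0 < e &
    forall y, unit_I y -> (D x y < e%:E)%E -> U y.

Definition dcompact (D : R -> R -> \bar R) : Prop :=
  forall (I : Type) (U : I -> set R), (forall i, dopen D (U i)) ->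
    unit_I `<=` \bigcup_i U i ->
    exists F : set I, finite_set F /\ unit_I `<=` \bigcup_(i in F) U i.

Definition ddiam (D : R -> R -> \bar R) (A : set R) : \bar R :=
  ereal_sup ([set 0%E] `|` [set D x y | x in A & y in A]).

Definition hcontent (D : R -> R -> \bar R) (s dl : R) : \bar R :=
  ereal_inf [set (\sum_(0 <= n <oo) (ddiam D (A n)) `^ s)%E
            | A in [set A : nat -> set R |
                    unit_I `<=` \bigcup_n A n /\
                    forall n, A n `<=` unit_I /\ (ddiam D (A n) <= dl%:E)%E]].

Definition hmeasure (D : R -> R -> \bar R) (s : R) : \bar R :=
  ereal_sup [set hcontent D s dl | dl in [set dl : R | 0 < dl]].

Definition hdim (D : R -> R -> \bar R) : \bar R :=
  ereal_inf [set s%:E | s in [set s : R | 0 <= s /\ hmeasure D s = 0%E]].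

Definition looptree_compact_dim alpha f : Prop :=
  let D := ltdist alpha f in
  [/\ is_pseudo_dist D, dcompact D & hdim D = alpha%:E].

End Looptree.

(* Main.v *)
(** Upper bound: [X] has no negative jumps, so exponential Chebyshev bounds and chaining
    give [X_t >= X_s - C (t - s)^gamma] for [s <= t] and every [gamma < 1/alpha]. Since
    [d(s,t) <= (X_s - I) + (X_(t-) - I)] with [I = inf_[s,t] X], cutting each of [n] equal
    time cells along the level sets of [X] at height multiples of [n^-gamma] produces
    O(n) sets of diameter O(n^-gamma), hence dimension at most [1/gamma]. Compactness
    follows from the same inequality, which makes [d] continuous.

    Lower bound: the mass distribution principle for Lebesgue measure. Fix the mesh
    [h = 2^-(L n^2)] and a cell [a, a + h]. At each of the [n] scales [h 2^(n j)] the path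
    has, independently of what happens later, a chance bounded below to make before [a] a
    jump of order [h^(1/alpha)] with the cell in the middle of the corresponding loop;
    soon after the cell the path falls below that loop. So, outside an event of
    probability O(theta^n), every point of the cell is at distance at least
    [kappa h^(1/alpha)] from all times farther than [H = h 2^(n (2 n + 1))]. By
    Borel-Cantelli, after removing a set of small measure, this holds at all fine scales,
    which gives dimension at least [s] when [s/alpha < (L - 2)/L]; let [L] grow. *)

Require Import Defs.
From HB Require Import structures.
From mathcomp Require Import all_boot all_order all_algebra.
From mathcomp Require Import finmap.
From mathcomp Require Import all_classical all_reals all_analysis.
From mathcomp Require Import measurable_realfun.
From mathcomp Require Import ring lra zify.
Set Implicit Arguments. Unset Strict Implicit. Unset Printing Implicit Defensive.
Import Order.TTheory GRing.Theory Num.Theory.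
Import numFieldNormedType.Exports.
Local Open Scope classical_set_scope.
Local Open Scope ring_scope.

(** * The looptree distance of an excursion *)

(** The process is given only by the joint Laplace transform of its increments, so independence has
    to be extracted from it. It is carried by the class [ind] of bounded variables that factor out
    of the Laplace transforms of later increments; a uniqueness theorem for Laplace transforms
    closes this class under indicators of increments, which suffices to run independent trials along
    deterministic times. Statements about all real times, whose measurability is unclear, are
    reduced to dyadic grids and receive outer bounds ([pbound]). A few almost sure properties of the
    path are extracted; then the excursion is treated path by path, and loops found in the original
    path are carried over by the affine change of time. The exponents quadratic in n are a
    compromise. Trials at n scales separated by factors 2^n disturb each other with probability O(n
    2^-n) only, but occupy a window of 2^(2 n^2 + n) meshes, which must be a small power of the
    inverse mesh. Bad cells are counted in expected Lebesgue measure, so that their number is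
    compensated by their length. *)

Section circle.
Variable R : realType.
Implicit Types (D a b c : R).

Lemma min_dist_ge0 D a b : 0 <= a <= D -> 0 <= b <= D ->
  0 <= Num.min `|a - b| (D - `|a - b|).
Proof.
move=> /andP[a0 aD] /andP[b0 bD]; rewrite le_min normr_ge0 subr_ge0 ler_norml/=.
by apply/andP; split; lra.
Qed.

(** The minimum is arc length on a circle of length [D]. Besides the triangle inequalities on the
    line, the one fact used is that the three gaps add up to at most [D + D], for the case where
    both arcs on the right wrap around. *)
Lemma min_dist_triangle D a b c : 0 <= a <= D -> 0 <= b <= D -> 0 <= c <= D ->
  Num.min `|a - c| (D - `|a - c|) <=
  Num.min `|a - b| (D - `|a - b|) + Num.min `|b - c| (D - `|b - c|).
Proof.
move=> /andP[a0 aD] /andP[b0 bD] /andP[c0 cD].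
have E (u v : R) : (`|u - v| = u - v /\ v <= u) \/ (`|u - v| = v - u /\ u <= v).
  have [uv|uv] := leP v u; [left|right].
    by split=> //; rewrite ger0_norm ?subr_ge0.
  by split=> //; [rewrite distrC ger0_norm ?subr_ge0// ltW|exact: ltW].
have [h1 h2 h3 h4] : [/\ `|a - c| <= `|a - b| + `|b - c|, `|b - c| <= `|a - b| + `|a - c|,
    `|a - b| <= `|a - c| + `|b - c| & `|a - b| + `|b - c| + `|a - c| <= D + D].
  by have [[-> ?]|[-> ?]] := E a c; have [[-> ?]|[-> ?]] := E a b;
    have [[-> ?]|[-> ?]] := E b c; split; lra.
move: h1 h2 h3 h4; move: `|a - c| `|a - b| `|b - c| => y x z h1 h2 h3 h4; clear -h1 h2 h3 h4.
have m1 : Num.min y (D - y) <= y by rewrite ge_min lexx.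
have m2 : Num.min y (D - y) <= D - y by rewrite ge_min lexx orbT.
by move: (Num.min y _) m1 m2 => m m1 m2; case: (leP x _) => _; case: (leP z _) => _; lra.
Qed.

End circle.

Section path.
Variables (R : realType) (alpha : R) (f : R -> R).
Local Notation x := (Xexc alpha f).
Local Notation xm := (Xexcm alpha f).
Local Notation I := (Iexc alpha f).
Local Notation D := (ltdist alpha f).

(** The deterministic interface between the process and the metric: right continuity, left limits
    equal to [xm], upward jumps, and nonnegativity on [0,1] from the value 0. *)
Record excursion : Prop := Excursion {
  exc_right : forall t e, 0 <= t -> 0 < e ->
    exists2 dl, 0 < dl & forall u, t <= u < t + dl -> `|x u - x t| < e;
  exc_left : forall t e, 0 < t -> 0 < e ->
    exists2 dl, 0 < dl & forall u, t - dl < u < t -> `|x u - xm t| < e;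
  exc_jump : forall t, 0 < t <= 1 -> xm t <= x t;
  exc_0 : x 0 = 0;
  exc_ge0 : forall t, 0 <= t <= 1 -> 0 <= x t }.

Hypothesis exc : excursion.

Lemma xm0 : xm 0 = 0. Proof. by rewrite /Xexcm eqxx. Qed.

Lemma xm_le t : 0 <= t <= 1 -> xm t <= x t.
Proof.
move=> /andP[]; rewrite le_eqVlt => /predU1P[<- _|t0 t1].
  by rewrite xm0 exc_0.
by apply: exc_jump => //; rewrite t0.
Qed.

Lemma has_inf_path s t : 0 <= s -> s <= t -> t <= 1 -> has_inf [set x u | u in `[s, t]].
Proof.
move=> s0 st t1; split; first by exists (x s), s => //=; rewrite in_itv/= lexx.
exists 0 => _ [u /= /[!in_itv]/= /andP[su ut] <-]; apply: exc_ge0 => //.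
by rewrite (le_trans s0)//= (le_trans ut).
Qed.

Lemma I_le s u t : 0 <= s -> s <= u -> u <= t -> t <= 1 -> I s t <= x u.
Proof.
move=> s0 su ut t1; apply: ge_inf.
  by have [] := has_inf_path s0 (le_trans su ut) t1.
by exists u => //=; rewrite in_itv/= su.
Qed.

Lemma I_glb s t c : s <= t -> (forall u, s <= u <= t -> c <= x u) -> c <= I s t.
Proof.
move=> st H; apply: lb_le_inf; first by exists (x s), s => //=; rewrite in_itv/= lexx.
by move=> _ [u /= /[!in_itv]/= ? <-]; exact: H.
Qed.

Lemma I_sub s s' t t' : 0 <= s -> s <= s' -> s' <= t' -> t' <= t -> t <= 1 ->
  I s t <= I s' t'.
Proof.
move=> s0 ss st tt t1; apply: I_glb => // u /andP[? ?].
by apply: I_le => //; [exact: le_trans ss _|exact: le_trans tt].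
Qed.

Lemma I_split s u t : 0 <= s -> s <= u -> u <= t -> t <= 1 ->
  I s t = Num.min (I s u) (I u t).
Proof.
move=> s0 su ut t1; apply/eqP; rewrite eq_le; apply/andP; split.
  by rewrite le_min; apply/andP; split; apply: I_sub => //; exact: le_trans su.
apply: I_glb => [|v /andP[sv vt]]; first exact: le_trans ut.
rewrite ge_min; have [vu|uv] := leP v u.
  by rewrite I_le// (le_trans ut).
by rewrite (I_le (le_trans s0 su) (ltW uv) vt t1) orbT.
Qed.

Lemma I_ge0 s t : 0 <= s -> s <= t -> t <= 1 -> 0 <= I s t.
Proof.
move=> s0 st t1; apply: I_glb => // u /andP[su ut].
by rewrite exc_ge0// (le_trans s0 su) (le_trans ut).
Qed.

Lemma xm_ge s t c : 0 <= s -> s < t -> (forall u, s <= u < t -> c <= x u) -> c <= xm t.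
Proof.
move=> s0 st H; rewrite leNgt; apply/negP => ltc.
have t0 := le_lt_trans s0 st.
have e0 : 0 < c - xm t by rewrite subr_gt0.
have [dl dl0 Hd] := exc_left exc t0 e0.
pose u := Num.max s (t - dl / 2).
have su : s <= u by rewrite le_max lexx.
have ut : u < t by rewrite gt_max st/=; lra.
have ud : t - dl < u by rewrite lt_max; apply/orP; right; lra.
have := H u; rewrite su ut => /(_ isT) Hu.
have := Hd u; rewrite ud ut => /(_ isT); rewrite ltr_distlC => /andP[]; lra.
Qed.

Lemma xm_le_sup s t c : 0 <= s -> s < t -> (forall u, s <= u < t -> x u <= c) -> xm t <= c.
Proof.
move=> s0 st H; rewrite leNgt; apply/negP => ltc.
have t0 := le_lt_trans s0 st.
have e0 : 0 < xm t - c by rewrite subr_gt0.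
have [dl dl0 Hd] := exc_left exc t0 e0.
pose u := Num.max s (t - dl / 2).
have su : s <= u by rewrite le_max lexx.
have ut : u < t by rewrite gt_max st/=; lra.
have ud : t - dl < u by rewrite lt_max; apply/orP; right; lra.
have := H u; rewrite su ut => /(_ isT) Hu.
have := Hd u; rewrite ud ut => /(_ isT); rewrite ltr_distlC => /andP[]; lra.
Qed.

(* Position of the ancestor [r] of [s] on the loop of [r], extended by 0 to all
   [r]; summing over all [r] removes the most recent common ancestor from [D]. *)
Definition xpos0 r s := if r <= s then Num.max 0 (I r s - xm r) else 0.

Lemma xpos0_anc r s : anc alpha f r s -> xpos0 r s = xpos alpha f r s.
Proof. by move=> [rs H]; rewrite /xpos0 rs /xpos; apply/max_idPr; rewrite subr_ge0. Qed.

Lemma xpos0_nanc r s : ~ anc alpha f r s -> xpos0 r s = 0.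
Proof.
rewrite /xpos0 => H; case: ifPn => // rs; apply/max_idPl; rewrite subr_le0 leNgt.
by apply/negP => lt; apply: H; split=> //; exact: ltW.
Qed.

Lemma xpos0_bound r s : 0 <= r <= 1 -> s <= 1 -> 0 <= xpos0 r s <= Jump alpha f r.
Proof.
move=> /andP[r0 r1] s1; rewrite /xpos0; case: ifPn => rs; last first.
  by rewrite lexx/= subr_ge0 xm_le// r0.
rewrite le_max lexx/= ge_max subr_ge0 xm_le ?r0//=.
by rewrite lerD2r I_le.
Qed.

Lemma xpos0_ge0 r s : 0 <= xpos0 r s.
Proof. by rewrite /xpos0; case: ifP => //; rewrite le_max lexx. Qed.

Definition dist_term s t r := delta alpha f r (xpos0 r s) (xpos0 r t).

Lemma dist_term_ge0 s t r : 0 <= r <= 1 -> s <= 1 -> t <= 1 -> 0 <= dist_term s t r.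
Proof. by move=> r01 s1 t1; apply: min_dist_ge0; exact: xpos0_bound. Qed.

(** Here [r] may be negative, since [is_mrca] compares with all real ancestors. Then the path may be
    unbounded below on [r, s], and [inf] takes its default value 0. As the path is nonnegative on
    [m, s], it is then unbounded below on [r, m] too, and both infima equal that default. *)
Lemma Iexc_subset r m s : m <= s -> r <= m -> 0 <= m -> s <= 1 ->
  I r s <= I r m.
Proof.
move=> ms rm m0 s1.
have sub : [set x u | u in `[r, m]] `<=` [set x u | u in `[r, s]].
  move=> _ [u /= /[!in_itv]/= /andP[ru um] <-]; exists u => //=.
  by rewrite in_itv/= ru (le_trans um).
have [[y Hy]|nlb] := pselect (has_lbound [set x u | u in `[r, s]]).
  apply: lb_le_inf; first by exists (x r), r => //=; rewrite in_itv/= lexx.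
  by move=> y' /sub; apply: ge_inf; exists y.
rewrite /Iexc inf_out; last by case.
rewrite inf_out//; move=> [_ [y Hy]]; apply: nlb; exists (Num.min y 0).
move=> _ [u /= /[!in_itv]/= /andP[ru us] <-]; rewrite ge_min.
have [um|mu] := leP u m.
  by apply/orP; left; apply: Hy; exists u => //=; rewrite in_itv/= ru.
by rewrite (exc_ge0 exc) ?orbT// (le_trans m0 (ltW mu)) (le_trans us).
Qed.

(** The candidate is the supremum [m] of the common ancestors. If it is not one of them, ancestors
    [r] increase to [m], so [xm r] approaches [xm m] while staying below the path from [m] to [s]
    and to [t]; hence [m] is a common ancestor after all. *)
Lemma mrca_exists s t : 0 <= s <= 1 -> 0 <= t <= 1 ->
  exists m, is_mrca alpha f s t m.
Proof.
move=> /andP[s0 s1] /andP[t0 t1].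
pose S := [set r | 0 <= r <= 1 /\ anc alpha f r s /\ anc alpha f r t].
have S0 : S 0.
  split; first by rewrite lexx ler01.
  by split; split=> //; rewrite xm0; apply: I_ge0.
have hS : has_sup S by split; [exists 0|exists 1 => r [/andP[]]].
pose m := sup S.
have mub r : S r -> r <= m by move=> Sr; apply: ub_le_sup => //; case: hS.
have m0 : 0 <= m := mub _ S0.
have mle v : (forall r, S r -> r <= v) -> m <= v by move=> H; apply: ge_sup; [exists 0|].
have ms : m <= s by apply: mle => r [_ [[]]].
have mt : m <= t by apply: mle => r [_ [_ []]].
have ancm v : v <= 1 -> m <= v -> (forall r, S r -> anc alpha f r v) -> anc alpha f m v.
  move=> v1 mv H; split=> //; have [Sm|nSm] := pselect (S m); first by case: (H _ Sm).
  apply: I_glb => // u /andP[mu uv].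
  have m_gt0 : 0 < m.
    by rewrite lt_neqAle m0 andbT; apply/eqP => m00; apply: nSm; rewrite -m00.
  apply/ler_addgt0Pr => e e0.
  have [dl dl0 Hd] := exc_left exc m_gt0 e0.
  have dl'0 : 0 < Num.min dl m by rewrite lt_min dl0.
  have [r Sr] := sup_adherent dl'0 hS; rewrite -/m => rm.
  have [/andP[r0 r1] _] := Sr.
  have rltm : r < m.
    by rewrite lt_neqAle mub// andbT; apply/eqP => E; apply: nSm; rewrite -E.
  have dlm : Num.min dl m <= dl by rewrite ge_min lexx.
  have dlm' : Num.min dl m <= m by rewrite ge_min lexx orbT.
  have r_gt0 : 0 < r by lra.
  have /(le_trans _) : xm r <= x u.
    have [rv Hr] := H _ Sr; apply: (le_trans Hr); apply: I_le => //.
    exact: le_trans (ltW rltm) mu.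
  have H1 : xm m - e <= xm r.
    apply: (@xm_ge (Num.max 0 (m - Num.min dl m + (r - (m - Num.min dl m)) / 2))).
    - by rewrite le_max lexx.
    - by rewrite gt_max r_gt0/=; lra.
    - move=> w /andP[]; rewrite ge_max => /andP[w0 w1] w2.
      have := Hd w; rewrite ltr_distlC.
      have -> : m - dl < w < m by apply/andP; split; lra.
      by move=> /(_ isT)/andP[]; lra.
  by move=> /(_ _ H1); lra.
exists m; split; first by rewrite m0 (le_trans ms).
have ams : anc alpha f m s by apply: ancm => // r [_ []].
have amt : anc alpha f m t by apply: ancm => // r [_ []].
split=> //; split=> // r [rs Hr] [rt Hr'].
have rm : r <= m.
  have [r0|r0] := leP 0 r; last by apply: le_trans (ltW r0) m0.
  by apply: mub; split; [rewrite r0 (le_trans rs)|split; split].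
by split=> //; apply: (le_trans Hr); exact: Iexc_subset.
Qed.

Lemma mrcaP s t : 0 <= s <= 1 -> 0 <= t <= 1 -> is_mrca alpha f s t (mrca alpha f s t).
Proof.
move=> s01 t01; rewrite /mrca.
by case: xgetP => [r _ //|/= H]; have [m /H] := mrca_exists s01 t01.
Qed.

(** [I r m <= xm m <= I m s]: what follows [m] does not lower the infimum from [r], so all
    descendants of [m] sit at the same point of the loop of [r]. *)
Lemma xpos0_below m s r : 0 <= r -> r < m -> anc alpha f m s -> s <= 1 -> xpos0 r s = xpos0 r m.
Proof.
move=> r0 rm [ms Hm] s1; rewrite /xpos0 (ltW rm) (le_trans (ltW rm) ms).
rewrite (I_split (u:=m))// ?(ltW rm)//.
have H : I r m <= I m s.
  apply: le_trans Hm; apply: (xm_ge r0 rm) => u /andP[ru um].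
  by apply: I_le => //; [exact: ltW|exact: le_trans s1].
by congr (Num.max _ (_ - _)); apply/min_idPl.
Qed.

Lemma delta_sym r a b : delta alpha f r a b = delta alpha f r b a.
Proof. by rewrite /delta distrC. Qed.

Lemma deltaxx r a : 0 <= r <= 1 -> delta alpha f r a a = 0.
Proof.
move=> r01; rewrite /delta subrr normr0 subr0; apply/min_idPl.
by rewrite subr_ge0 xm_le.
Qed.

Definition unit_set : set R := [set r | 0 <= r <= 1].

(** Term by term: for [r] before the common ancestor the two positions agree; at it the term is the
    arc of the definition; after it, maximality lets [r] be an ancestor of at most one of the two
    times, and the other position is 0. *)
Lemma ltdistE s t : 0 <= s <= 1 -> 0 <= t <= 1 ->
  D s t = \esum_(r in unit_set) (dist_term s t r)%:E.
Proof.
move=> s01 t01; rewrite /ltdist; set m := mrca _ _ _ _.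
have [m01 [ams [amt mmax]]] := mrcaP s01 t01; rewrite -/m in m01 ams amt mmax.
have /andP[s0 s1] := s01; have /andP[t0 t1] := t01; have /andP[m0 m1] := m01.
pose B u := [set r | sanc alpha f m r /\ anc alpha f r u].
have Bsub u : u <= 1 -> unit_set `&` B u = B u.
  move=> u1; apply/setIidPr => r [[[mr _] _] [ru _]].
  by rewrite /unit_set/= (le_trans m0 mr) (le_trans ru u1).
have msub : unit_set `&` [set m] = [set m].
  by apply/setIidPr => r ->.
have d0E u : u <= 1 -> d0 alpha f m u = \esum_(r in unit_set)
    (if r \in B u then delta alpha f r 0 (xpos0 r u) else 0)%:E.
  move=> u1; rewrite /d0 -/(B u) -[in LHS](Bsub u u1) esum_mkcondr.
  apply: eq_esum => r _; case: ifPn => [/set_mem[_ ar]|//].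
  by rewrite xpos0_anc.
have d_m : (delta alpha f m (xpos alpha f m s) (xpos alpha f m t))%:E =
   \esum_(r in unit_set) (if r \in [set m] then dist_term s t m else 0)%:E.
  transitivity (\esum_(r in [set m]) (dist_term s t r)%:E).
    by rewrite esum_set1 ?lee_fin ?dist_term_ge0// /dist_term !xpos0_anc.
  rewrite -[in LHS]msub esum_mkcondr; apply: eq_esum => r _.
  by case: ifPn => [/set_mem ->|].
have Bge0 u r : u <= 1 -> unit_set r ->
    0 <= (if r \in B u then delta alpha f r 0 (xpos0 r u) else 0).
  move=> u1 r01; case: ifP => // _; apply: min_dist_ge0; last exact: xpos0_bound.
  by rewrite lexx/= subr_ge0 xm_le.
have mge0 r : unit_set r -> 0 <= (if r \in [set m] then dist_term s t m else 0).
  by move=> _; case: ifP => // _; apply: dist_term_ge0.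
rewrite d_m !d0E// -!esumD; try by move=> r r01;
  rewrite -?EFinD lee_fin ?addr_ge0 ?Bge0 ?mge0.
apply: eq_esum => r r01; rewrite -!EFinD; congr EFin.
have [->|/eqP rm] := eqVneq r m.
  rewrite mem_set//= !memNset ?addr0//; by move=> [[_ /=]].
rewrite (memNset (_ : ~ [set m] r))// add0r.
have [r0 r1] := andP r01.
have [rltm|mler] := ltP r m.
  rewrite !memNset; try by move=> [[[+ _] _] _]; rewrite leNgt rltm.
  by rewrite addr0 /dist_term (xpos0_below r0 rltm ams s1) (xpos0_below r0 rltm amt t1) deltaxx.
have mltr : m < r by rewrite lt_neqAle mler andbT eq_sym; apply/eqP.
have am u : anc alpha f m u -> r <= u -> u <= 1 -> anc alpha f m r.
  by move=> [mu Hmu] ru u1; split=> //; apply: (le_trans Hmu); exact: I_sub.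
have nB u : anc alpha f m u -> u <= 1 -> anc alpha f r u -> r \in B u.
  move=> amu u1 aru; rewrite inE; split=> //; split; last exact/nesym.
  by apply: (am u) => //; case: aru.
have nboth : anc alpha f r s -> ~ anc alpha f r t.
  by move=> ars art; have [+ _] := mmax _ ars art; rewrite leNgt mltr.
have [ars|nars] := pselect (anc alpha f r s).
  rewrite (nB s)// memNset; last by move=> [_]; exact: nboth.
  by rewrite addr0 /dist_term (xpos0_nanc (nboth ars)) delta_sym.
rewrite (memNset (_ : ~ B s r)); last by case.
rewrite add0r /dist_term (xpos0_nanc nars).
have [art|nart] := pselect (anc alpha f r t); first by rewrite (nB t).
by rewrite memNset ?(xpos0_nanc nart) ?deltaxx//; case.
Qed.

Lemma ltdist_ge0 s t : 0 <= s <= 1 -> 0 <= t <= 1 -> (0 <= D s t)%E.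
Proof.
move=> s01 t01; rewrite ltdistE//; apply: esum_ge0 => r r01; rewrite lee_fin dist_term_ge0//.
  by have /andP[] := s01.
by have /andP[] := t01.
Qed.

Lemma ltdistxx s : 0 <= s <= 1 -> D s s = 0%E.
Proof. by move=> s01; rewrite ltdistE// esum1// => r r01; rewrite /dist_term deltaxx. Qed.

Lemma ltdist_sym s t : 0 <= s <= 1 -> 0 <= t <= 1 -> D s t = D t s.
Proof.
by move=> s01 t01; rewrite !ltdistE//; apply: eq_esum => r _; rewrite /dist_term delta_sym.
Qed.

(** Termwise on each loop, which the form of [ltdistE] makes possible: its index set does not depend
    on the two times. *)
Lemma ltdist_triangle s t u : 0 <= s <= 1 -> 0 <= t <= 1 -> 0 <= u <= 1 ->
  (D s u <= D s t + D t u)%E.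
Proof.
move=> s01 t01 u01; rewrite !ltdistE//.
have /andP[s0 s1] := s01; have /andP[t0 t1] := t01; have /andP[u0 u1] := u01.
rewrite -esumD; first last.
- by move=> r r01; rewrite lee_fin dist_term_ge0.
- by move=> r r01; rewrite lee_fin dist_term_ge0.
apply: le_esum => r r01; rewrite -EFinD lee_fin.
by apply: min_dist_triangle; exact: xpos0_bound.
Qed.

End path.

(** * Upper and lower bounds, continuity and compactness for the looptree distance *)

Section path_bounds.
Variables (R : realType) (alpha : R) (f : R -> R).
Local Notation x := (Xexc alpha f).
Local Notation xm := (Xexcm alpha f).
Local Notation I := (Iexc alpha f).
Local Notation D := (ltdist alpha f).
Local Notation F := (dist_term alpha f).
Local Notation xt := (xpos0 alpha f).
Hypothesis exc : excursion alpha f.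

(** Length of the part of the height interval [(xm r, I r t]] above [c]. *)
Definition slab t c r := Num.max 0 (I r t - Num.max (xm r) c).

(* The intervals [(xm r, I r t]] are pairwise disjoint. *)
Lemma sum_slab (l : seq R) t c v : t <= 1 -> c <= v -> sorted <%R l ->
  (forall r, r \in l -> [/\ 0 <= r, r <= t & I r t <= v]) ->
  \sum_(r <- l) slab t c r <= v - c.
Proof.
move=> t1; elim: l c => [|r l IH] c cv /= sl Hl.
  by rewrite big_nil subr_ge0.
have [r0 rt Hr] := Hl r (mem_head _ _).
have rl : {in l, forall r', r < r'}.
  by apply/allP; apply: order_path_min sl; exact: lt_trans.
(* Since [xm r' >= I r t] for [r'] after [r], raising the floor from [c] to [c'] changes none of the
   later slabs. *)
pose c' := Num.max c (I r t).
have c'v : c' <= v by rewrite ge_max cv.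
have -> : \sum_(i <- r :: l) slab t c i = slab t c r + \sum_(i <- l) slab t c' i.
  rewrite big_cons; congr (_ + _); apply: eq_big_seq => r' r'l.
  rewrite /slab; congr (Num.max _ (_ - _)).
  rewrite /c' [Num.max c _]maxC maxA [Num.max _ (I r t)](max_idPl _)//.
  apply: (xm_ge exc r0 (rl _ r'l)) => u /andP[ru ur']; apply: (I_le exc) => //.
  have r'l' : r' \in r :: l by rewrite inE r'l orbT.
  by have [_ r't _] := Hl r' r'l'; rewrite (le_trans (ltW ur')).
have -> : v - c = (c' - c) + (v - c') by lra.
apply: lerD.
  rewrite /slab ge_max subr_ge0 le_max lexx/=.
  have : c <= Num.max (xm r) c by rewrite le_max lexx orbT.
  have : I r t <= c' by rewrite le_max lexx orbT.
  lra.
apply: IH => //; first exact: path_sorted sl.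
by move=> r' r'l; apply: Hl; rewrite inE r'l orbT.
Qed.

(** Below the height [I s t] both times have the same position on the loop of an earlier [r], so
    only slabs above that height count. *)
Definition diff_bound s t r :=
  (if r <= s then slab s (I s t) r else 0) + (if s < r < t then slab t (I s t) r else 0).

Lemma delta_le r a b : delta alpha f r a b <= `|a - b|.
Proof. by rewrite /delta ge_min lexx. Qed.

Lemma dist_term_le s t r : 0 <= s -> s < t -> t <= 1 -> 0 <= r <= 1 ->
  F s t r <= diff_bound s t r.
Proof.
move=> s0 st t1 /andP[r0 r1]; rewrite /F /diff_bound /dist_term.
have [rs|sr] := leP r s.
  rewrite addr0; apply: (le_trans (delta_le _ _ _)).
  rewrite /xpos0 rs (le_trans rs (ltW st)) (I_split exc r0 rs (ltW st) t1).
  rewrite /slab; have := I_le exc r0 (lexx r) rs (le_trans (ltW st) t1).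
  move: (I r s) (I s t) (xm r) => A i m _.
  have M (p q : R) : (Num.max p q = p /\ q <= p) \/ (Num.max p q = q /\ p <= q).
    by have [pq|/ltW qp] := leP p q; [right|left].
  have N (p q : R) : (Num.min p q = p /\ p <= q) \/ (Num.min p q = q /\ q <= p).
    by have [pq|/ltW qp] := leP p q; [left|right].
  rewrite ler_norml; apply/andP.
  have [[-> ?]|[-> ?]] := N A i; have [[-> ?]|[-> ?]] := M m i;
    have [[-> ?]|[-> ?]] := M 0 (A - m);
    try (have [[-> ?]|[-> ?]] := M 0 (i - m));
    try (have [[-> ?]|[-> ?]] := M 0 (A - i)); split; lra.
rewrite add0r /=; have -> : xt r s = 0 by rewrite /xpos0 leNgt sr.
have [rt|tr|->] := ltgtP r t.
- apply: (le_trans (delta_le _ _ _)); rewrite sub0r normrN /xpos0 (ltW rt).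
  rewrite /slab ger0_norm; last by rewrite le_max lexx.
  suff -> : Num.max (xm r) (I s t) = xm r by rewrite lexx.
  apply/max_idPl; apply: (xm_ge exc s0 sr) => u /andP[su ur].
  by apply: (I_le exc) => //; exact: le_trans (ltW ur) (ltW rt).
- by rewrite /xpos0 [r <= t]leNgt tr/= (deltaxx exc)// r0.
(* At [r = t] the position is the whole jump, which is the origin of the loop again: the term
   vanishes, and this is why the distance is bounded with [xm t] instead of [x t]. *)
- have t01 : 0 <= t <= 1 by rewrite (le_trans s0 (ltW st)).
  rewrite /xpos0 lexx.
  have -> : I t t = x t.
    apply/eqP; rewrite eq_le (I_le exc)//=; last by have /andP[] := t01.
    by apply: I_glb => // u; rewrite -eq_le => /eqP ->.
  have J0 : 0 <= Jump alpha f t by rewrite subr_ge0 xm_le.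
  rewrite (max_idPr _)// /delta sub0r normrN ger0_norm//.
  by rewrite -/(Jump alpha f t) subrr ge_min lexx orbT.
Qed.

(** Each finite partial sum, sorted in time, is bounded by two families of disjoint slabs above
    [I s t]: those of [s] fit below [x s], those of [t] below [xm t] because [I r t <= xm t] when
    [r < t]. *)
Lemma ltdist_le s t : 0 <= s -> s < t -> t <= 1 ->
  (D s t <= ((x s - I s t) + (xm t - I s t))%:E)%E.
Proof.
move=> s0 st t1.
have s1 := le_trans (ltW st) t1; have t0 := le_trans s0 (ltW st).
rewrite (ltdistE exc) ?s0 ?t0//.
apply: ge_ereal_sup => _ [A [finA Asub] <-].
rewrite fsbig_finite//= sumEFin lee_fin.
pose l := sort <=%R (finmap.enum_fset (fset_set A)).
have pl : perm_eq l (finmap.enum_fset (fset_set A)) by rewrite perm_sort.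
rewrite -(perm_big _ pl)/=.
have sl : sorted <%R l.
  by rewrite lt_sorted_uniq_le sort_le_sorted// (perm_uniq pl) finmap.fset_uniq andbT.
have lA r : r \in l -> 0 <= r <= 1.
  by rewrite (perm_mem pl) in_fset_set// inE => /Asub.
have Ixs : I s t <= x s by apply: (I_le exc) => //; exact: ltW.
have Ixt : I s t <= xm t.
  apply: (xm_ge exc s0 st) => u /andP[su ut].
  by apply: (I_le exc) => //; exact: ltW.
apply: (@le_trans _ _ (\sum_(r <- l) diff_bound s t r)).
  rewrite big_seq [leRHS]big_seq; apply: ler_sum => r rl.
  by apply: dist_term_le => //; exact: lA.
rewrite /diff_bound big_split/=; apply: lerD.
  rewrite -big_mkcond/= -big_filter; apply: sum_slab => //.
    by apply: sorted_filter => //; exact: lt_trans.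
  move=> r; rewrite mem_filter => /andP[rs /lA/andP[r0 r1]]; split=> //.
  by apply: (I_le exc).
rewrite -big_mkcond/= -big_filter; apply: sum_slab => //.
  by apply: sorted_filter => //; exact: lt_trans.
move=> r; rewrite mem_filter => /andP[/andP[sr rt] /lA/andP[r0 r1]]; split=> //.
  exact: ltW.
apply: (xm_ge exc r0 rt) => u /andP[ru ut].
by apply: (I_le exc) => //; exact: ltW.
Qed.

Lemma ltdist_fin s t : 0 <= s <= 1 -> 0 <= t <= 1 -> D s t \is a fin_num.
Proof.
move=> s01 t01.
have H u v : 0 <= u -> u < v -> v <= 1 -> D u v \is a fin_num.
  move=> u0 uv v1; have u01 : 0 <= u <= 1 by rewrite u0 (le_trans (ltW uv)).
  have v01 : 0 <= v <= 1 by rewrite (le_trans u0 (ltW uv)).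
  rewrite ge0_fin_numE ?(ltdist_ge0 exc)//.
  exact: le_lt_trans (ltdist_le u0 uv v1) (ltry _).
have /andP[s0 s1] := s01; have /andP[t0 t1] := t01.
have [st|ts|->] := ltgtP s t; first exact: H.
  by rewrite (ltdist_sym exc)//; exact: H.
by rewrite (ltdistxx exc).
Qed.

Lemma ltdist_pseudo_dist : is_pseudo_dist D.
Proof.
move=> u v w; rewrite !inE /unit_I/= !in_itv/= => u01 v01 w01; split.
- exact: ltdist_fin.
- exact: (ltdist_ge0 exc).
- exact: (ltdistxx exc).
- exact: (ltdist_sym exc).
- exact: (ltdist_triangle exc).
Qed.

(** From the right, [ltdist_le] only sees values close to [x u]; from the left, only values close to
    [xm u]. Hence a jump at [u] does not spoil continuity. *)
Lemma ltdist_continuous u e : 0 <= u <= 1 -> 0 < e ->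
  exists2 dl, 0 < dl & forall y, 0 <= y <= 1 -> `|y - u| < dl -> (D u y < e%:E)%E.
Proof.
move=> u01 e0; have /andP[u0 u1] := u01.
have e4 : 0 < e / 4 by rewrite divr_gt0.
have [d1 d10 H1] := exc_right exc u0 e4.
have [d2 d20 H2] : exists2 d2, 0 < d2 & forall y, 0 <= y -> u - d2 < y < u -> (D u y < e%:E)%E.
  move: u0; rewrite le_eqVlt => /predU1P[u0|u0].
    by exists 1 => // y y0; rewrite -u0 => /andP[_]; rewrite ltNge y0.
  have [d2 d20 H2] := exc_left exc u0 e4.
  exists d2 => // y y0 /andP[uy yu].
  rewrite (ltdist_sym exc) ?y0 ?(ltW u0) ?u1 ?(le_trans (ltW yu))//.
  apply: le_lt_trans (ltdist_le y0 yu u1) _; rewrite lte_fin.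
  have Hy := H2 y; rewrite yu uy ltr_distlC in Hy; have /andP[? ?] := Hy isT.
  have : xm u - e / 4 <= I y u.
    apply: I_glb; first exact: ltW.
    move=> v /andP[yv]; rewrite le_eqVlt => /predU1P[->|vu].
      by apply: (@le_trans _ _ (xm u)); [lra|exact: xm_le].
    have := H2 v; rewrite vu (lt_le_trans uy yv) ltr_distlC => /(_ isT)/andP[]; lra.
  lra.
exists (Num.min d1 d2); first by rewrite lt_min d10.
move=> y /andP[y0 y1]; rewrite lt_min !ltr_distl => /andP[/andP[a1 a2] /andP[a3 a4]].
have [uy|yu|->] := ltgtP u y; first last.
- by rewrite (ltdistxx exc)// ?lte_fin// y0.
- by apply: H2 => //; rewrite yu a3.
have H v : u <= v -> v <= y -> x u - e / 4 < x v < x u + e / 4.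
  by move=> uv vy; rewrite -ltr_distl; apply: H1; rewrite uv (le_lt_trans vy).
apply: le_lt_trans (ltdist_le u0 uy y1) _; rewrite lte_fin.
have : x u - e / 4 <= I u y.
  by apply: I_glb => [|v /andP[uv vy]]; [exact: ltW|have /andP[/ltW] := H v uv vy].
have : xm y <= x u + e / 4.
  apply: (xm_le_sup exc u0 uy) => v /andP[uv vy].
  by have /andP[_ /ltW] := H v uv (ltW vy).
lra.
Qed.

Lemma ltdist_compact : dcompact D.
Proof.
move=> J U oU cU.
(* [J] may be empty, hence the [option]: outside [0,1] there may be no index to choose. *)
have /= ch u : exists p : R * option J, unit_I u ->
    0 < p.1 /\ exists2 i, p.2 = Some i & forall y, unit_I y -> `|y - u| < p.1 -> U i y.
  have [uI|nu] := pselect (unit_I u); last by exists (0, None).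
  have [i _ Ui] := cU u uI.
  have [_ /(_ u Ui)[e e0 He]] := oU i.
  have u01 : 0 <= u <= 1 by move: uI; rewrite /unit_I/= in_itv.
  have [dl dl0 Hdl] := ltdist_continuous u01 e0.
  exists (dl, Some i) => _; split=> //; exists i => // y yI yu; apply: He => //.
  by apply: Hdl => //; move: yI; rewrite /unit_I/= in_itv.
have [p Hp] := choice ch.
have := @segment_compact R 0 1; rewrite compact_cover.
move=> /(_ R (@unit_I R) (fun u => ball u (p u).1)) [|u uI|G GI Gc].
- by move=> u uI; apply: ball_open; have [] := Hp u uI.
- by exists u => //; apply: ballxx; have [] := Hp u uI.
have [J0|nJ] := pselect (exists i : J, True); last first.
  have [|i] := cU 0; first by rewrite /unit_I/= in_itv/= lexx ler01.
  by exfalso; apply: nJ; exists i.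
have [i0 _] := J0.
exists [set (odflt i0 (p u).2) | u in [set` G]]; split.
  by apply: finite_image; exact: finite_fset.
move=> y yI; have [u uG uy] := Gc y yI.
have [p0 [i pi Hi]] : 0 < (p u).1 /\ exists2 i, (p u).2 = Some i &
    forall y, unit_I y -> `|y - u| < (p u).1 -> U i y.
  by apply: Hp; have := GI u uG; rewrite inE.
exists i; first by exists u => //=; rewrite pi.
by apply: Hi => //; rewrite distrC.
Qed.

(** The single term of [r] suffices. On its loop [u] keeps [rho] away from both ends, while [t] lies
    at the origin (if [t < r]) or at least [rho] lower than [u] (if the path has fallen), so both
    arcs between them have length at least [rho]. *)
Lemma ltdist_loop r u t rho : 0 < r -> r <= u -> u <= 1 -> 0 <= t <= 1 -> 0 <= rho ->
  xm r + rho <= I r u -> I r u + rho <= x r ->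
  (t < r) || (u <= t) && (I u t <= I r u - rho) -> (rho%:E <= D u t)%E.
Proof.
move=> r0 ru u1 t01 rho0 H1 H2 H3; have /andP[t0 t1] := t01.
have u01 : 0 <= u <= 1 by rewrite (le_trans (ltW r0) ru).
have r01 : 0 <= r <= 1 by rewrite (ltW r0) (le_trans ru).
rewrite (ltdistE exc)//; apply: esum_ge; exists [set r].
  by split=> [|_ ->]; [exact: finite_set1|].
rewrite fsbig_set1 lee_fin /F /dist_term /delta.
have -> : xt r u = I r u - xm r.
  by rewrite /xpos0 ru; apply/max_idPr; rewrite subr_ge0; lra.
rewrite le_min -{2}(ger0_norm rho0).
have H (a : R) : 0 <= a -> a <= I r u - xm r - rho ->
    (rho <= `|I r u - xm r - a|) && (`|rho| <= Jump alpha f r - `|I r u - xm r - a|).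
  move=> a0 aH; rewrite !ger0_norm//; last lra.
  by rewrite /Jump; apply/andP; split; lra.
apply: H; first exact: xpos0_ge0.
move: H3 => /orP[tr|/andP[ut HI]]; first by rewrite /xpos0 [r <= t]leNgt tr/=; lra.
rewrite /xpos0 (le_trans ru ut) (I_split exc (ltW r0) ru ut t1).
rewrite ge_max; apply/andP; split; first by lra.
have : Num.min (I r u) (I u t) <= I u t by rewrite ge_min lexx orbT.
lra.
Qed.

End path_bounds.

(** * Hausdorff measures *)

Section hausdorff.
Variable R : realType.
Implicit Types (D : R -> R -> \bar R) (s : R).

Lemma ddiam_le D (A : set R) (c : R) : 0 <= c ->
  (forall u t, A u -> A t -> (D u t <= c%:E)%E) -> (ddiam D A <= c%:E)%E.
Proof.
move=> c0 H; apply: ge_ereal_sup => _ [->|[u Au [t At <-]]]; last exact: H.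
by rewrite lee_fin.
Qed.

Lemma ddiam_ge0 D (A : set R) : (0 <= ddiam D A)%E.
Proof. by apply: ereal_sup_ubound; left. Qed.

Lemma ddiam_ge D (A : set R) u t : A u -> A t -> (D u t <= ddiam D A)%E.
Proof. by move=> Au At; apply: ereal_sup_ubound; right; exists u => //; exists t. Qed.

Lemma ddiam0 D : ddiam D set0 = 0%E.
Proof. by apply/eqP; rewrite eq_le ddiam_ge0 andbT; exact: ddiam_le. Qed.

Lemma hcontent_ge0 D s dl : (0 <= hcontent D s dl)%E.
Proof.
apply: le_ereal_inf_tmp => _ [A _ <-].
by apply: nneseries_ge0 => n _ _; exact: poweR_ge0.
Qed.

Lemma hmeasure0 D s :
  (forall e dl : R, 0 < e -> 0 < dl -> exists2 A : nat -> set R,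
     @unit_I R `<=` \bigcup_n A n /\
       forall n, A n `<=` @unit_I R /\ (ddiam D (A n) <= dl%:E)%E &
     (\sum_(0 <= n <oo) (ddiam D (A n)) `^ s <= e%:E)%E) ->
  hmeasure D s = 0%E.
Proof.
move=> H; apply/eqP; rewrite eq_le; apply/andP; split.
  apply: ge_ereal_sup => _ [dl /= dl0 <-]; apply/lee_addgt0Pr => e e0.
  rewrite add0e; apply: ge_ereal_inf.
  by have [A HA Ae] := H e dl e0 dl0; eexists; [exists A|].
apply: le_ereal_sup_tmp; exists (hcontent D s 1); first by exists 1 => /=.
exact: hcontent_ge0.
Qed.

(* Mass distribution principle for Lebesgue measure restricted to [G]. *)
Lemma hmeasure_gt0 D s (G : set R) (C : R) (H rho : nat -> R) :
  measurable G -> G `<=` @unit_I R -> (0 < lebesgue_measure G)%E ->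
  0 <= s -> 0 < C -> (forall m, 0 < H m) -> (forall m, 0 < rho m) ->
  H @ \oo --> 0 -> rho @ \oo --> 0 ->
  (forall m, 2 * H m <= C * rho m.+1 `^ s) ->
  (forall m u t, G u -> unit_I t -> H m <= `|t - u| -> ((rho m)%:E <= D u t)%E) ->
  hmeasure D s != 0%E.
Proof.
move=> mG GI G0 s0 C0 H0 rho0 cH crho HC Hd.
suff : (0 < C^-1%:E * lebesgue_measure G <= hmeasure D s)%E.
  by move=> /andP[h1 h2]; rewrite gt_eqF// (lt_le_trans h1).
apply/andP; split; first by rewrite mule_gt0// lte_fin invr_gt0.
(* Half of [rho 0], so that for a set of positive diameter [dd] in the cover the first scale with
   [rho <= dd] is not scale 0 and has a predecessor. *)
apply: le_ereal_sup_tmp; exists (hcontent D s (rho 0%N / 2)).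
  by exists (rho 0%N / 2) => //=; rewrite divr_gt0.
apply: le_ereal_inf_tmp => _ [A [cA HA] <-].
rewrite lee_pdivrMl//.
(* The sets [A n] may fail to be measurable; the trace of each on [G] is enclosed in a measurable
   [J]: empty, a point if the diameter is 0, or an interval. *)
have exJ n : exists J : set R, [/\ measurable J, A n `&` G `<=` J &
    (lebesgue_measure J <= C%:E * (ddiam D (A n)) `^ s)%E].
  have [AI dA] := HA n.
  have pos : (0 <= C%:E * (ddiam D (A n)) `^ s)%E.
    by rewrite mule_ge0 ?poweR_ge0// lee_fin ltW.
  have [[u [Au Gu]]|nAG] := pselect (exists u, A n u /\ G u); last first.
    exists set0; rewrite measure0; split => // u AGu.
    by exfalso; apply: nAG; exists u; case: AGu.
  have [d0|d0] := eqVneq (ddiam D (A n)) 0%E.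
    exists [set u]; rewrite lebesgue_measure_set1; split => // v [Av Gv].
    apply/eqP; rewrite -subr_eq0 -normr_le0; apply/ler_addgt0Pr => e e0.
    rewrite add0r; have /cvgrPdist_lt /(_ _ e0)[N _ /(_ N (leqnn _))] := cH.
    rewrite sub0r normrN => HN; apply: le_trans (ltW HN); rewrite leNgt.
    apply/negP => lt; have := Hd N u v Gu (AI _ Av).
    move=> /(_ (le_trans (ler_norm _) (ltW lt))).
    have := ddiam_ge D Au Av; rewrite d0 => le0 le1.
    by have := le_trans le1 le0; rewrite lee_fin leNgt rho0.
  have dfin : ddiam D (A n) \is a fin_num.
    by rewrite ge0_fin_numE ?ddiam_ge0// (le_lt_trans dA)// ltry.
  have [dd Ed] : exists dd, ddiam D (A n) = dd%:E.
    by exists (fine (ddiam D (A n))); rewrite fineK.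
  rewrite Ed in dA d0 pos *.
  have dd0 : 0 < dd.
    have := ddiam_ge0 D (A n); rewrite Ed lee_fin lt_neqAle => ->.
    by rewrite eq_sym andbT -eqe.
  have exm : exists m, rho m <= dd.
    have /cvgrPdist_lt /(_ _ dd0)[N _ /(_ N (leqnn _))] := crho.
    by rewrite sub0r normrN gtr0_norm// => /ltW; exists N.
  (* By minimality [dd < rho m]: a point of [A n] at time distance [H m] or more from [u], which is
     in [G], would be too far from it in [D]. So the trace lies in an interval of radius [H m]
     around [u]. *)
  case: (ex_minnP exm) => -[|m] Hm Hmin.
    move: dA; rewrite lee_fin => dA; have := rho0 0%N; lra.
  have ltm : dd < rho m.
    by rewrite ltNge; apply/negP => /Hmin; rewrite ltnn.
  exists `[u - H m, u + H m]%classic; split => //.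
    move=> v [Av Gv] /=; rewrite in_itv/= -ler_distl leNgt; apply/negP => lt.
    have := Hd m u v Gu (AI _ Av) (ltW lt); move=> le1.
    have := le_trans le1 (ddiam_ge D Au Av).
    by rewrite Ed lee_fin leNgt ltm.
  rewrite lebesgue_measure_itv/= lte_fin.
  have -> : u - H m < u + H m by have := H0 m; lra.
  rewrite ?poweR_EFin -EFinD -?EFinM lee_fin.
  apply: (@le_trans _ _ (2 * H m)); first by lra.
  apply: (le_trans (HC m)); rewrite ler_wpM2l ?(ltW C0)//.
  by apply: ge0_ler_powR => //; rewrite nnegrE ?(ltW (rho0 _))// ltW.
have [J HJ] := choice exJ.
apply: (@le_trans _ _ (\sum_(0 <= n <oo) lebesgue_measure (J n))%E).
  apply: measure_sigma_subadditive => //; first by move=> n; have [] := HJ n.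
  move=> u Gu; have [n _ Anu] := cA u (GI u Gu).
  by exists n => //; have [_ + _] := HJ n; apply.
rewrite -nneseriesZl; last by move=> i _; exact: poweR_ge0.
by apply: lee_nneseries => // n _; have [] := HJ n.
Qed.

Lemma hdim_eq D (al : R) : 0 <= al ->
  (forall s, al < s -> hmeasure D s = 0%E) ->
  (forall s, 0 <= s -> s < al -> hmeasure D s != 0%E) ->
  hdim D = al%:E.
Proof.
move=> al0 Hu Hl; apply/eqP; rewrite eq_le; apply/andP; split.
  apply/lee_addgt0Pr => e e0; apply: ereal_inf_lbound; exists (al + e) => //.
  by split; [rewrite addr_ge0// ltW|apply: Hu; rewrite ltrDl].
apply: le_ereal_inf_tmp => _ [s [s0 Hs] <-]; rewrite lee_fin leNgt.
by apply/negP => sal; have := Hl s s0 sal; rewrite Hs eqxx.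
Qed.

End hausdorff.

(** * Covering by level sets: the upper bound on the dimension *)

Section upper_dimension.
Variables (R : realType) (alpha : R) (f : R -> R).
Local Notation x := (Xexc alpha f).
Local Notation xm := (Xexcm alpha f).
Local Notation D := (ltdist alpha f).
Hypothesis exc : excursion alpha f.

Section scale.
Variables (C gamma : R) (n : nat).
Hypotheses (C0 : 0 < C) (g0 : 0 < gamma) (g1 : gamma < 1) (n0 : (0 < n)%N).
Hypothesis hold : forall u t : R, 0 <= u -> u <= t -> t <= 1 ->
  x u - C * (t - u) `^ gamma <= x t.
Hypothesis x1 : x 1 = 0.

Let eta := C * n%:R `^ (- gamma).
(* Along one time cell, [x] moves down by at most [eta], so a level set of
   [truncn (x u / eta)] inside a cell has small diameter; the weight 3 makes the
   value of the index determine the cell. *)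
Let idx (u : R) : nat := (3 * Num.truncn (n%:R * u) + Num.truncn (x u / eta))%N.
Let cell i : set R := [set u | 0 <= u <= 1 /\ idx u = i].

Let nR0 : 0 < n%:R :> R. Proof. by rewrite ltr0n. Qed.
Let eta0 : 0 < eta. Proof. by rewrite mulr_gt0// powR_gt0. Qed.

Lemma hold_cell (u t : R) (m : nat) : 0 <= u -> u <= t -> t <= 1 ->
  n%:R * (t - u) <= m.+1%:R -> x u <= x t + m.+1%:R * eta.
Proof.
move=> u0 ut t1 H; have := hold u0 ut t1.
suff : C * (t - u) `^ gamma <= m.+1%:R * eta by lra.
rewrite /eta mulrCA ler_wpM2l ?(ltW C0)//.
have tu : t - u <= m.+1%:R * n%:R^-1 by rewrite ler_pdivlMr// mulrC.
have tu0 : 0 <= t - u by rewrite subr_ge0.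
apply: (@le_trans _ _ ((m.+1%:R * n%:R^-1) `^ gamma)).
  by apply: ge0_ler_powR => //; rewrite ?nnegrE ?mulr_ge0 ?invr_ge0 ?ler0n ?ltW.
rewrite powRM ?invr_ge0 ?ler0n//.
rewrite -[n%:R^-1]powR_inv1 ?ler0n// -powRrM mulN1r ler_wpM2r ?powR_ge0//.
by apply: ler1_powR; [rewrite ler1n|exact: ltW].
Qed.

Let trunc_n (u : R) : 0 <= u -> (Num.truncn (n%:R * u))%:R <= n%:R * u < (Num.truncn (n%:R * u)).+1%:R.
Proof. by move=> u0; apply: truncn_itv; rewrite mulr_ge0. Qed.

Let trunc_x (u : R) : 0 <= u <= 1 ->
  (Num.truncn (x u / eta))%:R * eta <= x u < (Num.truncn (x u / eta)).+1%:R * eta.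
Proof.
move=> u01; rewrite -ler_pdivlMr// -ltr_pdivrMr//; apply: truncn_itv.
by rewrite divr_ge0 ?(exc_ge0 exc)// ltW.
Qed.

(** If the time cells were k < k', equal indices would give q - q' = 3 (k' - k), but a path that
    loses at most [eta] per cell has q < q' + (k' - k) + 2. *)
Lemma cell_same (u t : R) : 0 <= u -> u <= t -> t <= 1 -> idx u = idx t ->
  Num.truncn (n%:R * u) = Num.truncn (n%:R * t) /\
  Num.truncn (x u / eta) = Num.truncn (x t / eta).
Proof.
move=> u0 ut t1 E; have t0 := le_trans u0 ut; have u1 := le_trans ut t1.
have tu := trunc_n u0; have tt := trunc_n t0.
have kle : (Num.truncn (n%:R * u) <= Num.truncn (n%:R * t))%N.
  by apply: le_truncn; rewrite ler_wpM2l// ltW.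
suff K : Num.truncn (n%:R * u) = Num.truncn (n%:R * t).
  by split=> //; move: E; rewrite /idx K => /addnI.
apply/eqP; rewrite eqn_leq kle/= leqNgt; apply/negP => klt.
move: E; rewrite /idx; set k := Num.truncn (n%:R * u) in tu kle klt *.
set k' := Num.truncn (n%:R * t) in tt kle klt *.
have u01 : 0 <= u <= 1 by rewrite u0.
have t01 : 0 <= t <= 1 by rewrite t0.
have /andP[xu1 xu2] := trunc_x u01; have /andP[xt1 xt2] := trunc_x t01.
set q := Num.truncn (x u / eta) in xu1 xu2 *.
set q' := Num.truncn (x t / eta) in xt1 xt2 *.
have : x u <= x t + (k' - k).+1%:R * eta.
  apply: hold_cell => //; rewrite -natr1 natrB//.
  move: tu tt; rewrite -!natr1; lra.
move=> xut.
have : (q < q'.+1 + (k' - k).+1)%N.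
  rewrite -(ltr_nat R) -(ltr_pM2r eta0) natrD mulrDl; lra.
move=> Hq E; have : (k <= k')%N := kle; move: klt Hq E.
clear; lia.
Qed.

Lemma cell_diam i : (ddiam D (cell i) <= (4 * eta)%:E)%E.
Proof.
have W u t : cell i u -> cell i t -> u < t -> (D u t <= (4 * eta)%:E)%E.
  move=> [/andP[u0 u1] iu] [/andP[t0 t1] it] ut.
  have [K Q] := cell_same u0 (ltW ut) t1 (etrans iu (esym it)).
  have u01 : 0 <= u <= 1 by rewrite u0.
  have t01 : 0 <= t <= 1 by rewrite t0.
  have /andP[xu1 xu2] := trunc_x u01; have /andP[xt1 xt2] := trunc_x t01.
  apply: le_trans (ltdist_le exc u0 ut t1) _; rewrite lee_fin.
  have : x u - eta <= Iexc alpha f u t.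
    apply: I_glb => [|v /andP[uv vt]]; first exact: ltW.
    rewrite lerBlDr -[eta]mul1r; apply: (@hold_cell _ _ 0%N) => //.
      exact: le_trans vt t1.
    have := trunc_n u0; have := trunc_n t0; rewrite K -!natr1.
    have : n%:R * v <= n%:R * t by rewrite ler_wpM2l// ltW.
    lra.
  have := xm_le exc t01.
  move: xu1 xu2 xt1 xt2; rewrite Q -natr1 mulrDl mul1r.
  lra.
apply: ddiam_le; first by rewrite mulr_ge0// ltW.
move=> u t cu ct; have [ut|tu|->] := ltgtP u t; first exact: W.
  by rewrite (ltdist_sym exc) ?W//; [case: cu|case: ct].
by rewrite (ltdistxx exc); [rewrite lee_fin mulr_ge0// ltW|case: ct].
Qed.

(** As [x 1 = 0] and at most [eta] is lost per cell, x u <= (n - k) eta in the time cell k, so the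
    index is at most 3 k + (n - k) <= 3 n. The return to 0 keeps the number of sets linear in
    [n]. *)
Lemma cell_range (u : R) : 0 <= u <= 1 -> (idx u < (3 * n).+1)%N.
Proof.
move=> u01; have /andP[u0 u1] := u01; rewrite ltnS /idx.
have /andP[tu1 tu2] := trunc_n u0; set k := Num.truncn _ in tu1 tu2 *.
have kn : (k <= n)%N.
  by rewrite -(ler_nat R) (le_trans tu1)// -{2}[n%:R]mulr1 ler_wpM2l// ltW.
have /andP[xu1 xu2] := trunc_x u01; set q := Num.truncn _ in xu1 xu2 *.
suff qn : (q <= n - k)%N.
  by rewrite -(subnKC kn) mulnDr leq_add2l (leq_trans qn)// leq_pmull.
move: kn; rewrite leq_eqVlt => /predU1P[kn|kn].
  suff u1' : u = 1 by rewrite /q u1' x1 mul0r truncn0.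
  apply/eqP; rewrite eq_le u1/=; move: tu1; rewrite kn.
  by rewrite -{1}[n%:R]mulr1 ler_pM2l.
have H : x u <= (n - k)%:R * eta.
  rewrite -[x u]subr0 -x1 lerBlDl -(subnSK kn); apply: hold_cell => //.
  rewrite (subnSK kn) natrB 1?ltnW// mulrBr mulr1; lra.
rewrite -(ler_nat R) -(ler_pM2r eta0); exact: le_trans xu1 H.
Qed.

Lemma cell_sum s : 0 < s ->
  (\sum_(0 <= i <oo) (ddiam D (cell i)) `^ s <= ((3 * n).+1%:R * (4 * eta) `^ s)%:E)%E.
Proof.
move=> s0; rewrite (nneseries_split _ (3 * n).+1)//; last first.
  by move=> k _; exact: poweR_ge0.
rewrite [X in (_ + X)%E]eseries0 ?adde0; last first.
  move=> i; rewrite add0n => ni _; rewrite (_ : cell i = set0) ?ddiam0 ?poweR0r ?gt_eqF//.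
  rewrite -subset0 => u [u01 iu]; have := cell_range u01; rewrite iu => /leq_trans/(_ ni).
  by rewrite ltnn.
rewrite add0n; apply: (@le_trans _ _ (\sum_(0 <= k < (3 * n).+1) ((4 * eta) `^ s)%:E)%E).
  apply: lee_sum => i _; rewrite -poweR_EFin; apply: gt0_ler_poweR.
  - exact: ltW.
  - by rewrite in_itv/= ddiam_ge0 leey.
  - by rewrite in_itv/= leey lee_fin mulr_ge0// ltW.
  - exact: cell_diam.
by rewrite sumEFin lee_fin sumr_const_nat subn0 -[leLHS]mulr_natl.
Qed.

Lemma cell_cover : @unit_I R `<=` \bigcup_i cell i /\ forall i, cell i `<=` @unit_I R.
Proof.
split=> [u|i u [u01 _]]; last by rewrite /unit_I/= in_itv.
by rewrite /unit_I/= in_itv/= => u01; exists (idx u).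
Qed.

End scale.

(** About 3 n sets of diameter at most 4 C n^(-gamma) contribute a multiple of n^(1 - gamma s),
    which tends to 0; [p] is minus this exponent. *)
Lemma hmeasure_upper (C gamma s : R) : 0 < C -> 0 < gamma -> gamma < 1 ->
  1 < gamma * s -> x 1 = 0 ->
  (forall u t : R, 0 <= u -> u <= t -> t <= 1 -> x u - C * (t - u) `^ gamma <= x t) ->
  hmeasure D s = 0%E.
Proof.
move=> C0 g0 g1 gs x1 hold; apply: hmeasure0 => e dl e0 dl0.
have s0 : 0 < s by rewrite -(pmulr_rgt0 _ g0); apply: lt_trans ltr01 gs.
pose p := gamma * s - 1; have p0 : 0 < p by rewrite subr_gt0.
pose K := (4 * C) `^ s.
have K0 : 0 < K by rewrite powR_gt0// mulr_gt0.
have big (q M : R) : 0 < q -> exists N : nat, forall n, (N <= n)%N -> M <= n%:R `^ q.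
  move=> q0; have [N HN] : exists N : nat, (Num.max M 1) `^ q^-1 < N%:R.
    exists (Num.truncn ((Num.max M 1) `^ q^-1)).+1.
    by have /andP[] := truncn_itv (powR_ge0 (Num.max M 1) q^-1).
  exists N => n Nn.
  have M1 : 0 <= Num.max M 1 by rewrite le_max ler01 orbT.
  have : (Num.max M 1) `^ q^-1 <= n%:R by rewrite (le_trans (ltW HN))// ler_nat.
  move=> /(ge0_ler_powR (ltW q0)); rewrite !nnegrE powR_ge0 ler0n => /(_ isT isT).
  by rewrite -powRrM mulVf ?gt_eqF// powRr1// ge_max => /andP[].
have [N1 HN1] := big gamma (4 * C / dl) g0.
have [N2 HN2] := big p (4 * K / e) p0.
pose n := (N1 + N2).+1.
have nR : 0 < n%:R :> R by rewrite ltr0n.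
have /HN1 H1 : (N1 <= n)%N by rewrite leqW// leq_addr.
have /HN2 H2 : (N2 <= n)%N by rewrite leqW// leq_addl.
have n0 : (0 < n)%N by [].
exists (fun i => [set u | 0 <= u <= 1 /\ (3 * Num.truncn (n%:R * u) +
  Num.truncn (x u / (C * n%:R `^ (- gamma))))%N = i]).
  have [c1 c2] := cell_cover C gamma n; split => // i; split; first exact: c2.
  apply: le_trans (cell_diam C0 g0 g1 n0 hold i) _.
  rewrite lee_fin powRN mulrA ler_pdivrMr ?powR_gt0//.
  by rewrite [leRHS]mulrC -ler_pdivrMr.
apply: le_trans (cell_sum C0 g0 g1 n0 hold x1 s0) _; rewrite lee_fin.
rewrite mulrA powRM ?powR_ge0 ?mulr_ge0 ?(ltW C0)// -/K -powRrM.
have -> : n%:R `^ (- gamma * s) = n%:R^-1 * (n%:R `^ p)^-1 :> R.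
  rewrite -powRN -[n%:R^-1]powR_inv1 ?ler0n// -powRD; last by rewrite (gt_eqF nR) implybT.
  by congr (_ `^ _); rewrite /p; lra.
have P0 : 0 < n%:R `^ p :> R by rewrite powR_gt0.
apply: (@le_trans _ _ (4 * n%:R * (K * (n%:R^-1 / n%:R `^ p)))).
  apply: ler_wpM2r; first by rewrite mulr_ge0 ?mulr_ge0 ?invr_ge0// ltW.
  by rewrite -natrM ler_nat /n; clear; lia.
have -> : 4 * n%:R * (K * (n%:R^-1 / n%:R `^ p)) = 4 * K / n%:R `^ p :> R.
  by field; rewrite !gt_eqF.
by rewrite ler_pdivrMr// [leRHS]mulrC -ler_pdivrMr.
Qed.

End upper_dimension.

(** * The excursion straddling time 1 *)

Section cadlag_paths.
Variables (R : realType) (f : R -> R).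
Hypothesis cf : cadlag f.

Lemma cadlag_right (t e : R) : 0 <= t -> 0 < e ->
  exists2 dl, 0 < dl & forall u, t <= u < t + dl -> `|f u - f t| < e.
Proof.
move=> t0 e0; have /cvgrPdist_lt /(_ e e0) := cf.1 t t0.
move=> /nbhs_ballP[dl /= dl0 H]; exists dl => // u /andP[].
rewrite le_eqVlt => /predU1P[<- _|tu ut]; first by rewrite subrr normr0.
rewrite distrC; apply: H => //; rewrite /ball/= distrC ltr_distl; lra.
Qed.

Definition leftlim (t l : R) := forall e, 0 < e ->
  exists2 dl, 0 < dl & forall u, t - dl < u < t -> `|f u - l| < e.

Lemma cvg_leftlim (t l : R) : f x @[x --> t^'-] --> l -> leftlim t l.
Proof.
move=> /cvgrPdist_lt H e e0; have /nbhs_ballP[dl /= dl0 Hd] := H e e0.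
exists dl => // u /andP[tu ut]; rewrite distrC; apply: Hd => //.
by rewrite /ball/= ltr_distl; lra.
Qed.

Lemma leftlim_cvg (t l : R) : leftlim t l -> f x @[x --> t^'-] --> l.
Proof.
move=> H; apply/cvgrPdist_lt => e e0; have [dl dl0 Hd] := H e e0.
apply/nbhs_ballP; exists dl => //= u; rewrite /ball/= ltr_distl => tu ut.
by rewrite distrC; apply: Hd; rewrite ut; lra.
Qed.

Lemma cadlag_left (t : R) : 0 < t -> exists l, leftlim t l.
Proof. by move=> t0; have /cvg_ex[l /cvg_leftlim] := cf.2 t t0; exists l. Qed.

Lemma leftlim_approx (t l a e : R) : leftlim t l -> a < t -> 0 < e ->
  exists2 u, a < u < t & `|f u - l| < e.
Proof.
move=> H at_ e0; have [dl dl0 Hd] := H e e0.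
pose u := Num.max ((a + t) / 2) (t - dl / 2).
have h1 : (a + t) / 2 <= u by rewrite le_max lexx.
have h2 : t - dl / 2 <= u by rewrite le_max lexx orbT.
have h3 : u < t by rewrite gt_max; apply/andP; split; lra.
by exists u; [lra|apply: Hd; lra].
Qed.

End cadlag_paths.

Definition lower_holder {R : realType} (gamma : R) (f : R -> R) :=
  forall K : R, exists2 C, 0 < C & forall u t, 0 <= u -> u <= t -> t <= K ->
    f u - C * (t - u) `^ gamma <= f t.

(** Excludes a jump that starts from the running infimum. There the infimum would be approached
    without being attained, and [g1], a supremum of zeros of the reflected process, might fail to be
    one. *)
Definition no_jump_from_inf {R : realType} (f : R -> R) := forall r l : R, 0 < r ->
  leftlim f r l -> (forall u, 0 <= u < r -> l <= f u) -> f r <= l.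

Section excursion_of_path.
Variables (R : realType) (alpha gamma : R) (f : R -> R).
Hypotheses (gamma0 : 0 < gamma) (cf : cadlag f) (lh : lower_holder gamma f).
Hypothesis NJ : no_jump_from_inf f.
Hypothesis unb : forall M : R, exists2 s, 1 <= s & f s < M.
Hypothesis f1 : exists2 u, 0 <= u <= 1 & f u < f 1.

Lemma leftlim_le (t l : R) : 0 < t -> leftlim f t l -> l <= f t.
Proof.
move=> t0 Hl; apply/ler_addgt0Pr => e e0; have [C C0 HC] := lh t.
have e2 : 0 < e / 2 by rewrite divr_gt0.
pose dl := (e / 2 / C) `^ gamma^-1.
have dl0 : 0 < dl by rewrite powR_gt0// divr_gt0.
have [u /andP[]] : exists2 u, Num.max 0 (t - dl) < u < t & `|f u - l| < e / 2.
  by apply: (leftlim_approx Hl) => //; rewrite gt_max t0/=; lra.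
rewrite gt_max => /andP[u0 tu] ut; rewrite ltr_distl => /andP[h1 h2].
have := HC u t (ltW u0) (ltW ut) (lexx _).
suff : C * (t - u) `^ gamma <= e / 2 by lra.
rewrite mulrC -ler_pdivlMr//.
have -> : e / 2 / C = dl `^ gamma.
  by rewrite /dl -powRrM mulVf ?gt_eqF// powRr1// ltW// divr_gt0.
by apply: (ge0_ler_powR (ltW gamma0)); rewrite ?nnegrE; lra.
Qed.

Lemma path_lbound (u : R) : 0 <= u -> has_lbound [set f v | v in `[0, u]].
Proof.
move=> u0; have [C C0 HC] := lh u; exists (f 0 - C * u `^ gamma).
move=> _ [v /= /[!in_itv]/= /andP[v0 vu] <-].
apply: le_trans (HC 0 v (lexx _) v0 vu); rewrite subr0 lerD2l lerN2.
rewrite ler_wpM2l ?(ltW C0)//; apply: (ge0_ler_powR (ltW gamma0)) => //;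
  by rewrite nnegrE.
Qed.

Lemma infI_le (u v : R) : 0 <= v -> v <= u -> infI f 0 u <= f v.
Proof.
move=> v0 vu; apply: ge_inf; first exact: path_lbound (le_trans v0 vu).
by exists v => //=; rewrite in_itv/= v0.
Qed.

Lemma infI_ge (u c : R) : 0 <= u -> (forall v, 0 <= v <= u -> c <= f v) -> c <= infI f 0 u.
Proof.
move=> u0 H; apply: lb_le_inf; first by exists (f 0), 0 => //=; rewrite in_itv/= lexx.
by move=> _ [v /= /[!in_itv]/= ? <-]; exact: H.
Qed.

Lemma infI_eq (u : R) : 0 <= u -> (f u = infI f 0 u) <-> (forall v, 0 <= v <= u -> f u <= f v).
Proof.
move=> u0; split=> [-> v /andP[v0 vu]|H]; first exact: infI_le.
by apply/eqP; rewrite eq_le infI_le// infI_ge.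
Qed.

(** If the infimum [m] were not attained, let [tau] be the supremum of the times up to which the
    path stays above [m] by some margin. Right continuity gives a margin just after [tau]; just
    before, the left limit exceeds [m], since otherwise [NJ] would give [f tau <= m]. So a margin
    extends past [tau], or up to [u]. *)
Lemma argmin (u : R) : 0 <= u -> exists2 v, 0 <= v <= u & forall w, 0 <= w <= u -> f v <= f w.
Proof.
move=> u0; apply: contrapT => nmin; set m := infI f 0 u.
have fm v : 0 <= v <= u -> m < f v.
  move=> /andP[v0 vu]; rewrite ltNge; apply/negP => fvm; apply: nmin.
  by exists v; rewrite ?v0// => w /andP[w0 wu]; exact: le_trans (infI_le w0 wu).
pose T := [set v | 0 <= v <= u /\ exists2 e, 0 < e & forall w, 0 <= w <= v -> m + e <= f w].
have T0 : T 0.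
  split; first by rewrite lexx.
  exists (f 0 - m); first by rewrite subr_gt0 fm// lexx.
  by move=> w; rewrite -eq_le => /eqP <-; lra.
have hT : has_sup T by split; [exists 0|exists u => v [/andP[]]].
set tau := sup T.
have tau0 : 0 <= tau by apply: ub_le_sup => //; case: hT.
have tauu : tau <= u by apply: ge_sup; [exists 0|move=> v [/andP[]]].
have [d1 d10 Hd1] : exists2 d1, 0 < d1 & forall w, tau <= w < tau + d1 ->
    m + (f tau - m) / 2 <= f w.
  have e0 : 0 < (f tau - m) / 2 by rewrite divr_gt0// subr_gt0 fm// tau0.
  have [d1 d10 H] := cadlag_right cf tau0 e0; exists d1 => // w /H.
  by rewrite ltr_distl; lra.
have [v Tv [e2 e20 Hv]] : exists2 v, T v & exists2 e, 0 < e & forall w, v <= w < tau -> m + e <= f w.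
  move: tau0; rewrite le_eqVlt => /predU1P[tau0|tau0].
    by exists 0 => //; exists 1 => // w; rewrite -tau0 => /andP[? ?]; lra.
  have [l Hl] := cadlag_left cf tau0.
  have lm : m < l.
    rewrite ltNge; apply/negP => lm.
    have : f tau <= l.
      apply: NJ => // w /andP[w0 wt]; apply: (le_trans lm); apply: infI_le => //.
      by rewrite (le_trans (ltW wt)).
    by have := fm tau; rewrite (ltW tau0) tauu => /(_ isT); lra.
  have e0 : 0 < (l - m) / 2 by rewrite divr_gt0// subr_gt0.
  have [d2 d20 Hd2] := Hl _ e0.
  have [v Tv vtau] := sup_adherent d20 hT.
  exists v => //; exists ((l - m) / 2) => // w /andP[vw wt].
  by have := Hd2 w; rewrite (lt_le_trans vtau vw) wt ltr_distl => /(_ isT); lra.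
have [/andP[v0 vu] [e3 e30 Hv3]] := Tv.
pose e := Num.min ((f tau - m) / 2) (Num.min e2 e3).
have ee : [/\ 0 < e, e <= (f tau - m) / 2, e <= e2 & e <= e3].
  rewrite /e !lt_min e20 e30 !ge_min !lexx !orbT; split=> //.
  by rewrite divr_gt0// subr_gt0 fm// tau0.
have [e0 ea eb ec] := ee.
have He w : 0 <= w -> w < tau + d1 -> m + e <= f w.
  move=> w0 wt; have [wv|vw] := leP w v.
    by have := Hv3 w; rewrite w0 wv => /(_ isT); lra.
  have [wtau|tauw] := ltP w tau.
    by have := Hv w; rewrite (ltW vw) wtau => /(_ isT); lra.
  by have := Hd1 w; rewrite tauw wt => /(_ isT); lra.
have [utau|utau] := ltP u (tau + d1).
  have : m + e <= m; last by lra.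
  by apply: infI_ge => // w /andP[w0 wu]; apply: He => //; exact: le_lt_trans utau.
have : tau + d1 / 2 <= tau; last by lra.
apply: ub_le_sup; first by case: hT.
split; first by lra.
by exists e => // w /andP[w0 wt]; apply: He => //; lra.
Qed.

Local Notation g := (g1 f).
Local Notation d := (d1 f).
Let S := [set s : R | 0 <= s <= 1 /\ f s = infI f 0 s].
Let Sd := [set s : R | 1 < s /\ f s = infI f 0 s].

Let S0 : S 0.
Proof.
split; first by rewrite lexx ler01.
by apply/infI_eq => // v; rewrite -eq_le => /eqP <-.
Qed.

Let hS : has_sup S.
Proof. by split; [exists 0|exists 1 => s [/andP[]]]. Qed.

(** Zeros of the reflected process accumulating at [g] from the left make the left limit there a
    running infimum; [NJ] then forbids a jump, and [g] is itself a zero. *)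
Let Sg : S g.
Proof.
have g0 : 0 <= g by apply: ub_le_sup => //; case: hS.
have g1 : g <= 1 by apply: ge_sup; [exists 0|move=> s [/andP[]]].
apply: contrapT => nSg.
have g_gt0 : 0 < g by rewrite lt_neqAle g0 andbT; apply/eqP => E; apply: nSg; rewrite -E.
have [l Hl] := cadlag_left cf g_gt0.
have lf u : 0 <= u < g -> l <= f u.
  move=> /andP[u0 ug]; apply/ler_addgt0Pr => e e0.
  have [dl dl0 Hd] := Hl e e0.
  have m0 : 0 < Num.min dl (g - u) by rewrite lt_min dl0 subr_gt0.
  have [s Ss] := sup_adherent m0 hS; rewrite -[sup S]/g => sg.
  have [/andP[s0 s1] fs] := Ss.
  have sltg : s < g.
    rewrite lt_neqAle (_ : s <= g) ?andbT; last by apply: ub_le_sup => //; case: hS.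
    by apply/eqP => E; apply: nSg; rewrite -E.
  have m1 : Num.min dl (g - u) <= dl by rewrite ge_min lexx.
  have m2 : Num.min dl (g - u) <= g - u by rewrite ge_min lexx orbT.
  have fsu : f s <= f u by rewrite fs; apply: infI_le => //; lra.
  have := Hd s; rewrite sltg andbT ltr_distl => /(_ ltac:(lra)); lra.
apply: nSg; split; first by rewrite g0.
apply/infI_eq => // v /andP[v0]; rewrite le_eqVlt => /predU1P[->//|vg].
by apply: le_trans (NJ g_gt0 Hl lf) _; apply: lf; rewrite v0.
Qed.

Lemma g_ge0 : 0 <= g. Proof. by have [/andP[]] := Sg. Qed.

Lemma g_min1 (u : R) : 0 <= u <= 1 -> f g <= f u.
Proof.
move=> /andP[u0 u1]; have [/andP[g0 g1] fg] := Sg.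
have [v /andP[v0 vu] Hv] := argmin u0.
apply: le_trans (Hv u _); last by rewrite u0 lexx.
have [vg|gv] := leP v g; first by rewrite fg; exact: infI_le.
have : v <= g; last by rewrite leNgt gv.
apply: ub_le_sup; first by case: hS.
split; first by rewrite v0 (le_trans vu).
by apply/infI_eq => // w /andP[w0 wv]; apply: Hv; rewrite w0 (le_trans wv).
Qed.

Lemma g_lt1 : g < 1.
Proof.
have [/andP[g0 g1] fg] := Sg; rewrite lt_neqAle g1 andbT; apply/eqP => E.
have [u u01 ] := f1; rewrite ltNge -{1}E fg => /negP; apply.
by rewrite E; apply: infI_le; case/andP: u01.
Qed.

Let Sd_argmin (u : R) : 0 <= u -> f u < f g -> exists2 v, Sd v & v <= u.
Proof.
move=> u0 fu; have [v /andP[v0 vu] Hv] := argmin u0; exists v => //.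
have fv : f v < f g by apply: le_lt_trans fu; apply: Hv; rewrite u0 lexx.
split; first by rewrite ltNge; apply/negP => v1; move: fv; rewrite ltNge g_min1// v0.
by apply/infI_eq => // w /andP[w0 wv]; apply: Hv; rewrite w0 (le_trans wv).
Qed.

Let Sd0 : Sd !=set0.
Proof.
have [s s1 fs] := unb (f g).
by have [v Sv _] := Sd_argmin (le_trans ler01 s1) fs; exists v.
Qed.

Let hSd : has_inf Sd.
Proof. by split=> //; exists 1 => s [/ltW]. Qed.

Lemma d_ge1 : 1 <= d.
Proof. by apply: lb_le_inf => // s [/ltW]. Qed.

Lemma g_lt_d : g < d. Proof. exact: lt_le_trans g_lt1 d_ge1. Qed.

Let g_min' (u : R) : 0 <= u -> u < d -> f g <= f u.
Proof.
move=> u0 ud; rewrite leNgt; apply/negP => /(Sd_argmin u0)[v Sv vu].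
by have : d <= v; [apply: ge_inf => //; case: hSd|lra].
Qed.

(** The level at [d] is at most [f g], by right continuity along zeros after time 1, and at least
    [f g] because the excursion cannot end with a negative jump. *)
Lemma f_d : f d = f g.
Proof.
have d0 : 0 < d by apply: lt_le_trans d_ge1.
apply/eqP; rewrite eq_le; apply/andP; split; last first.
  have [l Hl] := cadlag_left cf d0.
  apply: le_trans (leftlim_le d0 Hl); apply/ler_addgt0Pr => e e0.
  have [u /andP[u0 ud]] := leftlim_approx Hl d0 e0.
  have := g_min' (ltW u0) ud; rewrite ltr_distl; lra.
apply/ler_addgt0Pr => e e0.
have [dl dl0 Hd] := cadlag_right cf (ltW d0) e0.
have [s [s1 fs] sd] := inf_adherent dl0 hSd.
have ds : d <= s by apply: ge_inf; [case: hSd|split].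
have : f s <= f g.
  by rewrite fs; apply: infI_le; [exact: g_ge0|exact: ltW (lt_trans g_lt1 s1)].
have := Hd s; rewrite ds sd => /(_ isT); rewrite ltr_distl; lra.
Qed.

Lemma g_min (u : R) : 0 <= u <= d -> f g <= f u.
Proof.
move=> /andP[u0]; rewrite le_eqVlt => /predU1P[->|]; last exact: g_min'.
by rewrite f_d.
Qed.

Local Notation zeta := (d - g).
Local Notation c := (zeta `^ (- alpha^-1)).

Lemma zeta_gt0 : 0 < zeta. Proof. by rewrite subr_gt0 g_lt_d. Qed.

Let c0 : 0 < c. Proof. by rewrite powR_gt0// zeta_gt0. Qed.

Lemma time_ge0 (t : R) : 0 <= t -> 0 <= g + t * zeta.
Proof. by move=> t0; rewrite addr_ge0 ?g_ge0// mulr_ge0// ltW// zeta_gt0. Qed.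

Lemma Xexcm_eq (t l : R) : 0 < t -> leftlim f (g + t * zeta) l ->
  leftlim (Xexc alpha f) t (c * (l - f g)) /\ Xexcm alpha f t = c * (l - f g).
Proof.
move=> t0 Hl.
have H : leftlim (Xexc alpha f) t (c * (l - f g)).
  move=> e e0; have ec : 0 < e / c by rewrite divr_gt0.
  have [dl dl0 Hd] := Hl _ ec; exists (dl / zeta); first by rewrite divr_gt0// zeta_gt0.
  move=> u /andP[tu ut]; rewrite /Xexc -mulrBr normrM (gtr0_norm c0) mulrC -ltr_pdivlMr//.
  have -> : f (g + u * zeta) - f g - (l - f g) = f (g + u * zeta) - l by ring.
  apply: Hd; rewrite ltrD2l ltr_pM2r ?zeta_gt0// ut andbT.
  have -> : g + t * zeta - dl = g + (t - dl / zeta) * zeta.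
    by field; rewrite gt_eqF// zeta_gt0.
  by rewrite ltrD2l ltr_pM2r// zeta_gt0.
split=> //; rewrite /Xexcm gt_eqF//; apply/cvg_lim => //; exact: leftlim_cvg.
Qed.

Lemma path_excursion : excursion alpha f.
Proof.
have z0 := zeta_gt0.
split.
- move=> t e t0 e0; have ec : 0 < e / c by rewrite divr_gt0.
  have [dl dl0 Hd] := cadlag_right cf (time_ge0 t0) ec.
  exists (dl / zeta); first by rewrite divr_gt0.
  move=> u /andP[tu ut]; rewrite /Xexc -mulrBr normrM (gtr0_norm c0) mulrC -ltr_pdivlMr//.
  have -> : f (g + u * zeta) - f g - (f (g + t * zeta) - f g) =
     f (g + u * zeta) - f (g + t * zeta) by ring.
  apply: Hd; rewrite lerD2l ler_pM2r// tu/= -addrA ltrD2l.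
  have -> : t * zeta + dl = (t + dl / zeta) * zeta by field; rewrite gt_eqF.
  by rewrite ltr_pM2r.
- move=> t e t0 e0.
  have tz : 0 < g + t * zeta by rewrite ltr_wpDl ?g_ge0// mulr_gt0.
  have [l Hl] := cadlag_left cf tz.
  by have [H ->] := Xexcm_eq t0 Hl; exact: H.
- move=> t /andP[t0 t1].
  have tz : 0 < g + t * zeta by rewrite ltr_wpDl ?g_ge0// mulr_gt0.
  have [l Hl] := cadlag_left cf tz.
  have [_ ->] := Xexcm_eq t0 Hl.
  by rewrite /Xexc ler_pM2l// lerD2r leftlim_le.
- by rewrite /Xexc mul0r addr0 subrr mulr0.
- move=> t /andP[t0 t1]; rewrite /Xexc mulr_ge0 ?(ltW c0)// subr_ge0 g_min//.
  rewrite time_ge0//=; have : t * zeta <= 1 * zeta by rewrite ler_pM2r.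
  lra.
Qed.

Lemma Xexc1 : Xexc alpha f 1 = 0.
Proof.
rewrite /Xexc mul1r; have -> : g + zeta = d by ring.
by rewrite f_d subrr mulr0.
Qed.

Lemma Xexc_holder : exists2 C, 0 < C & forall u t : R, 0 <= u -> u <= t -> t <= 1 ->
  Xexc alpha f u - C * (t - u) `^ gamma <= Xexc alpha f t.
Proof.
have z0 := zeta_gt0.
have [C C0 HC] := lh d; exists (c * (C * zeta `^ gamma)).
  by rewrite !mulr_gt0// powR_gt0.
move=> u t u0 ut t1.
have := HC (g + u * zeta) (g + t * zeta) (time_ge0 u0).
rewrite lerD2l ler_pM2r// => /(_ ut).
have -> : (g + t * zeta <= d).
  by have : t * zeta <= 1 * zeta; [rewrite ler_pM2r|lra].
move=> /(_ isT).
have -> : g + t * zeta - (g + u * zeta) = zeta * (t - u) by ring.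
rewrite powRM ?(ltW z0) ?subr_ge0// => H.
have -> : c * (C * zeta `^ gamma) * (t - u) `^ gamma = c * (C * (zeta `^ gamma * (t - u) `^ gamma)).
  by ring.
by rewrite /Xexc -mulrBr ler_pM2l//; lra.
Qed.

End excursion_of_path.

(** * Laplace transforms and independent increments *)

Section expectation.
Context d (T : measurableType d) (R : realType) (P : probability T R).
Implicit Types (F G h : T -> R).

Definition rint F := P.-integrable setT (EFin \o F).
Definition Expect F : R := \int[P]_w F w.

Lemma rint_meas F : rint F -> measurable_fun setT F.
Proof. by move=> /integrableP[/measurable_EFinP]. Qed.

Lemma rint_le F G : measurable_fun setT F -> (forall w, `|F w| <= G w) -> rint G -> rint F.
Proof.
move=> mF FG; apply: le_integrable => //; first exact/measurable_EFinP.
by move=> w _ /=; rewrite lee_fin (le_trans (FG w))// ler_norm.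
Qed.

Lemma rintD F G : rint F -> rint G -> rint (fun w => F w + G w).
Proof. by move=> iF iG; apply: eq_integrable (integrableD measurableT iF iG). Qed.

Lemma rintB F G : rint F -> rint G -> rint (fun w => F w - G w).
Proof. by move=> iF iG; apply: eq_integrable (integrableB measurableT iF iG). Qed.

Lemma rintZ (k : R) F : rint F -> rint (fun w => k * F w).
Proof. by move=> iF; apply: eq_integrable (integrableZl measurableT k iF). Qed.

Lemma rint_cst (k : R) : rint (fun=> k).
Proof. exact: finite_measure_integrable_cst. Qed.

Lemma rint_bounded F (M : R) : measurable_fun setT F -> (forall w, `|F w| <= M) -> rint F.
Proof. by move=> mF FM; apply: rint_le (rint_cst M). Qed.

Lemma rint_norm F : rint F -> rint (fun w => `|F w|).
Proof. exact: integrable_norm. Qed.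

Lemma rintMb h F (M : R) : measurable_fun setT h -> (forall w, `|h w| <= M) -> rint F ->
  rint (fun w => h w * F w).
Proof.
move=> mh hM iF; apply: (@rint_le _ (fun w => M * `|F w|)).
- by apply: measurable_funM => //; exact: rint_meas.
- by move=> w; rewrite normrM ler_wpM2r.
- by apply: rintZ; exact: rint_norm.
Qed.

Lemma rint_sum (n : nat) (F : nat -> T -> R) : (forall i, (i < n)%N -> rint (F i)) ->
  rint (fun w => \sum_(i < n) F i w).
Proof.
elim: n => [|n IH] H.
  by under eq_fun do rewrite big_ord0; exact: rint_cst.
under eq_fun do rewrite big_ord_recr/=.
by apply: rintD; [apply: IH => i ni; apply: H; exact: ltnW|exact: H].
Qed.

Lemma ExD F G : rint F -> rint G -> Expect (fun w => F w + G w) = Expect F + Expect G.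
Proof. by move=> iF iG; apply: RintegralD. Qed.

Lemma ExB F G : rint F -> rint G -> Expect (fun w => F w - G w) = Expect F - Expect G.
Proof. by move=> iF iG; apply: RintegralB. Qed.

Lemma ExZ (k : R) F : rint F -> Expect (fun w => k * F w) = k * Expect F.
Proof. by move=> iF; apply: RintegralZl. Qed.

Lemma Ex_cst (k : R) : Expect (fun=> k) = k.
Proof. by rewrite /Expect Rintegral_cst//= probability_setT mulr1. Qed.

Lemma Ex_le F G : rint F -> rint G -> (forall w, F w <= G w) -> Expect F <= Expect G.
Proof. by move=> iF iG FG; apply: le_Rintegral => // w _; exact: FG. Qed.

Lemma Ex_ge0 F : (forall w, 0 <= F w) -> 0 <= Expect F.
Proof. by move=> F0; apply: Rintegral_ge0 => w _; exact: F0. Qed.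

Lemma Ex_sum (n : nat) (F : nat -> T -> R) : (forall i, (i < n)%N -> rint (F i)) ->
  Expect (fun w => \sum_(i < n) F i w) = \sum_(i < n) Expect (F i).
Proof.
elim: n => [|n IH] H.
  by under eq_fun do rewrite big_ord0; rewrite Ex_cst big_ord0.
under eq_fun do rewrite big_ord_recr/=.
rewrite ExD ?big_ord_recr/= ?IH//.
- by move=> i ni; apply: H; exact: ltnW.
- by apply: rint_sum => i ni; apply: H; exact: ltnW.
- exact: H.
Qed.

Lemma Ex_EFin F : rint F -> (\int[P]_w (F w)%:E)%E = (Expect F)%:E.
Proof. by move=> iF; rewrite /Expect /Rintegral fineK//; exact: integrable_fin_num. Qed.

Lemma Ex_dct (F_ : nat -> T -> R) F G : (forall n, measurable_fun setT (F_ n)) ->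
  rint G -> (forall n w, `|F_ n w| <= G w) -> (forall w, F_ n w @[n --> \oo] --> F w) ->
  rint F /\ Expect (F_ n) @[n --> \oo] --> Expect F.
Proof.
move=> mF_ iG FG cF.
have mF : measurable_fun setT F.
  by apply: (measurable_fun_cvg mF_) => w _; exact: cF.
have iF_ n : rint (F_ n) by apply: rint_le iG.
have [|||||h1 _ h2] := @dominated_convergence _ T R P setT measurableT
  (fun n => EFin \o F_ n) (EFin \o F) (EFin \o G).
- by move=> n; apply/measurable_EFinP.
- exact/measurable_EFinP.
- by apply: aeW => w _ /=; apply: cvg_EFin; [exact: nearW|exact: cF].
- exact: iG.
- by apply: aeW => w n _ /=; rewrite lee_fin.
split=> //; move: h2; rewrite Ex_EFin//.
under eq_fun do rewrite Ex_EFin//.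
by move/fine_cvg.
Qed.

Lemma Ex_dct0 (F_ : nat -> T -> R) F G : (forall n, measurable_fun setT (F_ n)) ->
  rint G -> (forall n w, `|F_ n w| <= G w) -> (forall w, F_ n w @[n --> \oo] --> F w) ->
  (forall n, Expect (F_ n) = 0) -> Expect F = 0.
Proof.
move=> mF iG FG cF H0; have [_] := Ex_dct mF iG FG cF.
under eq_fun do rewrite H0.
by move/cvg_lim => <-//; rewrite lim_cst.
Qed.

End expectation.

Section exp_bounds.
Variable R : realType.
Implicit Types x y t : R.

Lemma expR_norm_le x : expR `|x| <= expR x + expR (- x).
Proof.
have [x0|x0] := leP 0 x.
  by rewrite ger0_norm// lerDl expR_ge0.
by rewrite ltr0_norm// lerDr expR_ge0.
Qed.

Lemma expR_dist1_le x : `|expR x - 1| <= `|x| * expR `|x|.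
Proof.
have H y : 0 <= y -> expR y - 1 <= y * expR y.
  move=> y0; have := expR_ge1Dx (- y); rewrite expRN.
  have := expR_gt0 y; set e := expR y => e0 /(ler_wpM2r (ltW e0)).
  by rewrite mulVf ?gt_eqF//; lra.
have [x0|x0] := leP 0 x.
  by rewrite !ger0_norm ?H// subr_ge0; have := expR_ge1Dx x; lra.
rewrite ltr0_norm ?subr_lt0 ?expR_lt1// ltr0_norm//.
have := expR_ge1Dx x; have : 1 <= expR (- x) by rewrite leNgt expR_lt1; lra.
set e := expR (- x) => e1.
have : - x * 1 <= - x * e by rewrite ler_wpM2l//; lra.
lra.
Qed.

Lemma expR_dist2_le x : `|expR x - 1 - x| <= x ^+ 2 * expR `|x|.
Proof.
have h := expR_ge1Dx x; rewrite ger0_norm; last lra.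
have : expR x * (1 - x) <= 1.
  have := expR_ge1Dx (- x); rewrite expRN.
  have := expR_gt0 x; set e := expR x => e0 /(ler_wpM2l (ltW e0)).
  by rewrite mulfV ?gt_eqF.
move=> h2; apply: (@le_trans _ _ (x * (expR x - 1))); first by lra.
apply: (le_trans (ler_norm _)); rewrite normrM expr2.
apply: (@le_trans _ _ (`|x| * (`|x| * expR `|x|))); last first.
  by rewrite mulrA -normrM ger0_norm// -expr2 sqr_ge0.
by rewrite ler_wpM2l// expR_dist1_le.
Qed.

Lemma series_exp_le x n : 0 <= x -> series (exp_coeff x) n <= expR x.
Proof.
move=> x0; apply: nondecreasing_cvgn_le; last exact: is_cvg_series_exp_coeff.
apply/nondecreasing_seqP => k; rewrite seriesSr lerDl; exact: exp_coeff_ge0.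
Qed.

Lemma pow_le_expR x n : 0 <= x -> x ^+ n <= n`!%:R * expR x.
Proof.
move=> x0; have := @series_exp_le x n.+1 x0; rewrite seriesSr.
have : 0 <= series (exp_coeff x) n by apply: sumr_ge0 => i _; exact: exp_coeff_ge0.
have f0 : 0 < n`!%:R :> R by rewrite ltr0n fact_gt0.
move=> h1 h2; have : exp_coeff x n <= expR x by lra.
by rewrite /exp_coeff/= ler_pdivrMr// mulrC.
Qed.

Lemma pow_norm_le_expR x (dl : R) n : 0 < dl ->
  `|x| ^+ n <= n`!%:R / dl ^+ n * expR (dl * `|x|).
Proof.
move=> dl0; have := @pow_le_expR (dl * `|x|) n (mulr_ge0 (ltW dl0) (normr_ge0 x)).
rewrite exprMn mulrAC ler_pdivlMr ?exprn_gt0// mulrC.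
by rewrite [X in _ <= X -> _]mulrC [_ * expR _]mulrC.
Qed.

Lemma series_sin_le x n : `|series (sin_coeff x) n| <= expR `|x|.
Proof.
apply: le_trans (@series_exp_le `|x| n (normr_ge0 x)).
rewrite /series/= (le_trans (ler_norm_sum _ _ _))//; apply: ler_sum => i _.
have -> : `|sin_coeff x i| = (odd i)%:R * exp_coeff `|x| i.
  rewrite /sin_coeff /exp_coeff/= !normrM !normrX normrN1 expr1n mulr1.
  by rewrite normr_nat normfV normr_nat mulrA.
rewrite ler_piMl ?exp_coeff_ge0//.
by case: (odd i).
Qed.

Lemma cvg_series_sin x : series (sin_coeff x) n @[n --> \oo] --> sin x.
Proof. by rewrite unlock; exact: is_cvg_series_sin_coeff. Qed.

End exp_bounds.

Section threshold_polynomials.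
Variable R : realType.
Implicit Types x v a : R.

Lemma bernoulli_le a n : 0 <= a <= 1 -> 1 - n%:R * a <= (1 - a) ^+ n.
Proof.
move=> /andP[a0 a1]; elim: n => [|n IH]; first by rewrite mul0r subr0 expr0.
rewrite exprS -natr1; have h : 0 <= 1 - a by lra.
apply: le_trans (ler_wpM2l h IH).
have : 0 <= n%:R * (a * a) by rewrite !mulr_ge0.
lra.
Qed.

Lemma exp_le_expR a n : 0 <= a <= 1 -> (1 - a) ^+ n <= expR (- (n%:R * a)).
Proof.
move=> /andP[a0 a1]; rewrite -mulrN expRM_natl lerXn2r ?nnegrE ?expR_ge0//; first lra.
exact: expR_ge1Dx.
Qed.

Lemma cvg_invS : (fun n : nat => n.+1%:R^-1 : R) @ \oo --> 0.
Proof. exact: cvg_harmonic. Qed.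

(** Polynomials in [v], bounded by 1 on [0,1], that tend to the indicator of v < 1/2: (1 - v^n)^(n
    2^n) behaves like exp(- n (2 v)^n). The extra factor n in the exponent sends v = 1/2 to 0. *)
Definition thr (n : nat) v : R := (1 - v ^+ n.+1) ^+ (n.+1 * 2 ^ n.+1).

Lemma thr_bound n v : 0 <= v <= 1 -> 0 <= thr n v <= 1.
Proof.
move=> /andP[v0 v1]; have := exprn_ge0 n.+1 v0; have := exprn_ile1 n.+1 v0 v1 => h1 h2.
by rewrite exprn_ge0 ?exprn_ile1//; lra.
Qed.

Lemma thr_cvg v : 0 <= v <= 1 -> thr n v @[n --> \oo] --> ((v < 2^-1)%R%:R : R).
Proof.
move=> v01; have /andP[v0 v1] := v01.
have vn n : 0 <= v ^+ n <= 1 by rewrite exprn_ge0 ?exprn_ile1.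
have [vh|hv] := ltP v 2^-1.
  pose c := 1 - 2 * v; have c0 : 0 < c by rewrite /c; lra.
  apply: (@squeeze_cvgr _ _ _ _ (fun n : nat => 1 - 2 / c ^+ 2 * n.+1%:R^-1) (fun=> 1)).
  - apply: nearW => n; have /andP[_ ->] := thr_bound n v01; rewrite andbT.
    apply: le_trans (bernoulli_le _ (vn _)); rewrite lerD2l lerN2.
    rewrite natrM natrX -mulrA -exprMn.
    have h1 : (2 * v) ^+ n.+1 <= expR (- (n.+1%:R * c)).
      have := @exp_le_expR c n.+1; rewrite (_ : 1 - c = 2 * v); last by rewrite /c; ring.
      by apply; rewrite (ltW c0) /c; lra.
    have nc0 : 0 < n.+1%:R * c by rewrite mulr_gt0.
    have h2 : expR (- (n.+1%:R * c)) <= 2 / (n.+1%:R * c) ^+ 2.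
      have := pow_le_expR 2 (ltW nc0); rewrite expRN.
      have := expR_gt0 (n.+1%:R * c); set e := expR _ => e0.
      by move=> hh; rewrite -[e^-1]mul1r ler_pdivrMr// mulrAC ler_pdivlMr ?exprn_gt0// mul1r.
    apply: (le_trans (ler_wpM2l (ler0n _ _) (le_trans h1 h2))).
    by rewrite le_eqVlt; apply/orP; left; apply/eqP; field; rewrite !gt_eqF.
  - rewrite -[X in _ --> X]subr0; apply: cvgB; first exact: cvg_cst.
    rewrite -[X in _ --> X](mulr0 (2 / c ^+ 2)); apply: cvgMr; exact: cvg_invS.
  - exact: cvg_cst.
apply: (@squeeze_cvgr _ _ _ _ (fun=> 0) (fun n : nat => n.+1%:R^-1)).
- apply: nearW => n; have /andP[-> _] := thr_bound n v01 => /=.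
  apply: (le_trans (exp_le_expR _ (vn _))); rewrite natrM natrX -mulrA -exprMn.
  have h : 1 <= (2 * v) ^+ n.+1 by rewrite exprn_ege1//; lra.
  rewrite expRN lef_pV2 ?posrE ?expR_gt0//.
  apply: le_trans (_ : n.+1%:R * (2 * v) ^+ n.+1 <= _); first by rewrite ler_peMr.
  by have := expR_ge1Dx (n.+1%:R * (2 * v) ^+ n.+1); lra.
- exact: cvg_cst.
- exact: cvg_invS.
Qed.

Lemma cvg_norm_le (u : nat -> R) (l M : R) : (forall n, `|u n| <= M) ->
  u n @[n --> \oo] --> l -> `|l| <= M.
Proof.
move=> uM /cvgrPdist_lt ul; apply/ler_addgt0Pr => e e0.
have [N _ /(_ N (leqnn N))] := ul e e0; have := uM N.
by have := ler_normD (l - u N) (u N); rewrite subrK; lra.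
Qed.

End threshold_polynomials.

(** * Uniqueness of Laplace transforms with a signed weight *)

Section laplace_unique.
Context d (T : measurableType d) (R : realType) (P : probability T R).
Variables (V Y : T -> R).
Hypotheses (mV : measurable_fun setT V) (mY : measurable_fun setT Y).
Hypothesis iV : forall lam : R, 0 <= lam -> rint P (fun w => V w * expR (- (lam * Y w))).
Local Notation rint := (rint P).
Local Notation Ex := (Expect P).
Hypothesis zV : forall lam : R, 0 < lam -> Ex (fun w => V w * expR (- (lam * Y w))) = 0.
Implicit Types (lam dl theta : R) (w : T) (h : T -> R).

Let G k lam w : R := V w * Y w ^+ k * expR (- (lam * Y w)).

Let mG k lam : measurable_fun setT (G k lam).
Proof.
apply: measurable_funM; first by apply: measurable_funM => //; exact: measurable_funX.
apply: measurableT_comp => //; apply: measurableT_comp => //; exact: measurable_funM.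
Qed.

(** Majorant of |V| e^(-lam Y) e^(dl |Y|). The variable [Y] is two-sided and only e^(-lam Y) with
    lam >= 0 is under control, hence the constraint [dl <= lam] for its integrability. *)
Let B lam dl w : R := `|V w * expR (- ((lam - dl) * Y w))| + `|V w * expR (- ((lam + dl) * Y w))|.

Let iB lam dl : 0 <= dl <= lam -> rint (B lam dl).
Proof.
move=> /andP[d0 dlam]; apply: rintD; apply: rint_norm; apply: iV.
  by rewrite subr_ge0.
by rewrite addr_ge0// (le_trans d0).
Qed.

Let B_le lam dl w : 0 <= dl -> `|V w| * expR (- (lam * Y w)) * expR (dl * `|Y w|) <= B lam dl w.
Proof.
move=> d0; rewrite /B !normrM !(ger0_norm (expR_ge0 _)) -mulrA -mulrDr ler_wpM2l//.
have := expR_norm_le (dl * Y w); rewrite normrM (ger0_norm d0).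
move=> /(ler_wpM2l (expR_ge0 (- (lam * Y w)))); rewrite mulrDr -!expRD.
have -> : - (lam * Y w) + dl * Y w = - ((lam - dl) * Y w) by ring.
by have -> : - (lam * Y w) - dl * Y w = - ((lam + dl) * Y w) by ring.
Qed.

Let G_le k lam dl : 0 < dl -> exists2 C : R, 0 <= C & forall w,
  `|V w| * `|Y w| ^+ k * expR (- (lam * Y w)) <= C * (`|V w| * expR (- (lam * Y w)) * expR (dl * `|Y w|)).
Proof.
move=> d0; exists (k`!%:R / dl ^+ k); first by rewrite divr_ge0 ?ler0n ?exprn_ge0 ?ltW.
move=> w; have := pow_norm_le_expR (Y w) k d0.
have h : 0 <= `|V w| * expR (- (lam * Y w)) by rewrite mulr_ge0// expR_ge0.
move=> /(ler_wpM2l h); rewrite -!mulrA; set A := expR _; set A' := expR _; lra.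
Qed.

Section class.
Variable lam0 : R.
Hypothesis lam00 : 0 < lam0.

(* Bounded variables integrating to zero against all [V e^(- lam Y)]; Taylor
   expansion shows stability under multiplication by [sin (theta Y)]. *)
Let cls h := [/\ measurable_fun setT h, exists M : R, forall w, `|h w| <= M &
  forall lam, lam0 < lam -> Ex (fun w => h w * G 0 lam w) = 0].

Let iG k lam h M : lam0 < lam -> measurable_fun setT h -> (forall w, `|h w| <= M) ->
  rint (fun w => h w * G k lam w).
Proof.
move=> lt mh hM; apply: (rintMb mh hM).
have d0 : 0 < lam by apply: lt_trans lt.
have [C C0 HC] := G_le k lam d0.
apply: (@rint_le _ _ _ _ _ (fun w => C * B lam lam w)); first exact: mG.
  move=> w; rewrite /G !normrM normrX (ger0_norm (expR_ge0 _)).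
  apply: (le_trans (HC w)); rewrite ler_wpM2l//; apply: B_le; exact: ltW.
by apply: rintZ; apply: iB; rewrite (ltW d0) lexx.
Qed.

(** Differentiation in [lam] under the expectation, once per power of [Y], through difference
    quotients; the strict inequality [lam0 < lam] leaves the room that the majorant needs. *)
Let cls_pow h : cls h -> forall k lam, lam0 < lam -> Ex (fun w => h w * G k lam w) = 0.
Proof.
move=> [mh [M hM] h0]; elim=> [|k IH] lam lt; first exact: h0.
pose dl := (lam - lam0) / 2; have dl0 : 0 < dl by rewrite divr_gt0// subr_gt0.
pose s (n : nat) := dl / n.+1%:R.
have s0 n : 0 < s n by rewrite divr_gt0.
have sd n : s n <= dl by rewrite ler_pdivrMr// ler_peMr ?(ltW dl0)// ler1n.
have cs : s n @[n --> \oo] --> 0.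
  by rewrite -[X in _ --> X](mulr0 dl); apply: cvgMr; exact: cvg_invS.
have M0 : 0 <= `|M| by [].
have [C C0 HC] := G_le k.+1 lam dl0.
suff H : Ex (fun w => - (h w * G k.+1 lam w)) = 0.
  have := ExZ (-1) (iG k.+1 lt mh hM); under eq_fun do rewrite mulN1r.
  by rewrite H => /eqP; rewrite eq_sym mulN1r oppr_eq0 => /eqP.
have lts n : lam0 < lam + s n by apply: lt_le_trans lt _; rewrite lerDl ltW.
apply: (@Ex_dct0 _ _ _ _ (fun n w => (s n)^-1 * (h w * G k (lam + s n) w - h w * G k lam w))
   _ (fun w => `|M| * (C * B lam (2 * dl) w))).
- move=> n; apply: measurable_funM => //; apply: measurable_funB;
  by apply: measurable_funM => //; exact: mG.
- apply: rintZ; apply: rintZ; apply: iB; rewrite mulr_ge0 ?(ltW dl0)//=.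
  have -> : 2 * dl = lam - lam0 by rewrite /dl; field.
  by rewrite lerBlDr lerDl ltW.
- move=> n w; rewrite -mulrBr !normrM mulrCA.
  apply: ler_pM => //; first exact: le_trans (hM w) (ler_norm M).
  rewrite /G -mulrBr mulrDl opprD expRD -[X in _ - X]mulr1 -mulrBr !normrM normrX.
  rewrite (ger0_norm (expR_ge0 _)).
  have := expR_dist1_le (- (s n * Y w)); rewrite normrN normrM (gtr0_norm (s0 n)).
  have e1 : expR (s n * `|Y w|) <= expR (dl * `|Y w|) by rewrite ler_expR ler_wpM2r.
  move=> e2; have e3 : `|expR (- (s n * Y w)) - 1| <= s n * (`|Y w| * expR (dl * `|Y w|)).
    by apply: (le_trans e2); rewrite -mulrA !ler_wpM2l// ltW.
  have v0 : 0 <= `|V w| * `|Y w| ^+ k * expR (- (lam * Y w)) by rewrite !mulr_ge0// ?exprn_ge0// expR_ge0.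
  have := ler_wpM2l v0 e3.
  have sn0 : 0 <= (s n)^-1 by rewrite invr_ge0 ltW.
  rewrite gtr0_norm ?invr_gt0// => /(ler_wpM2l sn0) e4.
  have -> : `|V w| * `|Y w| ^+ k * (expR (- (lam * Y w)) * `|expR (- (s n * Y w)) - 1|) =
     `|V w| * `|Y w| ^+ k * expR (- (lam * Y w)) * `|expR (- (s n * Y w)) - 1| by ring.
  apply: (le_trans e4).
  have -> : (s n)^-1 * (`|V w| * `|Y w| ^+ k * expR (- (lam * Y w)) * (s n * (`|Y w| * expR (dl * `|Y w|)))) =
     `|V w| * `|Y w| ^+ k.+1 * expR (- (lam * Y w)) * expR (dl * `|Y w|).
    by rewrite exprS; field; rewrite gt_eqF.
  apply: (le_trans (ler_wpM2r (expR_ge0 _) (HC w))).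
  rewrite -[leLHS]mulrA ler_wpM2l//.
  have dl2 : 0 <= 2 * dl by rewrite mulr_ge0// ltW.
  apply: le_trans (B_le lam w dl2).
  rewrite -[leLHS]mulrA -expRD -mulrDl (_ : dl + dl = 2 * dl)//; ring.
- move=> w.
  have -> : (fun n => (s n)^-1 * (h w * G k (lam + s n) w - h w * G k lam w)) =
     (fun n => h w * G k lam w * ((expR (- (s n * Y w)) - 1) / s n)).
    apply/funext => n; rewrite /G mulrDl opprD expRD; field; rewrite gt_eqF//.
  have -> : - (h w * G k.+1 lam w) = h w * G k lam w * (- Y w).
    by rewrite /G exprS; ring.
  apply: cvgMr; apply/cvgrPdist_le => /= e e0.
  pose K := Y w ^+ 2 * expR (dl * `|Y w|).
  have K0 : 0 <= K by rewrite mulr_ge0 ?sqr_ge0 ?expR_ge0.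
  have : K * s n @[n --> \oo] --> K * 0 by apply: cvgMr.
  rewrite mulr0 => /cvgrPdist_le /(_ e e0).
  apply: filterS => n; rewrite sub0r normrN => hn; apply: le_trans hn.
  rewrite distrC opprK.
  have -> : (expR (- (s n * Y w)) - 1) / s n + Y w =
    (expR (- (s n * Y w)) - 1 - (- (s n * Y w))) / s n by field; rewrite gt_eqF.
  rewrite normrM normfV (gtr0_norm (s0 n)) ler_pdivrMr//.
  apply: (le_trans (expR_dist2_le _)); rewrite normrN normrM (gtr0_norm (s0 n)).
  rewrite [X in _ <= X * _]ger0_norm; last by rewrite mulr_ge0// ltW.
  rewrite /K sqrrN exprMn.
  have -> : Y w ^+ 2 * expR (dl * `|Y w|) * s n * s n = s n ^+ 2 * Y w ^+ 2 * expR (dl * `|Y w|) by ring.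
  apply: ler_wpM2l; first by rewrite mulr_ge0 ?sqr_ge0.
  by rewrite ler_expR ler_wpM2r.
- move=> n; rewrite ExZ; last by apply: rintB; apply: iG => //; exact: hM.
  by rewrite ExB ?(IH _ lt) ?IH ?subrr ?mulr0//; apply: iG => //; exact: hM.
Qed.

(** Partial sums of the sine series are polynomials in [Y], handled by [cls_pow], and bounded by
    e^(theta |Y|), which [theta <= lam0 < lam] makes integrable against V e^(-lam Y). *)
Let cls_sin h (theta : R) : 0 <= theta <= lam0 -> cls h -> cls (fun w => h w * sin (theta * Y w)).
Proof.
move=> /andP[th0 th1] ch; have [mh [M hM] _] := ch; split.
- apply: measurable_funM => //; apply: measurableT_comp; last exact: measurable_funM.
  apply: continuous_measurable_fun; exact: continuous_sin.
- exists M => w; rewrite normrM; apply: le_trans (hM w); rewrite ler_piMr// sin_max//.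
move=> lam lt.
have mS n : measurable_fun setT (fun w => series (sin_coeff (theta * Y w)) n).
  rewrite /series/=; apply: measurable_sum => i; rewrite /sin_coeff/=.
  apply: measurable_funM => //; apply: measurable_funM => //.
  by apply: measurable_funX; exact: measurable_funM.
apply: (@Ex_dct0 _ _ _ _ (fun n w => h w * (series (sin_coeff (theta * Y w)) n) * G 0 lam w)
   _ (fun w => `|M| * B lam theta w)).
- by move=> n; apply: measurable_funM => //; apply: measurable_funM.
- by apply: rintZ; apply: iB; rewrite th0 (le_trans th1) ?ltW.
- move=> n w; rewrite -mulrA normrM; apply: ler_pM => //.
    exact: le_trans (hM w) (ler_norm M).
  apply: le_trans (B_le lam w th0); rewrite /G expr0 mulr1 !normrM.
  rewrite (ger0_norm (expR_ge0 _)) mulrC ler_wpM2l ?mulr_ge0 ?expR_ge0//.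
  by apply: (le_trans (series_sin_le _ _)); rewrite normrM (ger0_norm th0).
- move=> w; apply: cvgMl; apply: cvgMr; exact: cvg_series_sin.
move=> n.
have -> : (fun w => h w * series (sin_coeff (theta * Y w)) n * G 0 lam w) =
  (fun w => \sum_(i < n) ((odd i)%:R * (-1) ^+ i.-1./2 * theta ^+ i / i`!%:R) * (h w * G i lam w)).
  apply/funext => w; rewrite /series/= big_mkord mulr_sumr mulr_suml.
  by apply: eq_bigr => i _; rewrite /sin_coeff/= exprMn /G expr0; ring.
rewrite (@Ex_sum _ _ _ _ n (fun i w => ((odd i)%:R * (-1) ^+ i.-1./2 * theta ^+ i / i`!%:R) * (h w * G i lam w))).
  apply: big1 => i _; rewrite ExZ; last exact: iG hM.
  by rewrite cls_pow// mulr0.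
by move=> i _; apply: rintZ; exact: iG hM.
Qed.

Let cls_cst (c : R) : cls (fun=> c).
Proof.
split; [exact: measurable_cst|by exists (`|c|) |move=> lam lt].
have l0 : 0 < lam by apply: lt_trans lt.
rewrite ExZ /G; under eq_fun do rewrite expr0 mulr1.
  by rewrite zV// mulr0.
by apply: iV; exact: ltW.
Qed.

Let cls_lin h1 h2 (a : R) : cls h1 -> cls h2 -> cls (fun w => h1 w + a * h2 w).
Proof.
move=> [m1 [M1 H1] z1] [m2 [M2 H2] z2]; split.
- by apply: measurable_funD => //; exact: measurable_funM.
- exists (M1 + `|a| * M2) => w; rewrite (le_trans (ler_normD _ _))// lerD// normrM.
  by rewrite ler_wpM2l.
- move=> lam lt.
  have -> : (fun w => (h1 w + a * h2 w) * G 0 lam w) =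
     (fun w => h1 w * G 0 lam w + a * (h2 w * G 0 lam w)) by apply/funext => w; ring.
  rewrite ExD ?ExZ ?z1 ?z2// ?mulr0 ?addr0//; try exact: iG H2; try exact: iG H1.
  by apply: rintZ; exact: iG H2.
Qed.

Let cls_lim (h_ : nat -> T -> R) h (M : R) : (forall n, cls (h_ n)) ->
  (forall n w, `|h_ n w| <= M) -> (forall w, h_ n w @[n --> \oo] --> h w) -> cls h.
Proof.
move=> ch hM hc; split.
- by apply: (measurable_fun_cvg (h := h_)) => [n|w _]; [have [] := ch n|exact: hc].
- exists M => w; exact: cvg_norm_le (fun n => hM n w) (hc w).
- move=> lam lt.
  apply: (@Ex_dct0 _ _ _ _ (fun n w => h_ n w * G 0 lam w) _ (fun w => M * `|G 0 lam w|)).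
  + by move=> n; apply: measurable_funM => //; have [] := ch n.
  + apply: rintZ; apply: rint_norm; rewrite /G; under eq_fun do rewrite expr0 mulr1.
    by apply: iV; exact/ltW/(lt_trans lam00).
  + by move=> n w; rewrite normrM ler_wpM2r.
  + by move=> w; apply: cvgMl; exact: hc.
  + by move=> n; have [_ _] := ch n; apply.
Qed.

(** [v] is the affine image of the sine in [0,1] for which sin < c reads v < 1/2. The class is
    linear and stable under multiplication by [v], hence contains [thr n (v w)] and its bounded
    limit. *)
Let cls_sin_thr (theta c : R) : 0 <= theta <= lam0 -> -1 <= c <= 1 ->
  cls (fun w => (sin (theta * Y w) < c)%R%:R).
Proof.
move=> th c1; have /andP[c2 c3] := c1.
pose v w := 2^-1 + (sin (theta * Y w) - c) / 4.
have v01 w : 0 <= v w <= 1.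
  by rewrite /v; have := sin_geN1 (theta * Y w); have := sin_le1 (theta * Y w); lra.
have clsv h : cls h -> cls (fun w => h w * v w).
  move=> ch.
  have -> : (fun w => h w * v w) =
     (fun w => ((fun=> 0) w + (2^-1 - c / 4) * h w) + 4^-1 * (h w * sin (theta * Y w))).
    by apply/funext => w; rewrite /v; field.
  by apply: cls_lin; [apply: cls_lin => //; exact: cls_cst|exact: cls_sin].
have clsvn h n : cls h -> cls (fun w => h w * v w ^+ n).
  move=> ch; elim: n => [|n IH]; first by under eq_fun do rewrite expr0 mulr1.
  by under eq_fun do rewrite exprSr mulrA; exact: clsv.
have cls1 h n : cls h -> cls (fun w => h w * (1 - v w ^+ n)).
  move=> ch; have -> : (fun w => h w * (1 - v w ^+ n)) = (fun w => h w + (-1) * (h w * v w ^+ n)).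
    by apply/funext => w; ring.
  by apply: cls_lin => //; exact: clsvn.
have clsk n k : cls (fun w => (1 - v w ^+ n) ^+ k).
  elim: k => [|k IH]; first by under eq_fun do rewrite expr0; exact: cls_cst.
  by under eq_fun do rewrite exprSr; exact: cls1.
apply: (cls_lim (h_ := fun n w => thr n (v w)) (M := 1)) => [n|n w|w].
- exact: clsk.
- by have /andP[a1 a2] := thr_bound n (v01 w); rewrite ger0_norm.
- have := thr_cvg (v01 w).
  have -> : (v w < 2^-1) = (sin (theta * Y w) < c) by rewrite /v; apply/idP/idP; lra.
  by [].
Qed.

(** As [th k] tends to 0, both [th k * Y w] and [th k * a] enter the range where the sine increases,
    so for each [w] the indicator is that of Y < a from some rank on. *)
Let cls_ray (a : R) : cls (fun w => (Y w < a)%R%:R).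
Proof.
pose th (k : nat) := lam0 / k.+1%:R.
have th0 k : 0 < th k by rewrite divr_gt0.
have thl k : th k <= lam0 by rewrite ler_pdivrMr// ler_peMr ?(ltW lam00)// ler1n.
have cth : th k @[k --> \oo] --> 0.
  by rewrite -[X in _ --> X](mulr0 lam0); apply: cvgMr; exact: cvg_invS.
apply: (cls_lim (h_ := fun k w => (sin (th k * Y w) < sin (th k * a))%R%:R) (M := 1)) => [n|n w|w].
- by apply: cls_sin_thr; rewrite ?(ltW (th0 _))//= sin_geN1 sin_le1.
- by case: ltP; rewrite ?normr1 ?normr0.
apply: cvg_near_cst; pose K := `|Y w| + `|a| + 1.
have K0 : 0 < K by rewrite /K ltr_wpDl ?addr_ge0.
have /cvgrPdist_lt /(_ K^-1) := cth; rewrite invr_gt0 => /(_ K0).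
apply: filterS => k; rewrite sub0r normrN gtr0_norm// => hk.
have bnd y : `|y| <= K -> th k * y \in `[(- (pi / 2)), (pi / 2)].
  move=> yK; rewrite in_itv/= -ler_norml normrM (gtr0_norm (th0 k)).
  apply: (@le_trans _ _ 1); last by have := pi_ge2 R; lra.
  apply: (@le_trans _ _ (K^-1 * K)); last by rewrite mulVf ?gt_eqF.
  by apply: ler_pM => //; exact: ltW.
rewrite ltr_sin ?bnd//; first by rewrite ltr_pM2l.
- by rewrite /K; have : 0 <= `|a| by []; lra.
- by rewrite /K; have : 0 <= `|Y w| by []; lra.
Qed.

Lemma laplace_ray_class (a lam : R) : lam0 < lam ->
  Ex (fun w => (Y w < a)%R%:R * (V w * expR (- (lam * Y w)))) = 0.
Proof.
move=> lt; have [_ _ /(_ _ lt) <-] := cls_ray a; rewrite /G; congr (Ex _).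
by apply/funext => w; rewrite expr0 mulr1.
Qed.

End class.

(** The weight e^(-lam Y) is removed along lam = 1/(n+1), dominated by the sum of its values at lam
    = 0 and lam = 1. *)
Let lam_to0 (h : T -> R) : measurable_fun setT h -> (forall w, `|h w| <= 1) ->
  (forall lam, 0 < lam -> Ex (fun w => h w * (V w * expR (- (lam * Y w)))) = 0) ->
  Ex (fun w => h w * V w) = 0.
Proof.
move=> mh h1 H.
have mE lam : measurable_fun setT (fun w => V w * expR (- (lam * Y w))).
  by apply: measurable_funM => //; apply: measurableT_comp => //;
     apply: measurableT_comp => //; exact: measurable_funM.
apply: (@Ex_dct0 _ _ _ _ (fun n w => h w * (V w * expR (- (n.+1%:R^-1 * Y w)))) _
   (fun w => `|V w * expR (- (0 * Y w))| + `|V w * expR (- (1 * Y w))|)).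
- by move=> n; apply: measurable_funM.
- by apply: rintD; apply: rint_norm; apply: iV.
- move=> n w; rewrite normrM.
  apply: (@le_trans _ _ (1 * `|V w * expR (- (n.+1%:R^-1 * Y w))|)); first by rewrite ler_wpM2r.
  rewrite mul1r !normrM -mulrDr ler_wpM2l// !(ger0_norm (expR_ge0 _)) mul0r oppr0 expR0 mul1r.
  have n1 : n.+1%:R^-1 <= 1 :> R by rewrite invf_le1// ler1n.
  have n0 : 0 <= n.+1%:R^-1 :> R by rewrite invr_ge0.
  have [y0|y0] := leP 0 (Y w).
    rewrite (@le_trans _ _ 1)// ?lerDl ?expR_ge0// expR_le1 oppr_le0 mulr_ge0//.
  rewrite (@le_trans _ _ (expR (- Y w)))// ?lerDr// ler_expR lerN2.
  by rewrite -{1}[Y w]mul1r ler_wnM2r// ltW.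
- move=> w; apply: cvgMr; rewrite -[X in _ --> X]mulr1; apply: cvgMr.
  rewrite -[X in _ --> X](_ : expR (- (0 * Y w)) = 1); last by rewrite mul0r oppr0 expR0.
  apply: (@cvg_comp _ _ _ (fun n : nat => - (n.+1%:R^-1 * Y w)) (@expR R));
    last exact: continuous_expR.
  by apply: cvgN; apply: cvgMl; exact: cvg_invS.
- by move=> n; rewrite H// invr_gt0.
Qed.

Lemma laplace_total0 : Ex V = 0.
Proof.
have := @lam_to0 (fun=> 1) (measurable_cst _) (fun=> ltac:(by rewrite normr1)).
rewrite (_ : (fun w => 1 * V w) = V); last by apply/funext => w; rewrite mul1r.
by apply => lam l0; under eq_fun do rewrite mul1r; exact: zV.
Qed.

Lemma laplace_ray0 (a : R) : Ex (fun w => (Y w < a)%R%:R * V w) = 0.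
Proof.
apply: lam_to0 => [|w|lam l0]; last by apply: (@laplace_ray_class (lam / 2)); lra.
  have -> : (fun w => (Y w < a)%R%:R) = \1_[set w | Y w < a] :> (T -> R).
    by apply/funext => w; rewrite indicE; congr (_%:R); rewrite mem_setE.
  by apply: measurable_indic; rewrite -[X in measurable X]setTI; exact: measurable_fun_ltr.
by case: ltP; rewrite ?normr1 ?normr0.
Qed.

End laplace_unique.

(** * Independence of increments from their joint Laplace transform *)

Section increments.
Context d (T : measurableType d) (R : realType) (P : probability T R).
Variables (alpha : R) (X : R -> T -> R).
Hypotheses (mX : forall t, measurable_fun setT (X t)) (lapX : stable_laplace P alpha X).
Local Notation rint := (rint P).
Local Notation Ex := (Expect P).
Implicit Types (t u a : R) (s lam : nat -> R) (W : T -> R) (n : nat) (w : T).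

Lemma measurable_inc t u : measurable_fun setT (fun w => X u w - X t w).
Proof. exact: measurable_funB. Qed.

Definition lin n s lam w : R := \sum_(i < n) lam i * (X (s i.+1) w - X (s i) w).
Definition psi n s lam : R := \sum_(i < n) (s i.+1 - s i) * lam i `^ alpha.

Definition admissible s lam := (forall i, s i <= s i.+1) /\ (forall i, 0 < lam i).

Lemma measurable_exp_lin n s lam : measurable_fun setT (fun w => expR (- lin n s lam w)).
Proof.
apply: measurableT_comp => //; apply: measurableT_comp => //; apply: measurable_sum => i.
by apply: measurable_funM => //; exact: measurable_inc.
Qed.

Lemma rint_exp_lin n s lam : 0 <= s 0%N -> admissible s lam ->
  rint (fun w => expR (- lin n s lam w)).
Proof.
move=> s0 [ss l0]; apply/integrableP; split.
  by apply/measurable_EFinP; exact: measurable_exp_lin.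
under eq_integral do rewrite /= ger0_norm ?expR_ge0//.
by rewrite lapX// ltry.
Qed.

Lemma Ex_exp_lin n s lam : 0 <= s 0%N -> admissible s lam ->
  Ex (fun w => expR (- lin n s lam w)) = expR (psi n s lam).
Proof. by move=> s0 [ss l0]; rewrite /Expect /Rintegral lapX. Qed.

Definition scons t s : nat -> R := fun i => if i is j.+1 then s j else t.

Lemma scons_admissible t (l : R) s lam : t <= s 0%N -> 0 < l -> admissible s lam ->
  admissible (scons t s) (scons l lam).
Proof. by move=> ts l0 [ss ll]; split=> -[|i] /=. Qed.

Lemma lin_scons t (l : R) n s lam w :
  lin n.+1 (scons t s) (scons l lam) w = l * (X (s 0%N) w - X t w) + lin n s lam w.
Proof. by rewrite /lin big_ord_recl. Qed.

Lemma psi_scons t (l : R) n s lam :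
  psi n.+1 (scons t s) (scons l lam) = (s 0%N - t) * l `^ alpha + psi n s lam.
Proof. by rewrite /psi big_ord_recl. Qed.

Lemma inc_laplace t u (l : R) : 0 <= t -> t <= u -> 0 < l ->
  rint (fun w => expR (- (l * (X u w - X t w)))) /\
  Ex (fun w => expR (- (l * (X u w - X t w)))) = expR ((u - t) * l `^ alpha).
Proof.
move=> t0 tu l0.
have adm : admissible (scons t (fun=> u)) (scons l (fun=> 1)).
  by apply: scons_admissible => //; split=> // i; exact: lexx.
have E w : lin 1 (scons t (fun=> u)) (scons l (fun=> 1)) w = l * (X u w - X t w).
  by rewrite lin_scons /lin big_ord0 addr0.
have h0 : 0 <= scons t (fun=> u) 0%N by [].
have := Ex_exp_lin 1 h0 adm; rewrite psi_scons /psi big_ord0 addr0.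
have := rint_exp_lin 1 h0 adm.
have -> : (fun w => expR (- lin 1 (scons t (fun=> u)) (scons l (fun=> 1)) w)) =
  (fun w => expR (- (l * (X u w - X t w)))) by apply/funext => w; rewrite E.
by [].
Qed.

(* [W] is independent of the increments after time [t], in the sense of Laplace
   transforms. *)
Definition ind t W := [/\ measurable_fun setT W, exists M : R, forall w, `|W w| <= M &
  forall n s lam, s 0%N = t -> admissible s lam ->
    Ex (fun w => W w * expR (- lin n s lam w)) = Ex W * expR (psi n s lam)].

Lemma ind_rint t W : ind t W -> rint W.
Proof. by move=> [mW [M hM] _]; exact: rint_bounded hM. Qed.

Lemma ind_rintM t W n s lam : 0 <= s 0%N -> admissible s lam -> ind t W ->
  rint (fun w => W w * expR (- lin n s lam w)).
Proof. by move=> s0 adm [mW [M hM] _]; apply: (rintMb mW hM); exact: rint_exp_lin. Qed.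

Lemma ind_cst t (c : R) : 0 <= t -> ind t (fun=> c).
Proof.
move=> t0; split; [exact: measurable_cst|by exists (`|c|) |move=> n s lam st adm].
by rewrite ExZ ?Ex_cst ?Ex_exp_lin//; [rewrite st|apply: rint_exp_lin; rewrite ?st].
Qed.

Lemma ind_lin t W1 W2 (c : R) : 0 <= t -> ind t W1 -> ind t W2 ->
  ind t (fun w => W1 w + c * W2 w).
Proof.
move=> t0 i1 i2; have [m1 [M1 h1] e1] := i1; have [m2 [M2 h2] e2] := i2; split.
- by apply: measurable_funD => //; exact: measurable_funM.
- exists (M1 + `|c| * M2) => w; rewrite (le_trans (ler_normD _ _))// lerD// normrM.
  by rewrite ler_wpM2l.
- move=> n s lam st adm; have s0 : 0 <= s 0%N by rewrite st.
  have -> : (fun w => (W1 w + c * W2 w) * expR (- lin n s lam w)) =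
    (fun w => W1 w * expR (- lin n s lam w) + c * (W2 w * expR (- lin n s lam w))).
    by apply/funext => w; ring.
  have j1 := ind_rintM n s0 adm i1; have j2 := ind_rintM n s0 adm i2.
  rewrite [in LHS]ExD//; last exact: rintZ j2.
  rewrite ExZ// e1// e2// [in RHS]ExD ?ExZ; first by ring.
  - exact: ind_rint i2.
  - exact: ind_rint i1.
  - by apply: rintZ; exact: ind_rint i2.
Qed.

Lemma measurable_ray t u a : measurable_fun setT (fun w => (X u w - X t w < a)%R%:R : R).
Proof.
have -> : (fun w => (X u w - X t w < a)%R%:R) = \1_[set w | X u w - X t w < a] :> (T -> R).
  by apply/funext => w; rewrite indicE; congr (_%:R); rewrite mem_setE.
apply: measurable_indic; rewrite -[X in measurable X]setTI.
by apply: measurable_fun_ltr => //; exact: measurable_inc.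
Qed.

Section step.
Variables (t u : R) (W : T -> R).
Hypotheses (t0 : 0 <= t) (tu : t <= u) (iW : ind t W).
Let u0 : 0 <= u. Proof. exact: le_trans tu. Qed.

(** Let Y be the increment over [t, u]. Prepending it to the later ones shows that W e^(-lin) - c
    has a vanishing Laplace transform against Y. Uniqueness then removes e^(-l Y), or replaces it by
    the indicator of Y < a. *)
Let step_aux n s lam : s 0%N = u -> admissible s lam ->
  Ex (fun w => W w * expR (- lin n s lam w)) = Ex W * expR (psi n s lam) /\
  forall a, Ex (fun w => (X u w - X t w < a)%R%:R * W w * expR (- lin n s lam w)) =
    Ex W * expR (psi n s lam) * Ex (fun w => (X u w - X t w < a)%R%:R).
Proof.
move=> su adm; have [mW [M hM] eW] := iW.
set c := Ex W * expR (psi n s lam).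
pose V w := W w * expR (- lin n s lam w) - c.
have s0 : 0 <= s 0%N by rewrite su.
have iWl : rint (fun w => W w * expR (- lin n s lam w)) by exact: ind_rintM iW.
have mV : measurable_fun setT V.
  apply: measurable_funB => //; apply: measurable_funM => //; exact: measurable_exp_lin.
have VE (l : R) : (fun w => V w * expR (- (l * (X u w - X t w)))) =
  (fun w => W w * expR (- lin n.+1 (scons t s) (scons l lam) w) -
            c * expR (- (l * (X u w - X t w)))).
  by apply/funext => w; rewrite /V lin_scons su opprD expRD; ring.
have iV1 (l : R) : 0 < l -> rint (fun w => W w * expR (- lin n.+1 (scons t s) (scons l lam) w)).
  move=> l0; apply: (@ind_rintM t) => //.
  by apply: scons_admissible => //; rewrite su.
have iV2 (l : R) : 0 < l -> rint (fun w => c * expR (- (l * (X u w - X t w)))).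
  by move=> l0; apply: rintZ; have [] := inc_laplace t0 tu l0.
have iV (l : R) : 0 <= l -> rint (fun w => V w * expR (- (l * (X u w - X t w)))).
  rewrite le_eqVlt => /predU1P[<-|l0]; last by rewrite VE; apply: rintB; [exact: iV1|exact: iV2].
  under eq_fun do rewrite mul0r oppr0 expR0 mulr1.
  by apply: rintB => //; exact: rint_cst.
have zV (l : R) : 0 < l -> Ex (fun w => V w * expR (- (l * (X u w - X t w)))) = 0.
  move=> l0; have [j1 j2] := inc_laplace t0 tu l0.
  rewrite VE ExB; last exact: iV2; last exact: iV1.
  rewrite ExZ// j2.
  rewrite eW//; last by apply: scons_admissible => //; rewrite su.
  by rewrite psi_scons su expRD /c; ring.
have mY : measurable_fun setT (fun w => X u w - X t w) by exact: measurable_inc.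
split.
  have := laplace_total0 mV mY iV zV; rewrite /V ExB//; last exact: rint_cst.
  by rewrite Ex_cst => /eqP; rewrite subr_eq0 => /eqP.
move=> a; have := laplace_ray0 mV mY iV zV a.
have bI w : `|(X u w - X t w < a)%R%:R| <= 1 :> R by case: ltP; rewrite ?normr1 ?normr0.
have -> : (fun w => (X u w - X t w < a)%R%:R * V w) =
  (fun w => (X u w - X t w < a)%R%:R * W w * expR (- lin n s lam w) -
            c * (X u w - X t w < a)%R%:R).
  by apply/funext => w; rewrite /V; ring.
have iI : rint (fun w => (X u w - X t w < a)%R%:R).
  by apply: rint_bounded bI; exact: measurable_ray.
rewrite ExB ?ExZ//; first by move=> /eqP; rewrite subr_eq0 => /eqP.
- have -> : (fun w => (X u w - X t w < a)%R%:R * W w * expR (- lin n s lam w)) =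
    (fun w => (X u w - X t w < a)%R%:R * (W w * expR (- lin n s lam w))).
    by apply/funext => w; rewrite mulrA.
  by apply: rintMb bI _ => //; exact: measurable_ray.
- exact: rintZ.
Qed.

Lemma ind_mono : ind u W.
Proof.
have [mW bW _] := iW; split=> // n s lam su adm.
by have [] := step_aux n su adm.
Qed.

Lemma Ex_ind_ray a : Ex (fun w => (X u w - X t w < a)%R%:R * W w) =
  Ex W * Ex (fun w => (X u w - X t w < a)%R%:R).
Proof.
have adm : admissible (fun=> u) (fun=> 1) by split=> // i; exact: lexx.
have [_ /(_ a)] := @step_aux 0 _ _ erefl adm.
rewrite /psi big_ord0 expR0 mulr1 => <-; congr (Ex _); apply/funext => w.
by rewrite /lin big_ord0 oppr0 expR0 mulr1.
Qed.

(** The closure property behind all later independence: starting from a constant, [W] accumulates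
    the indicators of successive increments. *)
Lemma ind_ray a : ind u (fun w => (X u w - X t w < a)%R%:R * W w).
Proof.
have [mW [M hM] _] := iW; split.
- by apply: measurable_funM => //; exact: measurable_ray.
- exists M => w; rewrite normrM; apply: le_trans (hM w).
  by case: ltP; rewrite ?normr1 ?normr0 ?mul1r ?mul0r.
- move=> n s lam su adm; have [_ ->] := step_aux n su adm.
  by rewrite Ex_ind_ray; ring.
Qed.

End step.

End increments.

Section exponential_inequalities.
Variable R : realType.
Implicit Types x z r v : R.

Lemma expR1_ge : 5 / 2 <= expR 1 :> R.
Proof.
have := @expR_ge1Dxn R 1 1 ler01; rewrite expr1n.
have h : 1 + (1 + 1 / 2) <= expR 1 :> R; last by move=> _; lra.
have := @series_exp_le R 1 3 ler01; rewrite /series/= big_mkord !big_ord_recr big_ord0/=.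
rewrite /exp_coeff/= !expr1n (_ : 0`! = 1%N)// (_ : 1`! = 1%N)// (_ : 2`! = 2%N)//; lra.
Qed.

Lemma expR_le_quad v : 0 <= v -> expR v <= 1 + v + v ^+ 2 * expR v.
Proof.
by move=> v0; have := expR_dist2_le v; rewrite (ger0_norm v0) ler_norml; lra.
Qed.

Lemma expR_le_lin v : 0 <= v -> expR v <= 1 + v * expR v.
Proof. by move=> v0; have := expR_dist1_le v; rewrite (ger0_norm v0) ler_norml; lra. Qed.

Lemma psi_compare_neg (k : nat) z : (0 < k)%N -> z <= 0 ->
  k%:R * `|1 - expR (- (z / k%:R))| <= `|1 - expR (- z)|.
Proof.
move=> k0 z0; have kR : 0 < k%:R :> R by rewrite ltr0n.
have zk : 0 <= - (z / k%:R) by rewrite oppr_ge0 pmulr_lle0// invr_gt0.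
have E : expR (- z) = expR (- (z / k%:R)) ^+ k.
  by rewrite -expRM_natl; congr expR; field; rewrite gt_eqF.
have e1 : 1 <= expR (- (z / k%:R)) by rewrite leNgt expR_lt1 -leNgt.
rewrite E; move: (expR _) e1 => e e1.
rewrite distrC ger0_norm ?subr_ge0// distrC ger0_norm; last by rewrite subr_ge0 exprn_ege1.
elim: k {k0 kR zk E} => [|k IH]; first by rewrite mul0r expr0 subrr.
rewrite -natr1 exprS; have : 1 <= e ^+ k by rewrite exprn_ege1.
move: IH; move: (e ^+ k) => q IH q1.
have : (e - 1) * 1 <= (e - 1) * q by rewrite ler_wpM2l//; lra.
lra.
Qed.

(** The gain 1/k^2 is that of z^2. For z <= 0 it comes from Bernoulli; for 0 < z < 1, from 1 -
    exp(-z/k) <= z/k and 1 - exp(-z) >= z/2, whence the 4. It compares one test function at two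
    scales in [upper_tail_ge]. *)
Lemma psi_compare (k : nat) z : (0 < k)%N -> z < 1 ->
  (1 - expR (- (z / k%:R))) ^+ 2 <= 4 / k%:R ^+ 2 * (1 - expR (- z)) ^+ 2.
Proof.
move=> k0 z1; have kR : 0 < k%:R :> R by rewrite ltr0n.
suff H : k%:R * `|1 - expR (- (z / k%:R))| <= 2 * `|1 - expR (- z)|.
  rewrite mulrAC ler_pdivlMr ?exprn_gt0//.
  rewrite -[(1 - _) ^+ 2]ger0_norm ?sqr_ge0// normrX -[X in _ <= _ * X]ger0_norm ?sqr_ge0// normrX.
  have -> : 4 = 2 ^+ 2 :> R by rewrite expr2; lra.
  by rewrite -!exprMn mulrC lerXn2r ?nnegrE ?mulr_ge0.
have [z0|z0] := leP z 0.
  apply: (le_trans (psi_compare_neg k0 z0)); rewrite ler_peMl//; lra.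
have h1 : 0 <= 1 - expR (- (z / k%:R)).
  by rewrite subr_ge0 expR_le1 oppr_le0 divr_ge0// ltW.
have h2 : 0 <= 1 - expR (- z) by rewrite subr_ge0 expR_le1 oppr_le0 ltW.
rewrite !ger0_norm//.
have h3 : k%:R * (1 - expR (- (z / k%:R))) <= z.
  rewrite mulrC -ler_pdivlMr//; have := expR_ge1Dx (- (z / k%:R)); lra.
apply: (le_trans h3).
have h4 : expR (- z) <= 1 - z / 2.
  rewrite expRN -[leLHS]mul1r ler_pdivrMr ?expR_gt0//.
  have := expR_ge1Dx z; move: (expR z) => e he.
  have : (1 - z / 2) * (1 + z) <= (1 - z / 2) * e by rewrite ler_wpM2l//; lra.
  have : 0 <= z * (1 - z) by rewrite mulr_ge0//; lra.
  lra.
lra.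
Qed.

(** For q = 2^alpha and v = (u - t) lam^alpha the left side is the mean of (1 - e^(-lam Y))^2, where
    Y is the increment over [t, u]. With [psi_mean_ge], where q > 2 enters, it is of exact order
    v. *)
Lemma psi_mean_le v (q : R) : 0 <= v -> 0 <= q <= 4 -> v <= 1 ->
  expR (q * v) - 2 * expR v + 1 <= 4 * expR 4 * v.
Proof.
move=> v0 /andP[q0 q4] v1.
have qv0 : 0 <= q * v by rewrite mulr_ge0.
have := expR_le_lin qv0; have := expR_ge1Dx v.
have : q * v * expR (q * v) <= 4 * expR 4 * v.
  rewrite mulrAC; apply: ler_wpM2r => //; apply: ler_pM; rewrite ?expR_ge0//.
  by rewrite ler_expR -[leRHS]mulr1 ler_pM.
lra.
Qed.

Lemma psi_mean_ge v (q : R) : 0 <= v -> v <= 1 -> v * (4 * expR 1) <= q - 2 ->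
  (q - 2) / 2 * v <= expR (q * v) - 2 * expR v + 1.
Proof.
move=> v0 v1 hv; have := expR_le_quad v0; have := expR_ge1Dx (q * v).
have : v ^+ 2 * expR v <= v * (v * expR 1).
  by rewrite expr2 -mulrA !ler_wpM2l// ler_expR.
have : v * (v * (4 * expR 1)) <= v * (q - 2) by rewrite ler_wpM2l.
lra.
Qed.

End exponential_inequalities.

(** * Tails of the increments *)

Section tails.
Context d (T : measurableType d) (R : realType) (P : probability T R).
Variables (alpha : R) (X : R -> T -> R).
Hypotheses (mX : forall t, measurable_fun setT (X t)) (lapX : stable_laplace P alpha X).
Hypotheses (al1 : 1 < alpha) (al2 : alpha < 2).
Local Notation rint := (rint P).
Local Notation Ex := (Expect P).
Implicit Types (t u a y l : R).

Definition Prob (b : T -> bool) : R := Ex (fun w => (b w)%:R).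

Lemma bool_norm (b : bool) : `|b%:R : R| <= 1.
Proof. by case: b; rewrite ?normr1 ?normr0. Qed.

Lemma rint_ray t u a : rint (fun w => (X u w - X t w < a)%R%:R).
Proof. by apply: (@rint_bounded _ _ _ _ _ 1) => [|w]; [exact: measurable_ray|exact: bool_norm]. Qed.

Lemma boolN (b : bool) : (~~ b)%:R = 1 - b%:R :> R.
Proof. by case: b; rewrite ?subrr ?subr0. Qed.

Lemma rint_coray t u a : rint (fun w => (a <= X u w - X t w)%R%:R).
Proof.
have -> : (fun w => (a <= X u w - X t w)%R%:R) = (fun w => 1 - (X u w - X t w < a)%R%:R) :> (T -> R).
  by apply/funext => w; rewrite -boolN -leNgt.
by apply: rintB; [exact: rint_cst|exact: rint_ray].
Qed.

Lemma pr_coray t u a : Prob (fun w => a <= X u w - X t w) = 1 - Prob (fun w => X u w - X t w < a).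
Proof.
rewrite /Prob.
have -> : (fun w => (a <= X u w - X t w)%R%:R) = (fun w => 1 - (X u w - X t w < a)%R%:R) :> (T -> R).
  by apply/funext => w; rewrite -boolN -leNgt.
by rewrite ExB ?Ex_cst//; [exact: rint_cst|exact: rint_ray].
Qed.

Let al0 : 0 < alpha. Proof. by apply: lt_trans al1. Qed.

Lemma chernoff t u y (lam : R) : 0 <= t -> t <= u -> 0 < lam ->
  Prob (fun w => X u w - X t w < - y) <= expR ((u - t) * lam `^ alpha - lam * y).
Proof.
move=> t0 tu l0; have [i1 e1] := inc_laplace mX lapX t0 tu l0.
rewrite expRD -e1 mulrC -ExZ//; apply: Ex_le; [exact: rint_ray|exact: rintZ|move=> w].
rewrite -expRD; case: ltP => h; last by rewrite expR_ge0.
rewrite leNgt expR_lt1 -leNgt.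
have : lam * (X u w - X t w) <= lam * - y by rewrite ler_pM2l// ltW.
lra.
Qed.

Lemma psi_mean t u (lam : R) : 0 <= t -> t <= u -> 0 < lam ->
  rint (fun w => (1 - expR (- (lam * (X u w - X t w)))) ^+ 2) /\
  Ex (fun w => (1 - expR (- (lam * (X u w - X t w)))) ^+ 2) =
  expR (2 `^ alpha * ((u - t) * lam `^ alpha)) - 2 * expR ((u - t) * lam `^ alpha) + 1.
Proof.
move=> t0 tu l0; have l20 : 0 < 2 * lam by rewrite mulr_gt0.
have [i1 e1] := inc_laplace mX lapX t0 tu l0.
have [i2 e2] := inc_laplace mX lapX t0 tu l20.
have -> : (fun w => (1 - expR (- (lam * (X u w - X t w)))) ^+ 2) =
  (fun w => expR (- (2 * lam * (X u w - X t w))) - 2 * expR (- (lam * (X u w - X t w))) + 1).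
  apply/funext => w; rewrite (_ : - (2 * lam * (X u w - X t w)) =
    - (lam * (X u w - X t w)) + - (lam * (X u w - X t w))); last by ring.
  by rewrite expRD; ring.
have j : rint (fun w => expR (- (2 * lam * (X u w - X t w))) - 2 * expR (- (lam * (X u w - X t w)))).
  by apply: rintB => //; exact: rintZ.
split; first by apply: rintD => //; exact: rint_cst.
rewrite ExD//; last exact: rint_cst.
rewrite ExB//; last exact: rintZ.
rewrite ExZ// e1 e2 Ex_cst powRM ?(ltW l0)//.
by congr (expR _ - _ + _); ring.
Qed.

Lemma psi_prefactor : 0 <= 2 `^ alpha <= 4.
Proof.
rewrite powR_ge0/= (_ : 4 = 2 `^ 2%:R); last by rewrite powR_mulrn// expr2; lra.
by rewrite ler_powR ?ler1n// ltW.
Qed.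

(** With lam = 1/y the test function is at least 1/4 on the event, and its mean is at most 4 e^4 v,
    which gives 16 e^4. For v > 1 the bound exceeds 1. *)
Lemma upper_tail t u y : 0 <= t -> t <= u -> 0 < y ->
  Prob (fun w => y <= X u w - X t w) <= 16 * expR 4 * ((u - t) * y `^ (- alpha)).
Proof.
move=> t0 tu y0; set v := (u - t) * _.
have v0 : 0 <= v by rewrite mulr_ge0 ?powR_ge0 ?subr_ge0.
have e4 : 1 <= expR 4 :> R by rewrite leNgt expR_lt1; lra.
have [v1|v1] := leP v 1; last first.
  apply: (@le_trans _ _ 1).
    rewrite -[leRHS](Ex_cst P); apply: Ex_le; [exact: rint_coray|exact: rint_cst|].
    by move=> w; apply: le_trans (ler_norm _) (bool_norm _).
  by apply: (@le_trans _ _ (1 * v)); [lra|rewrite ler_wpM2r//; lra].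
have y'0 : 0 < y^-1 by rewrite invr_gt0.
have [i e] := psi_mean t0 tu y'0.
have Ev : (u - t) * y^-1 `^ alpha = v.
  by rewrite /v -[y^-1]powR_inv1 ?(ltW y0)// -powRrM mulN1r.
rewrite Ev in e; have := psi_mean_le v0 psi_prefactor v1; rewrite -e => h.
suff : Prob (fun w => y <= X u w - X t w) <= 4 * Ex (fun w => (1 - expR (- (y^-1 * (X u w - X t w)))) ^+ 2).
  lra.
rewrite -ExZ//; apply: Ex_le; [exact: rint_coray|exact: rintZ|move=> w].
case: (leP y (X u w - X t w)) => hy /=; last by rewrite mulr_ge0// sqr_ge0.
have : expR (- (y^-1 * (X u w - X t w))) <= 2^-1.
  apply: (@le_trans _ _ (expR (-1))).
    by rewrite ler_expR lerN2 -(mulVf (lt0r_neq0 y0)) ler_pM2l.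
  by rewrite expRN lef_pV2 ?posrE ?expR_gt0//; have := expR1_ge R; lra.
have := expR_ge0 (- (y^-1 * (X u w - X t w))); move: (expR _) => q q0 q1.
have : 0 <= (2^-1 - q) * (2^-1 - q + 1) by rewrite mulr_ge0//; lra.
lra.
Qed.

(** A second moment argument for Z = e^(-lam Y) with lam^alpha = 1/(u - t): E Z = e >= 5/2, E Z^2 <=
    e^4, and Z <= 2 off the event. The pointwise bound [key], a completed square, yields e <= 2 +
    e^4 p + 1/4 for the probability p. *)
Lemma lower_tail_ge t u : 0 <= t -> t < u ->
  expR (- 4) / 4 <= Prob (fun w => X u w - X t w < - (ln 2 * (u - t) `^ alpha^-1)).
Proof.
move=> t0 tu; have l0 : 0 < u - t by rewrite subr_gt0.
set lam := (u - t) `^ (- alpha^-1); have lam0 : 0 < lam by rewrite powR_gt0.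
have Elam : (u - t) * lam `^ alpha = 1.
  rewrite /lam -powRrM mulNr mulVf ?gt_eqF// powR_inv1 ?(ltW l0)//.
  by rewrite mulfV ?gt_eqF.
have lam20 : 0 < 2 * lam by rewrite mulr_gt0.
have [i1 e1] := inc_laplace mX lapX t0 (ltW tu) lam0; rewrite Elam in e1.
have [i2 e2] := inc_laplace mX lapX t0 (ltW tu) lam20.
have e2' : Ex (fun w => expR (- (2 * lam * (X u w - X t w)))) <= expR 4.
  rewrite e2 powRM ?(ltW lam0)// mulrCA Elam mulr1 ler_expR.
  by have /andP[] := psi_prefactor.
pose E4 := expR 4 : R; have E40 : 0 < E4 by exact: expR_gt0.
set b := fun w => _; have ib : rint (fun w => (b w)%:R) by exact: rint_ray.
have key w : expR (- (lam * (X u w - X t w))) <=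
    2 + E4 * (b w)%:R + (4 * E4)^-1 * expR (- (2 * lam * (X u w - X t w))).
  have -> : - (2 * lam * (X u w - X t w)) = - (lam * (X u w - X t w)) + - (lam * (X u w - X t w)) by ring.
  rewrite expRD.
  have hb : ~~ b w -> expR (- (lam * (X u w - X t w))) <= 2.
    rewrite /b -leNgt => h; rewrite -[leRHS]lnK ?posrE// ler_expR.
    have := ler_wpM2l (ltW lam0) h.
    have -> : lam * - (ln 2 * (u - t) `^ alpha^-1) = - ln 2 * (lam * (u - t) `^ alpha^-1) by ring.
    by rewrite /lam powRN mulVf ?gt_eqF ?powR_gt0// mulr1; lra.
  have := expR_gt0 (- (lam * (X u w - X t w))); move: (expR _) hb => q hb q0.
  have q2 : 0 <= (4 * E4)^-1 * (q * q) by rewrite !mulr_ge0 ?invr_ge0 ?mulr_ge0// ltW.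
  move: hb; case: (b w) => /= hb; last by have := hb isT; lra.
  have : 0 <= (4 * E4)^-1 * ((q - 2 * E4) * (q - 2 * E4)).
    by rewrite -expr2 mulr_ge0 ?sqr_ge0// invr_ge0 mulr_ge0// ltW.
  have -> : (4 * E4)^-1 * ((q - 2 * E4) * (q - 2 * E4)) = (4 * E4)^-1 * (q * q) - q + E4.
    by field; rewrite gt_eqF.
  lra.
have : expR 1 <= 2 + E4 * Prob b + (4 * E4)^-1 * E4.
  rewrite -e1; apply: (@le_trans _ _ (2 + E4 * Prob b + (4 * E4)^-1 *
    Ex (fun w => expR (- (2 * lam * (X u w - X t w)))))); last first.
    by rewrite lerD2l ler_wpM2l// invr_ge0 mulr_ge0// ltW.
  rewrite /Prob -!ExZ// -{1}[2](Ex_cst P) -!ExD//; try exact: rint_cst; try exact: rintZ;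
    try (apply: rintD; [exact: rint_cst|exact: rintZ]).
  by apply: Ex_le => //; apply: rintD; [apply: rintD; [exact: rint_cst|exact: rintZ]|exact: rintZ].
have -> : (4 * E4)^-1 * E4 = 4^-1 by field; rewrite gt_eqF.
rewrite expRN -/E4 => h; have := expR1_ge R.
move=> h'; apply: (@le_trans _ _ (E4^-1 * (E4 * Prob b))); last by rewrite mulKf ?gt_eqF.
by rewrite ler_wpM2l ?invr_ge0 ?(ltW E40)//; lra.
Qed.

(** The test function at scale k y has mean at least a multiple of k^(-alpha) v. On Y < y it is at
    most 4/k^2 times the test function at scale y, whose mean is O(v). As alpha < 2, a large [k]
    makes this at most half of the total; the rest is carried by Y >= y, where the function is at
    most 1. *)
Lemma upper_tail_ge : exists c v0 : R, [/\ 0 < c, 0 < v0 &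
  forall t u y, 0 <= t -> t <= u -> 0 < y -> (u - t) * y `^ (- alpha) <= v0 ->
    c * ((u - t) * y `^ (- alpha)) <= Prob (fun w => y <= X u w - X t w)].
Proof.
pose q := 2 `^ alpha - 2 : R.
have q0 : 0 < q.
  rewrite subr_gt0 -{1}[2]powRr1// /powR !ifF ?gt_eqF// ltr_expR.
  by rewrite ltr_pM2r// ln_gt0// ltr1n.
have al20 : 0 < 2 - alpha by rewrite subr_gt0.
pose M := 64 * expR 4 / q.
have M0 : 0 < M by rewrite divr_gt0// mulr_gt0// expR_gt0.
pose k := (Num.truncn (M `^ (2 - alpha)^-1)).+1.
have kR : 0 < k%:R :> R by rewrite ltr0n.
have kM : M <= k%:R `^ (2 - alpha).
  have : M `^ (2 - alpha)^-1 <= k%:R.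
    by have /andP[_ /ltW] := truncn_itv (powR_ge0 M (2 - alpha)^-1).
  move=> /(ge0_ler_powR (ltW al20)); rewrite !nnegrE powR_ge0 ler0n => /(_ isT isT).
  by rewrite -powRrM mulVf ?gt_eqF// powRr1// ltW.
pose r := k%:R `^ (- alpha) : R; have r0 : 0 < r by rewrite powR_gt0.
have r1 : r <= 1.
  rewrite /r powRN invf_le1 ?powR_gt0//.
  by rewrite -[leLHS](powRr0 k%:R) ler_powR ?ler1n// ltW.
pose v0 := Num.min 1 (q / (4 * expR 1)).
have v00 : 0 < v0 by rewrite lt_min ltr01 divr_gt0// mulr_gt0// expR_gt0.
exists (q / 4 * r), v0; split => //; first by rewrite mulr_gt0// divr_gt0.
move=> t u y t0 tu y0; set v := (u - t) * _ => vv0.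
have v0' : 0 <= v by rewrite mulr_ge0 ?powR_ge0 ?subr_ge0.
have v1 : v <= 1 by apply: le_trans vv0 _; rewrite ge_min lexx.
have vq : v * (4 * expR 1) <= q.
  rewrite -ler_pdivlMr ?mulr_gt0 ?expR_gt0//.
  by apply: le_trans vv0 _; rewrite ge_min lexx orbT.
have y'0 : 0 < y^-1 by rewrite invr_gt0.
have yk0 : 0 < y^-1 / k%:R by rewrite divr_gt0.
have [i1 e1] := psi_mean t0 tu y'0; have [i2 e2] := psi_mean t0 tu yk0.
have Ev : (u - t) * y^-1 `^ alpha = v.
  by rewrite /v -[y^-1]powR_inv1 ?(ltW y0)// -powRrM mulN1r.
have Evk : (u - t) * (y^-1 / k%:R) `^ alpha = r * v.
  rewrite powRM ?invr_ge0 ?ler0n ?(ltW y0)// mulrA Ev mulrC; congr (_ * _).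
  by rewrite -[k%:R^-1]powR_inv1 ?ler0n// -powRrM mulN1r.
rewrite Ev in e1; rewrite Evk in e2.
have h1 := psi_mean_le v0' psi_prefactor v1; rewrite -e1 in h1.
have rv0 : 0 <= r * v by rewrite mulr_ge0// ltW.
have rvv : r * v <= v by rewrite -[leRHS]mul1r ler_wpM2r.
have h2 : (2 `^ alpha - 2) / 2 * (r * v) <= Ex (fun w => (1 - expR (- (y^-1 / k%:R * (X u w - X t w)))) ^+ 2).
  rewrite e2; apply: psi_mean_ge => //; first exact: le_trans rvv v1.
  apply: le_trans vq; rewrite ler_wpM2r// mulr_ge0// expR_ge0.
have h3 : Ex (fun w => (1 - expR (- (y^-1 / k%:R * (X u w - X t w)))) ^+ 2) <=
  Prob (fun w => y <= X u w - X t w) + 4 / k%:R ^+ 2 * Ex (fun w => (1 - expR (- (y^-1 * (X u w - X t w)))) ^+ 2).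
  rewrite /Prob -ExZ// -ExD; [|exact: rint_coray|exact: rintZ].
  apply: Ex_le => //; first by apply: rintD; [exact: rint_coray|exact: rintZ].
  move=> w; have p0 : 0 <= 4 / k%:R ^+ 2 * (1 - expR (- (y^-1 * (X u w - X t w)))) ^+ 2.
    by rewrite mulr_ge0 ?sqr_ge0// divr_ge0// exprn_ge0.
  have Ez : y^-1 / k%:R * (X u w - X t w) = y^-1 * (X u w - X t w) / k%:R by ring.
  rewrite Ez; case: (leP y (X u w - X t w)) => hy /=.
    have z0 : 0 <= y^-1 * (X u w - X t w) / k%:R.
      by rewrite divr_ge0// mulr_ge0 ?invr_ge0 ?(ltW y0)// (le_trans (ltW y0)).
    have a1 : expR (- (y^-1 * (X u w - X t w) / k%:R)) <= 1 by rewrite expR_le1 oppr_le0.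
    have a2 := expR_ge0 (- (y^-1 * (X u w - X t w) / k%:R)).
    have : (1 - expR (- (y^-1 * (X u w - X t w) / k%:R))) ^+ 2 <= 1.
      by rewrite exprn_ile1 ?subr_ge0 ?gerBl.
    by move=> /le_trans; apply; rewrite lerDl.
  rewrite add0r; apply: psi_compare => //.
  by rewrite -(mulVf (lt0r_neq0 y0)) ltr_pM2l.
have h4 : 4 / k%:R ^+ 2 * (4 * expR 4 * v) <= q / 4 * (r * v).
  have -> : r = k%:R `^ (2 - alpha) / k%:R ^+ 2.
    rewrite -powR_mulrn ?ler0n// -powRB; last by rewrite (gt_eqF kR) implybT.
    by rewrite /r; congr (_ `^ _); ring.
  have -> : 4 / k%:R ^+ 2 * (4 * expR 4 * v) = q / 4 * (M / k%:R ^+ 2 * v).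
    by rewrite /M; field; rewrite !gt_eqF.
  rewrite ler_wpM2l ?divr_ge0 ?(ltW q0)//; apply: ler_wpM2r => //.
  by rewrite ler_wpM2r// invr_ge0 exprn_ge0.
have h5 : 4 / k%:R ^+ 2 * Ex (fun w => (1 - expR (- (y^-1 * (X u w - X t w)))) ^+ 2) <=
   4 / k%:R ^+ 2 * (4 * expR 4 * v) by rewrite ler_wpM2l// divr_ge0// exprn_ge0.
rewrite -/q in h2.
have -> : q / 4 * r * v = q / 4 * (r * v) by rewrite mulrA.
have e6 : q / 2 * (r * v) = q / 4 * (r * v) + q / 4 * (r * v) by field.
have := le_trans h2 (le_trans h3 (lerD (lexx _) (le_trans h5 h4))).
by rewrite e6 lerD2r.
Qed.

(** Chernoff with lam^alpha equal to the inverse length leaves e exp(-z), where z = y 2^(k (1/alpha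
    - gamma)). Polynomial decay suffices afterwards: 4^k beats the 2^k intervals of level k, and y^2
    makes large drops rare. *)
Lemma dyadic_drop (gamma : R) : gamma < alpha^-1 -> exists2 C : R, 0 < C &
  forall t l y (k : nat), 0 <= t -> 0 < l -> 1 <= y ->
    Prob (fun w => X (t + l / 2 ^+ k) w - X t w < - (y * (l `^ alpha^-1 * (2 `^ (- gamma)) ^+ k)))
    <= C / (y ^+ 2 * 4 ^+ k).
Proof.
move=> gal; pose dl := alpha^-1 - gamma; have dl0 : 0 < dl by rewrite subr_gt0.
(* [dl * m >= 2] produces 4^k from z^m, and the successor is taken twice to have m >= 2 for the
   factor y^2. *)
pose m := (Num.truncn (2 / dl)).+2.
have m2 : 2 <= dl * m%:R.
  have : 2 / dl < m%:R.
    have /andP[_] := truncn_itv (divr_ge0 (ler0n R 2) (ltW dl0)).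
    by move=> h; apply: (lt_le_trans h); rewrite ler_nat.
  by move/ltW; rewrite ler_pdivrMr// mulrC.
have f0 : 0 < m`!%:R :> R by rewrite ltr0n fact_gt0.
exists (expR 1 * m`!%:R); first by rewrite mulr_gt0// expR_gt0.
move=> t l y k t0 l0 y1; have y0 : 0 < y by lra.
have k0 : 0 < 2 ^+ k :> R by rewrite exprn_gt0.
pose lam := l `^ (- alpha^-1) * (2 `^ alpha^-1) ^+ k.
have lam0 : 0 < lam by rewrite mulr_gt0 ?exprn_gt0 ?powR_gt0.
apply: (le_trans (chernoff _ t0 _ lam0)); first by rewrite lerDl divr_ge0// ltW.
have -> : (t + l / 2 ^+ k - t) * lam `^ alpha = 1.
  rewrite /lam powRM ?powR_ge0 ?exprn_ge0 ?powR_ge0// -powR_mulrn ?powR_ge0//.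
  rewrite -!powRrM mulNr mulVf ?gt_eqF// powR_inv1 ?(ltW l0)//.
  have -> : alpha^-1 * (k%:R * alpha) = k%:R by field; rewrite gt_eqF.
  rewrite powR_mulrn//; move: (2 ^+ k) k0 => K K0.
  by rewrite addrAC subrr add0r mulrA mulrAC divfK ?gt_eqF// divff ?gt_eqF.
pose z := y * (2 `^ dl) ^+ k; have z0 : 0 < z by rewrite mulr_gt0 ?exprn_gt0 ?powR_gt0.
have -> : lam * (y * (l `^ alpha^-1 * (2 `^ (- gamma)) ^+ k)) = z.
  rewrite /lam /z [l `^ (- _)]powRN.
  have -> : 2 `^ dl = 2 `^ alpha^-1 * 2 `^ (- gamma) :> R.
    by rewrite -powRD// ?pnatr_eq0 ?implybT.
  rewrite exprMn; have L0 : 0 < l `^ alpha^-1 by rewrite powR_gt0.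
  move: (l `^ alpha^-1) L0 => L L0; move: (2 `^ alpha^-1 ^+ k) (2 `^ (- gamma) ^+ k) => A B.
  have -> : L^-1 * A * (y * (L * B)) = L^-1 * L * (y * (A * B)) by ring.
  by rewrite mulVf ?mul1r// gt_eqF.
rewrite expRD expRN -mulrA ler_wpM2l ?expR_ge0//.
have h := pow_le_expR m (ltW z0).
rewrite -[leLHS]mul1r ler_pdivrMr ?expR_gt0// mulrAC ler_pdivlMr; last first.
  by rewrite mulr_gt0 ?exprn_gt0.
rewrite mul1r; apply: le_trans h; rewrite /z exprMn; apply: ler_pM.
- by rewrite exprn_ge0// ltW.
- by rewrite exprn_ge0.
- by rewrite ler_weXn2l.
- rewrite exprAC lerXn2r ?nnegrE ?exprn_ge0 ?powR_ge0//.
  rewrite -powR_mulrn ?powR_ge0// -powRrM (_ : 4 = 2 `^ 2%:R); last by rewrite powR_mulrn// expr2; lra.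
  by rewrite ler_powR ?ler1n.
Qed.

End tails.

(** * Chaining and lower regularity of paths *)

Section chaining.
Variables (R : realType) (f : R -> R) (p l : R).
Hypotheses (p0 : 0 <= p) (l0 : 0 < l).
Implicit Types (u t a : R) (z : nat -> R).

Definition dy (m i : nat) : R := p + l * i%:R / 2 ^+ m.

Let pow2 m : 0 < 2 ^+ m :> R. Proof. by rewrite exprn_gt0. Qed.

Lemma dyS m i : dy m.+1 i.*2 = dy m i.
Proof.
rewrite /dy exprS -muln2 natrM; congr (p + _); have := pow2 m.
by move: (2 ^+ m) => q q0; field; rewrite gt_eqF.
Qed.

Lemma le_dy m i j : (i <= j)%N -> dy m i <= dy m j.
Proof.
by move=> ij; rewrite lerD2l ler_wpM2r ?invr_ge0 ?(ltW (pow2 _))// ler_wpM2l ?ler_nat// ltW.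
Qed.

Lemma dy_ge m i : p <= dy m i.
Proof. by rewrite lerDl !mulr_ge0 ?invr_ge0 ?(ltW (pow2 _))// ltW. Qed.

(* Strip odd endpoints, one dyadic level at a time. *)
Lemma chain a z (k N : nat) : (k <= N)%N -> (forall m, 0 <= z m) ->
  (forall m i, (k <= m <= N)%N -> (i < 2 ^ m)%N -> a <= dy m i ->
     f (dy m i) - z m <= f (dy m i.+1)) ->
  forall i j, (i <= j)%N -> (j <= 2 ^ N)%N -> (j - i <= 2 ^ (N - k))%N -> a <= dy N i ->
  f (dy N i) - 2 * \sum_(k <= m < N.+1) z m <= f (dy N j).
Proof.
move=> kN z0; rewrite -(subnK kN) addnC; elim: (N - k)%N => [|n IH] H i j ij jN ijk ai.
  rewrite addn0 in H jN ai *; rewrite big_nat1; have zk := z0 k.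
  have : (j == i) || (j == i.+1) by move: ijk; rewrite addKn expn0; lia.
  move=> /orP[/eqP->|/eqP ji]; first by lra.
  have := H k i; rewrite leqnn -ji => /(_ isT ltac:(by lia) ai); lra.
have [->|ne] := eqVneq i j.
  by rewrite gerBl mulr_ge0// sumr_ge0.
have {ne}ij : (i < j)%N by rewrite ltn_neqAle ne.
rewrite addnS in H jN ijk ai *.
set M := (k + n)%N in H jN ijk ai IH *.
have zM := z0 M.+1.
pose i' := uphalf i; pose j' := j./2.
have i'2 : i'.*2 = (i + odd i)%N by rewrite /i' uphalf_half; have := odd_double_half i; lia.
have j'2 : (j'.*2 + odd j = j)%N by rewrite /j' addnC odd_double_half.
have si : f (dy M.+1 i) - z M.+1 <= f (dy M i').
  rewrite -(dyS M i') i'2; case: (odd i); last by rewrite addn0; lra.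
  by rewrite addn1; apply: H => //; [rewrite /M; lia|lia].
have sj : f (dy M j') - z M.+1 <= f (dy M.+1 j).
  rewrite -(dyS M j') -[X in _ <= f (dy _ X)]j'2; case E : (odd j); last by rewrite addn0; lra.
  rewrite addn1; apply: H => //; [by rewrite /M; lia|move: j'2; rewrite E; lia|].
  by apply: le_trans ai (le_dy _ _); move: j'2; rewrite E; lia.
have jN' : (j' <= 2 ^ M)%N by move: jN; rewrite expnS; lia.
have ij' : (j' - i' <= 2 ^ (M - k))%N.
  have E : (2 ^ (M.+1 - k) = 2 * 2 ^ (M - k))%N by rewrite subSn ?leq_addr// expnS.
  by move: ijk; rewrite E; lia.
have := IH _ i' j' _ jN' ij'.
have -> : a <= dy M i' by rewrite -(dyS M i'); apply: le_trans ai (le_dy _ _); lia.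
have -> : (i' <= j')%N by lia.
move=> /(_ _ isT isT) IH'.
rewrite big_nat_recr/=; last exact: leq_trans (leq_addr n k) (leqnSn M).
have := IH' ltac:(by move=> m q /andP[h1 h2]; apply: H; rewrite h1 (leq_trans h2)).
lra.
Qed.

(** Index of the first grid point at or after [u]: a ceiling, written as the complement of a
    truncation so that it never exceeds [2 ^ N]. Rounding up is what right continuity can follow. *)
Definition dyup (N : nat) u : nat := (2 ^ N - Num.truncn ((1 - (u - p) / l) * 2 ^+ N))%N.

Lemma dyup_spec N u : p <= u <= p + l -> (dyup N u <= 2 ^ N)%N /\
  u <= dy N (dyup N u) < u + l / 2 ^+ N.
Proof.
move=> /andP[pu ul]; split; first exact: leq_subr.
have x0 : 0 <= 1 - (u - p) / l by rewrite subr_ge0 ler_pdivrMr// mul1r; lra.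
have x1 : 1 - (u - p) / l <= 1 by rewrite gerBl divr_ge0 ?subr_ge0// ltW.
have /andP[h1 h2] := truncn_itv (mulr_ge0 x0 (ltW (pow2 N))).
have le : (Num.truncn ((1 - (u - p) / l) * 2 ^+ N) <= 2 ^ N)%N.
  by rewrite -(ler_nat R) (le_trans h1)// natrX -[leRHS]mul1r ler_wpM2r// ltW.
rewrite /dy /dyup natrB// natrX; move: h1 h2; set c := Num.truncn _; rewrite -natr1.
have := pow2 N; move: (2 ^+ N) => q q0.
have E : (1 - (u - p) / l) * q = q - (u - p) * q / l by ring.
rewrite E => h1 h2.
have -> : p + l * (q - c%:R) / q = u + (l / q) * ((q - (u - p) * q / l) - c%:R).
  by field; rewrite !gt_eqF.
have lq : 0 < l / q by rewrite divr_gt0.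
rewrite lerDl mulr_ge0 ?(ltW lq)//=; last by lra.
by rewrite ltrD2l -[ltRHS]mulr1 ltr_pM2l//; lra.
Qed.

Lemma dyup_dist N k u t : (k <= N)%N -> p <= u -> u <= t -> t <= p + l -> t - u <= l / 2 ^+ k ->
  (dyup N u <= dyup N t)%N /\ (dyup N t - dyup N u <= 2 ^ (N - k))%N.
Proof.
move=> kN pu ut tl tuk; rewrite /dyup.
have xt0 : 0 <= 1 - (t - p) / l by rewrite subr_ge0 ler_pdivrMr// mul1r; lra.
have le : (Num.truncn ((1 - (t - p) / l) * 2 ^+ N) <= Num.truncn ((1 - (u - p) / l) * 2 ^+ N))%N.
  apply: le_truncn; rewrite ler_wpM2r ?(ltW (pow2 _))// lerD2l lerN2.
  by rewrite ler_wpM2r ?invr_ge0 ?(ltW l0)//; lra.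
split; first by rewrite leq_sub2l.
have : (Num.truncn ((1 - (u - p) / l) * 2 ^+ N) <= Num.truncn ((1 - (t - p) / l) * 2 ^+ N) + 2 ^ (N - k))%N.
  have -> : (Num.truncn ((1 - (t - p) / l) * 2 ^+ N) + 2 ^ (N - k) =
     Num.truncn ((1 - (t - p) / l) * 2 ^+ N + (2 ^ (N - k))%:R))%N.
    rewrite [X in _ = Num.truncn X]addrC truncnD; first by rewrite natrK addnC.
    - exact: natr_nat.
    - by rewrite nnegrE mulr_ge0// ltW.
  apply: le_truncn.
  have -> : (2 ^ (N - k))%:R = 2 ^+ N / 2 ^+ k :> R.
    by rewrite natrX -{2}(subnK kN) exprD mulfK// gt_eqF.
  have h : (t - u) / l <= (2 ^+ k)^-1 by rewrite ler_pdivrMr// mulrC.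
  have -> : (1 - (u - p) / l) * 2 ^+ N = (1 - (t - p) / l) * 2 ^+ N + 2 ^+ N * ((t - u) / l) by ring.
  by rewrite lerD2l ler_wpM2l// ltW.
by lia.
Qed.

Hypothesis cf : cadlag f.

Lemma cadlag_dyup u e : p <= u <= p + l -> 0 < e ->
  exists N0 : nat, forall N, (N0 <= N)%N -> `|f (dy N (dyup N u)) - f u| < e.
Proof.
move=> ul e0; have u0 : 0 <= u by apply: le_trans p0 _; case/andP: ul.
have [dl dl0 Hd] := cadlag_right cf u0 e0.
exists (Num.truncn (l / dl)).+1 => N HN; apply: Hd.
have [_ /andP[-> h]] := dyup_spec N ul; apply: (lt_le_trans h); rewrite lerD2l.
rewrite ler_pdivrMr// mulrC -ler_pdivrMr//.
have /andP[_ h1] := truncn_itv (divr_ge0 (ltW l0) (ltW dl0)).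
apply: (le_trans (ltW h1)); rewrite -natrX ler_nat.
by apply: leq_trans HN (ltnW (ltn_expl _ _)).
Qed.

Lemma dyadic_ext a k (S u t : R) :
  (forall N i j, (k <= N)%N -> (i <= j)%N -> (j <= 2 ^ N)%N -> (j - i <= 2 ^ (N - k))%N ->
    a <= dy N i -> f (dy N i) - S <= f (dy N j)) ->
  p <= u -> a <= u -> u <= t -> t <= p + l -> t - u <= l / 2 ^+ k -> f u - S <= f t.
Proof.
move=> H pu au ut tl tuk; apply/ler_addgt0Pr => e e0.
have e2 : 0 < e / 2 by rewrite divr_gt0.
have ul : p <= u <= p + l by rewrite pu (le_trans ut).
have tl' : p <= t <= p + l by rewrite (le_trans pu ut).
have [N1 H1] := cadlag_dyup ul e2; have [N2 H2] := cadlag_dyup tl' e2.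
pose N := (k + (N1 + N2))%N.
have kN : (k <= N)%N by exact: leq_addr.
have N1N : (N1 <= N)%N by rewrite (leq_trans (leq_addr N2 N1))// leq_addl.
have N2N : (N2 <= N)%N by rewrite (leq_trans (leq_addl N1 N2))// leq_addl.
have := H1 N N1N; have := H2 N N2N.
rewrite !ltr_distl => /andP[? ?] /andP[? ?].
have [iu /andP[uu _]] := dyup_spec N ul; have [it _] := dyup_spec N tl'.
have [ij ijk] := dyup_dist kN pu ut tl tuk.
have := H N (dyup N u) (dyup N t) kN ij it ijk (le_trans au uu).
lra.
Qed.

Lemma chaining a z k (S u t : R) : (forall m, 0 <= z m) ->
  (forall N, (k <= N)%N -> \sum_(k <= m < N.+1) z m <= S) ->
  (forall m i, (k <= m)%N -> (i < 2 ^ m)%N -> a <= dy m i -> f (dy m i) - z m <= f (dy m i.+1)) ->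
  p <= u -> a <= u -> u <= t -> t <= p + l -> t - u <= l / 2 ^+ k -> f u - 2 * S <= f t.
Proof.
move=> z0 zS H; apply: dyadic_ext => N i j kN ij jN ijk ai.
apply: le_trans (chain kN z0 _ ij jN ijk ai).
  by rewrite lerD2l lerN2 ler_wpM2l// zS.
by move=> m q /andP[km _]; exact: H.
Qed.

End chaining.

Section geometric_sums.
Variable R : realType.

Lemma geom_sum_le (q : R) (k n : nat) : 0 < q -> q < 1 ->
  \sum_(k <= m < n) q ^+ m <= q ^+ k / (1 - q).
Proof.
move=> q0 q1; have h : 0 < 1 - q by rewrite subr_gt0.
have [nk|kn] := leqP n k; first by rewrite big_geq// divr_ge0 ?exprn_ge0 ?ltW.
rewrite ler_pdivlMr//.
have E m : (k <= m)%N -> (\sum_(k <= i < m) q ^+ i) * (1 - q) = q ^+ k - q ^+ m.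
  move=> km; rewrite -(subnK km) addnC; elim: (m - k)%N => [|j IH].
    by rewrite addn0 big_geq// mul0r subrr.
  by rewrite addnS big_nat_recr/= ?leq_addr// mulrDl IH exprS; ring.
by rewrite E ?(ltnW kn)// gerBl exprn_ge0// ltW.
Qed.

Lemma geom_half_le (n : nat) : \sum_(0 <= m < n) 2^-1 ^+ m <= 2 :> R.
Proof.
have h : 2^-1 < 1 :> R by rewrite invf_lt1// ltr1n.
have := @geom_sum_le 2^-1 0 n; rewrite invr_gt0 ltr0n => /(_ isT h).
have e : 1 - 2^-1 = 2^-1 :> R by rewrite {1}(splitr 1) mul1r addrK.
by rewrite expr0 e div1r invrK.
Qed.

Lemma nneseries_geom_lty (C q : R) : 0 <= C -> 0 < q -> q < 1 ->
  (\sum_(0 <= m <oo) (C * q ^+ m)%:E < +oo)%E.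
Proof.
move=> C0 q0 q1; apply: (@le_lt_trans _ _ (C * (1 / (1 - q)))%:E); last exact: ltry.
apply: lime_le; first by apply: is_cvg_nneseries => n _ _; rewrite lee_fin mulr_ge0// exprn_ge0// ltW.
apply: nearW => n; rewrite sumEFin lee_fin -mulr_sumr ler_wpM2l//.
by rewrite -[X in _ <= X / _](expr0 q) geom_sum_le.
Qed.

Lemma nneseries_tail (u : nat -> R) (e : R) : (forall m, 0 <= u m) -> 0 < e ->
  (\sum_(0 <= m <oo) (u m)%:E < +oo)%E -> exists N, (\sum_(N <= m <oo) (u m)%:E <= e%:E)%E.
Proof.
move=> u0 e0 H.
have := @nneseries_tail_cvg R (fun m => (u m)%:E) xpredT H (fun m _ => ltac:(by rewrite lee_fin)).
move=> /fine_cvgP[h1 /cvgrPdist_lt /(_ e e0) h2].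
have [N _ /(_ N (leqnn N))[/= hf]] := filterI h1 h2.
rewrite sub0r normrN => hN; exists N; rewrite -(fineK hf) lee_fin.
by apply: le_trans (ltW hN); exact: ler_norm.
Qed.

Lemma nneseries_term_le (u : nat -> R) (N m : nat) : (forall m, 0 <= u m) -> (N <= m)%N ->
  ((u m)%:E <= \sum_(N <= i <oo) (u i)%:E)%E.
Proof.
move=> u0 Nm; apply: le_trans (nneseries_lim_ge m.+1 _); last by move=> n _ _; rewrite lee_fin.
rewrite sumEFin lee_fin big_nat_recr//= lerDr sumr_ge0//.
Qed.

End geometric_sums.

Section borel_cantelli.
Context d (T : measurableType d) (R : realType) (P : probability T R).

Lemma ae_summable (S : nat -> T -> R) (c : nat -> R) : (forall m, rint P (S m)) ->
  (forall m w, 0 <= S m w) -> (forall m, Expect P (S m) <= c m) ->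
  (\sum_(0 <= m <oo) (c m)%:E < +oo)%E ->
  {ae P, forall w, (\sum_(0 <= m <oo) (S m w)%:E < +oo)%E}.
Proof.
move=> iS S0 Sc cfin.
have mS m : measurable_fun setT (fun w => (S m w)%:E).
  by apply/measurable_EFinP; exact: rint_meas.
have mSS : measurable_fun setT (fun w => \sum_(0 <= m <oo) (S m w)%:E)%E.
  by apply: ge0_emeasurable_sum => // m w _ _; rewrite lee_fin.
have S0' w : (0 <= \sum_(0 <= m <oo) (S m w)%:E)%E.
  by apply: nneseries_ge0 => m _ _; rewrite lee_fin.
have iSS : P.-integrable setT (fun w => \sum_(0 <= m <oo) (S m w)%:E)%E.
  apply/integrableP; split => //.
  under eq_integral do rewrite gee0_abs//.
  rewrite integral_nneseries//; last by move=> m w _; rewrite lee_fin.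
  apply: le_lt_trans cfin; apply: lee_nneseries => m _.
    by move=> _; apply: integral_ge0 => w _; rewrite lee_fin.
  by rewrite Ex_EFin// lee_fin.
have := integrable_ae measurableT iSS; apply: filterS => w /(_ I).
by rewrite ge0_fin_numE.
Qed.

End borel_cantelli.

Section dyadic_holder.
Variables (R : realType) (f : R -> R) (l gamma : R).
Hypotheses (cf : cadlag f) (l0 : 0 < l) (gamma0 : 0 < gamma).
Local Notation q := (2 `^ (- gamma) : R).

Lemma q_gt0 : 0 < q. Proof. by rewrite powR_gt0. Qed.

Lemma q_lt1 : q < 1.
Proof. by rewrite powRN invf_lt1 ?powR_gt0// -[ltLHS](powRr0 2) /powR !ifF ?gt_eqF// ltr_expR ltr_pM2r ?ln_gt0// ltr1n. Qed.

Lemma dyadic_scale (s : R) : 0 < s -> s <= l ->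
  exists k : nat, s <= l / 2 ^+ k /\ q ^+ k <= (2 / l) `^ gamma * s `^ gamma.
Proof.
move=> s0 sl.
have ex : exists k : nat, l / 2 ^+ k.+1 <= s.
  exists (Num.truncn (l / s)).+1; rewrite ler_pdivrMr ?exprn_gt0// mulrC -ler_pdivrMr//.
  have /andP[_ h] := truncn_itv (divr_ge0 (ltW l0) (ltW s0)).
  apply: (le_trans (ltW h)); rewrite -natrX ler_nat.
  exact: leq_trans (ltnW (ltn_expl _ (ltnSn 1))) (leq_pexp2l _ _).
case: (ex_minnP ex) => k Hk Hmin; exists k; split.
  case: k Hk Hmin => [|k] Hk Hmin; first by rewrite expr0 divr1.
  by apply/ltW; rewrite ltNge; apply/negP => /Hmin; rewrite ltnn.
rewrite -powRM ?divr_ge0 ?(ltW l0) ?(ltW s0)// -powR_mulrn ?powR_ge0// powRAC powR_mulrn//.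
rewrite powRN -powR_inv1 ?powR_ge0// powRAC powR_inv1 ?exprn_ge0//.
apply: (ge0_ler_powR (ltW gamma0)); rewrite ?nnegrE ?invr_ge0 ?exprn_ge0 ?mulr_ge0 ?invr_ge0 ?(ltW l0) ?(ltW s0)//.
move: Hk; rewrite exprS; have k0 : 0 < 2 ^+ k :> R by rewrite exprn_gt0.
move: (2 ^+ k) k0 => K K0; rewrite ler_pdivrMr ?mulr_gt0// => h.
rewrite -[leLHS]mul1r ler_pdivrMr// mulrAC mulrAC -mulrA mulrAC ler_pdivlMr// mul1r.
by apply: (le_trans h); rewrite le_eqVlt; apply/orP; left; apply/eqP; ring.
Qed.

Lemma holder_of_dyadic (A : R) : 0 < A ->
  (forall m i, (i < 2 ^ m)%N -> f (dy 0 l m i) - A * q ^+ m <= f (dy 0 l m i.+1)) ->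
  exists2 C, 0 < C & forall u t, 0 <= u -> u <= t -> t <= l -> f u - C * (t - u) `^ gamma <= f t.
Proof.
move=> A0 H; have q0 := q_gt0; have q1 : 0 < 1 - q by rewrite subr_gt0 q_lt1.
exists (2 * (A / (1 - q)) * (2 / l) `^ gamma).
  by rewrite !mulr_gt0 ?powR_gt0 ?divr_gt0 ?invr_gt0.
move=> u t u0; rewrite le_eqVlt => /predU1P[->|ut] tl.
  by rewrite gerBl mulr_ge0 ?powR_ge0// mulr_ge0 ?powR_ge0// mulr_ge0// divr_ge0// ltW.
have s0 : 0 < t - u by rewrite subr_gt0.
have [|k [k1 k2]] := dyadic_scale s0; first by lra.
have := @chaining R f 0 l (lexx 0) l0 cf 0 (fun m => A * q ^+ m) k (A * (q ^+ k / (1 - q))) u t.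
move=> /(_ _ _ _ u0 u0 (ltW ut) _ k1) h.
apply: le_trans (h _ _ _ _).
- rewrite lerD2l lerN2.
  have -> : 2 * (A / (1 - q)) * (2 / l) `^ gamma * (t - u) `^ gamma =
    (2 * (A / (1 - q))) * ((2 / l) `^ gamma * (t - u) `^ gamma) by ring.
  have -> : 2 * (A * (q ^+ k / (1 - q))) = (2 * (A / (1 - q))) * q ^+ k by ring.
  by rewrite ler_wpM2l// mulr_ge0// divr_ge0// ltW.
- by move=> m; rewrite mulr_ge0 ?exprn_ge0 ?ltW.
- by move=> N kN; rewrite -mulr_sumr ler_wpM2l ?(ltW A0)// geom_sum_le// q_lt1.
- by move=> m i _ im _; exact: H.
- by rewrite add0r.
Qed.

(** The finitely many levels below [N] only enlarge the constant, by the sum [B] of all their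
    rescaled increments. *)
Lemma holder_of_eventually (A : R) (N : nat) : 0 < A ->
  (forall m i, (N <= m)%N -> (i < 2 ^ m)%N -> f (dy 0 l m i) - A * q ^+ m <= f (dy 0 l m i.+1)) ->
  exists2 C, 0 < C & forall u t, 0 <= u -> u <= t -> t <= l -> f u - C * (t - u) `^ gamma <= f t.
Proof.
move=> A0 H; have q0 := q_gt0.
pose g m i := `|f (dy 0 l m i) - f (dy 0 l m i.+1)| / q ^+ m.
have g0 m i : 0 <= g m i by rewrite divr_ge0// exprn_ge0// ltW.
pose B := \sum_(m < N) \sum_(i < 2 ^ m) g m i.
have B0 : 0 <= B by apply: sumr_ge0 => m _; apply: sumr_ge0.
apply: (@holder_of_dyadic (A + B)); first by rewrite ltr_wpDr.
move=> m i im; have qm : 0 < q ^+ m by rewrite exprn_gt0.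
have [Nm|mN] := leqP N m.
  apply: le_trans (H m i Nm im); rewrite lerD2l lerN2 ler_wpM2r ?(ltW qm)//; lra.
have gB : g m i <= B.
  rewrite /B (bigD1 (Ordinal mN))//= (bigD1 (Ordinal im))//= -addrA lerDl.
  by rewrite addr_ge0// !sumr_ge0// => j _; apply: sumr_ge0.
have : f (dy 0 l m i) - f (dy 0 l m i.+1) <= g m i * q ^+ m.
  by rewrite /g divfK ?gt_eqF// ler_norm.
have : g m i * q ^+ m <= (A + B) * q ^+ m by rewrite ler_wpM2r ?(ltW qm)//; lra.
lra.
Qed.

End dyadic_holder.

Section holder_ae.
Context d (T : measurableType d) (R : realType) (P : probability T R).
Variables (alpha : R) (X : R -> T -> R).
Hypotheses (mX : forall t, measurable_fun setT (X t)) (lapX : stable_laplace P alpha X).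
Hypotheses (al1 : 1 < alpha) (al2 : alpha < 2).
Hypothesis cX : {ae P, forall w, cadlag (fun t => X t w)}.

Lemma dy_succ (p l : R) m i : dy p l m i.+1 = dy p l m i + l / 2 ^+ m.
Proof. by rewrite /dy -natr1; ring. Qed.

(** A count rather than an event: its expectation is a union bound, and a value below 1 excludes
    every drop. The index [i0] discards the intervals that start before a given time. *)
Definition drops (p l z : R) (m i0 : nat) (w : T) : R :=
  \sum_(i < 2 ^ m) ((i0 <= i)%N && (X (dy p l m i.+1) w - X (dy p l m i) w < - z))%:R.

Lemma drops_ge0 p l z m i0 w : 0 <= drops p l z m i0 w.
Proof. by apply: sumr_ge0 => i _; rewrite ler0n. Qed.

Lemma rint_and_ray (b : bool) (t u a : R) : rint P (fun w => (b && (X u w - X t w < a))%:R).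
Proof. by case: b => /=; [exact: rint_ray|exact: rint_cst]. Qed.

Lemma rint_drops p l z m i0 : rint P (drops p l z m i0).
Proof.
apply: (rint_sum (F := fun i w => ((i0 <= i)%N && (X (dy p l m i.+1) w - X (dy p l m i) w < - z))%:R)).
by move=> i _; exact: rint_and_ray.
Qed.

Lemma Ex_drops (gamma : R) : gamma < alpha^-1 -> exists2 C : R, 0 < C &
  forall p l y (m i0 : nat), 0 <= p -> 0 < l -> 1 <= y ->
    Expect P (drops p l (y * (l `^ alpha^-1 * (2 `^ (- gamma)) ^+ m)) m i0) <= C / y ^+ 2 * 2^-1 ^+ m.
Proof.
move=> ga; have [C C0 HC] := dyadic_drop mX lapX al1 ga; exists C => // p l y m i0 p0 l0 y1.
have y0 : 0 < y by lra.
rewrite (Ex_sum (F := fun i w => ((i0 <= i)%N && (X (dy p l m i.+1) w - X (dy p l m i) w < _))%:R));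
  last by move=> i _; exact: rint_and_ray.
apply: (@le_trans _ _ (\sum_(i < 2 ^ m) C / (y ^+ 2 * 4 ^+ m))).
  apply: ler_sum => i _; apply: le_trans (HC (dy p l m i) l y m _ l0 y1); last first.
    exact: le_trans p0 (dy_ge _ l0 _ _).
  apply: Ex_le; [exact: rint_and_ray|exact: rint_ray|move=> w].
  by rewrite dy_succ; case: (i0 <= i)%N.
rewrite sumr_const card_ord -[leLHS]mulr_natr natrX.
have -> : 4 ^+ m = 2 ^+ m * 2 ^+ m :> R by rewrite -exprMn; congr (_ ^+ _); lra.
have k0 : 0 < 2 ^+ m :> R by rewrite exprn_gt0.
rewrite exprVn; move: (2 ^+ m) k0 => K K0.
by rewrite le_eqVlt; apply/orP; left; apply/eqP; field; rewrite !gt_eqF.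
Qed.

Lemma drops_lt1 p l z m i0 w i : drops p l z m i0 w < 1 -> (i0 <= i)%N -> (i < 2 ^ m)%N ->
  X (dy p l m i) w - z <= X (dy p l m i.+1) w.
Proof.
move=> H i0i im; rewrite leNgt; apply/negP => lt; move: H; rewrite ltNge => /negP; apply.
rewrite /drops (bigD1 (Ordinal im))//= i0i/=.
have -> /= : (X (dy p l m i.+1) w - X (dy p l m i) w < - z) by lra.
by rewrite lerDl; apply: sumr_ge0 => j _; rewrite ler0n.
Qed.

(** At level m the expected number of drops beyond a multiple of 2^(-gamma m) is O(2^-m); being
    summable, the counts vanish from some level on. *)
Lemma ae_lower_holder (gamma : R) : 0 < gamma -> gamma < alpha^-1 ->
  {ae P, forall w, lower_holder gamma (fun t => X t w)}.
Proof.
move=> g0 ga; have [C C0 HC] := Ex_drops ga.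
have main (n : nat) : {ae P, forall w, exists2 C, 0 < C & forall u t, 0 <= u -> u <= t ->
    t <= n.+1%:R -> X u w - C * (t - u) `^ gamma <= X t w}.
  pose l : R := n.+1%:R; have l0 : 0 < l by rewrite ltr0n.
  pose z m : R := l `^ alpha^-1 * (2 `^ (- gamma)) ^+ m.
  have := @ae_summable _ _ _ P (fun m => drops 0 l (1 * z m) m 0) (fun m => C * 2^-1 ^+ m).
  move=> /(_ (fun m => rint_drops _ _ _ _ _) (fun m w => drops_ge0 _ _ _ _ _ _)).
  have h m : Expect P (drops 0 l (1 * z m) m 0) <= C * 2^-1 ^+ m.
    by have := HC 0 l 1 m 0%N (lexx _) l0 (lexx _); rewrite expr1n divr1.
  move=> /(_ h (nneseries_geom_lty (ltW C0) _ _)).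
  move=> /(_ ltac:(by rewrite invr_gt0) ltac:(by rewrite invf_lt1// ltr1n)).
  move=> aeS; near=> w.
  have cf : cadlag (fun t => X t w) by near: w.
  have hS : (\sum_(0 <= m <oo) (drops 0 l (1 * z m) m 0 w)%:E < +oo)%E by near: w.
  have S0 m : 0 <= drops 0 l (1 * z m) m 0 w by exact: drops_ge0.
  have h2 : 0 < 2^-1 :> R by rewrite invr_gt0.
  have [N HN] := nneseries_tail S0 h2 hS.
  apply: (@holder_of_eventually R (fun t => X t w) l gamma cf l0 g0 (l `^ alpha^-1) N).
    by rewrite powR_gt0.
  move=> m i Nm im.
  have lt1 : drops 0 l (1 * z m) m 0 w < 1.
    have := le_trans (nneseries_term_le S0 Nm) HN.
    by rewrite lee_fin => /le_lt_trans; apply; rewrite invf_lt1// ltr1n.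
  by have := drops_lt1 lt1 (leq0n i) im; rewrite mul1r.
have : {ae P, forall w, forall n : nat, exists2 C, 0 < C & forall u t, 0 <= u -> u <= t ->
    t <= n.+1%:R -> X u w - C * (t - u) `^ gamma <= X t w} by apply: ae_foralln.
apply: filterS => w H K.
have [D D0 HD] := H (Num.truncn `|K|); exists D => // u t u0 ut tK; apply: HD => //.
apply: (le_trans tK); apply: (le_trans (ler_norm _)).
by have /andP[_ /ltW] := truncn_itv (normr_ge0 K).
Unshelve. all: by end_near. Qed.

End holder_ae.

(** * Independent attempts *)

Section outer_bounds.
Context d (T : measurableType d) (R : realType) (P : probability T R).
Implicit Types (A B : set T) (r s : R).

(** An outer bound: events on whole paths, such as those mentioning [cadlag] or all real times, are
    not known to be measurable. *)
Definition pbound A r := exists B, [/\ measurable B, A `<=` B & (P B <= r%:E)%E].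

Lemma pbound_sub A B r s : A `<=` B -> r <= s -> pbound B r -> pbound A s.
Proof.
move=> AB rs [C [mC BC PC]]; exists C; split=> //; first exact: subset_trans BC.
by apply: le_trans PC _; rewrite lee_fin.
Qed.

Lemma pbound_Ex A (F : T -> R) r : rint P F -> (forall w, 0 <= F w) ->
  (forall w, A w -> 1 <= F w) -> Expect P F <= r -> pbound A r.
Proof.
move=> iF F0 AF Fr; exists [set w | 1 <= F w].
have mB : measurable [set w | 1 <= F w].
  rewrite -[X in measurable X]setTI; apply: measurable_fun_ler => //; exact: rint_meas iF.
split=> //; rewrite -[X in P X]setIT -integral_indic//.
apply: (@le_trans _ _ (Expect P F)%:E); last by rewrite lee_fin.
rewrite -Ex_EFin//; apply: ge0_le_integral => //.
- by apply/measurable_EFinP; exact: measurable_indic.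
- by apply/measurable_EFinP; exact: rint_meas iF.
- move=> w _; rewrite lee_fin indicE; case: (boolP (w \in _)) => [|_]; last exact: F0.
  by rewrite inE.
Qed.

Lemma pboundU A B r s : pbound A r -> pbound B s -> pbound (A `|` B) (r + s).
Proof.
move=> [C [mC AC PC]] [D [mD BD PD]]; exists (C `|` D); split.
- exact: measurableU.
- exact: setUSS.
- apply: le_trans (measureU2 _ mC mD) _; rewrite EFinD; exact: leeD.
Qed.

Lemma pbound_bigU n (A : nat -> set T) r : (forall i, (i < n)%N -> pbound (A i) r) ->
  pbound [set w | exists2 i, (i < n)%N & A i w] (n%:R * r).
Proof.
elim: n => [|n IH] H.
  exists set0; split=> //; first by move=> w [].
  by rewrite measure0 mul0r.
have h := pboundU (IH (fun i ni => H i (ltnW ni))) (H n (ltnSn n)).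
apply: pbound_sub h; last by rewrite -natr1 mulrDl mul1r.
move=> w [i]; rewrite ltnS leq_eqVlt => /predU1P[->|ni] Aw; first by right.
by left; exists i.
Qed.

(** Intersections of the measurable covers over [N >= n] increase with [n], each bounded by [r].
    This transfers bounds from grids to paths: it covers any event that shows on all fine grids. *)
Lemma pbound_liminf (A : nat -> set T) (N1 : nat) r :
  (forall N, (N1 <= N)%N -> pbound (A N) r) ->
  pbound [set w | exists N0, forall N, (N0 <= N)%N -> A N w] r.
Proof.
move=> H.
have /choice[B HB] : forall N, exists B, [/\ measurable B, A (N1 + N)%N `<=` B & (P B <= r%:E)%E].
  by move=> N; apply: H; exact: leq_addr.
have mB N : measurable (B N) by have [] := HB N.
pose C n := \bigcap_(N in [set N | (n <= N)%N]) B N.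
have mC n : measurable (C n) by apply: bigcap_measurable => [|k _]; [exists n => /=|exact: mB].
have ndC : nondecreasing_seq C.
  move=> m n mn; apply/subsetPset => w Cw N /= nN; apply: Cw => /=.
  exact: leq_trans mn nN.
exists (\bigcup_n C n); split.
- exact: bigcup_measurable.
- move=> w [N0 HN0]; exists N0 => // N /= N0N; have [_ + _] := HB N; apply.
  by apply: HN0; rewrite (leq_trans N0N)// leq_addl.
- have : P (C n) @[n --> \oo] --> P (\bigcup_n C n).
    by apply: nondecreasing_cvg_mu => //; exact: bigcup_measurable.
  move=> /cvg_lim <-//; apply: lime_le.
    apply: ereal_nondecreasing_is_cvgn => m n mn; apply: le_measure; rewrite ?inE//.
    by have /subsetPset := ndC _ _ mn.
  apply: nearW => n; have [_ _ PB] := HB n; apply: le_trans PB.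
  apply: le_measure; rewrite ?inE//.
  by move=> w; apply => /=.
Qed.

Lemma pbound_negligible A : (forall e, 0 < e -> pbound A e) -> P.-negligible A.
Proof.
move=> H.
have /choice[B HB] : forall n : nat, exists B, [/\ measurable B, A `<=` B & (P B <= (n.+1%:R^-1)%:E)%E].
  by move=> n; apply: H; rewrite invr_gt0.
have mB n : measurable (B n) by have [] := HB n.
exists (\bigcap_n B n); split.
- exact: bigcapT_measurable.
- apply/eqP; rewrite eq_le measure_ge0 andbT; apply/lee_addgt0Pr => e e0; rewrite add0e.
  have [N _ /(_ N (leqnn N))] : \forall n \near \oo, n.+1%:R^-1 < e.
    have /cvgrPdist_lt /(_ e e0) := @cvg_invS R; apply: filterS => n.
    by rewrite sub0r normrN gtr0_norm// invr_gt0.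
  move=> /ltW hN; have [_ _ PB] := HB N.
  apply: (@le_trans _ _ (P (B N))).
    by apply: le_measure; rewrite ?inE//; [exact: bigcapT_measurable|move=> w; apply].
  by apply: le_trans PB _; rewrite lee_fin.
- by move=> w Aw n _; have [_ + _] := HB n; apply.
Qed.

End outer_bounds.

Section attempts.
Context d (T : measurableType d) (R : realType) (P : probability T R).
Variables (alpha : R) (X : R -> T -> R).
Hypotheses (mX : forall t, measurable_fun setT (X t)) (lapX : stable_laplace P alpha X).
Hypotheses (al1 : 1 < alpha) (al2 : alpha < 2).
Local Notation ind := (ind P alpha X).
Local Notation Ex := (Expect P).
Local Notation pr := (Prob P).
Implicit Types (t u a r : R) (b : T -> bool) (W : T -> R).

(* Whatever happened before [t], the event [b], decided by time [u], has
   conditional probability at most [r]. *)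
Definition step t u b r := forall W, (forall w, 0 <= W w) -> ind t W ->
  exists W', [/\ forall w, 0 <= W' w, ind u W', forall w, b w -> W w <= W' w & Ex W' <= r * Ex W].

Lemma Ex_coray W t u a : 0 <= t -> t <= u -> ind t W ->
  ind u (fun w => (a <= X u w - X t w)%R%:R * W w) /\
  Ex (fun w => (a <= X u w - X t w)%R%:R * W w) = Ex W * pr (fun w => a <= X u w - X t w).
Proof.
move=> t0 tu iW.
have E : (fun w => (a <= X u w - X t w)%R%:R * W w) =
    (fun w => W w + (-1) * ((X u w - X t w < a)%R%:R * W w)).
  by apply/funext => w; rewrite leNgt boolN; ring.
have i1 := ind_ray mX lapX t0 tu iW a; have i2 := ind_mono mX lapX t0 tu iW.
rewrite E; split.
  by apply: ind_lin => //; exact: le_trans tu.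
rewrite ExD ?ExZ; [|exact: ind_rint i1|exact: ind_rint i2|by apply: rintZ; exact: ind_rint i1].
by rewrite (Ex_ind_ray mX lapX) // pr_coray// /Prob; ring.
Qed.

Lemma step_lt t u a r : 0 <= t -> t <= u -> 1 - r <= pr (fun w => a <= X u w - X t w) ->
  step t u (fun w => X u w - X t w < a) r.
Proof.
move=> t0 tu; rewrite pr_coray// => h W W0 iW.
exists (fun w => (X u w - X t w < a)%R%:R * W w); split.
- by move=> w; rewrite mulr_ge0.
- exact: ind_ray.
- by move=> w ->; rewrite mul1r.
- have h' : pr (fun w => X u w - X t w < a) <= r by lra.
  rewrite (Ex_ind_ray mX lapX)// mulrC; apply: ler_wpM2r => //; exact: Ex_ge0.
Qed.

Lemma step_ge t u a r : 0 <= t -> t <= u -> 1 - r <= pr (fun w => X u w - X t w < a) ->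
  step t u (fun w => a <= X u w - X t w) r.
Proof.
move=> t0 tu h W W0 iW; have [i e] := Ex_coray a t0 tu iW.
exists (fun w => (a <= X u w - X t w)%R%:R * W w); split=> //.
- by move=> w; rewrite mulr_ge0.
- by move=> w ->; rewrite mul1r.
- have h' : pr (fun w => a <= X u w - X t w) <= r by rewrite pr_coray//; lra.
  rewrite e mulrC; apply: ler_wpM2r => //; exact: Ex_ge0.
Qed.

(* Bounds the probability of [A], also conditionally on the future of [t]. *)
Definition ibound t (A : set T) r := exists W, [/\ forall w, 0 <= W w, ind t W,
  forall w, A w -> 1 <= W w & Ex W <= r].

Lemma ibound_pbound t A r : ibound t A r -> pbound P A r.
Proof. by move=> [W [W0 iW AW EW]]; apply: (pbound_Ex _ W0 AW EW); exact: ind_rint iW. Qed.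

Lemma ibound_mono t u A r : 0 <= t -> t <= u -> ibound t A r -> ibound u A r.
Proof.
by move=> t0 tu [W [W0 iW AW EW]]; exists W; split=> //; exact: ind_mono iW.
Qed.

Lemma ibound_sub t A B r s : A `<=` B -> r <= s -> ibound t B r -> ibound t A s.
Proof.
move=> AB rs [W [W0 iW BW EW]]; exists W; split=> //; last exact: le_trans rs.
by move=> w /AB; exact: BW.
Qed.

Lemma iboundU t A B r s : 0 <= t -> ibound t A r -> ibound t B s -> ibound t (A `|` B) (r + s).
Proof.
move=> t0 [W [W0 iW AW EW]] [V [V0 iV BV EV]].
exists (fun w => W w + 1 * V w); split.
- by move=> w; rewrite mul1r addr_ge0.
- exact: ind_lin.
- by move=> w [/AW|/BV] h; rewrite mul1r; [rewrite ler_wpDr|rewrite ler_wpDl].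
- under eq_fun do rewrite mul1r.
  by rewrite ExD; [exact: lerD|exact: ind_rint iW|exact: ind_rint iV].
Qed.

Lemma ibound_bigU t n (A : nat -> set T) r : 0 <= t -> (forall i, (i < n)%N -> ibound t (A i) r) ->
  ibound t [set w | exists2 i, (i < n)%N & A i w] (n%:R * r).
Proof.
move=> t0; elim: n => [|n IH] H.
  exists (fun=> 0); split=> //; first exact: ind_cst.
    by move=> w [].
  by rewrite Ex_cst mul0r.
have h := iboundU t0 (IH (fun i ni => H i (ltnW ni))) (H n (ltnSn n)).
apply: ibound_sub h; last by rewrite -natr1 mulrDl mul1r.
move=> w [i]; rewrite ltnS leq_eqVlt => /predU1P[->|ni] Aw; first by right.
by left; exists i.
Qed.

Lemma ibound_ray t u a r : 0 <= t -> t <= u -> pr (fun w => X u w - X t w < a) <= r ->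
  ibound u [set w | X u w - X t w < a] r.
Proof.
move=> t0 tu h; have i1 := ind_cst mX lapX 1 t0.
exists (fun w => (X u w - X t w < a)%R%:R * 1); split.
- by move=> w; rewrite mulr1.
- exact: ind_ray.
- by move=> w /= ->; rewrite mulr1.
- by rewrite (Ex_ind_ray mX lapX)// Ex_cst mul1r.
Qed.

Lemma ibound_coray t u a A r : 0 <= t -> t <= u -> ibound t A r ->
  ibound u [set w | A w /\ a <= X u w - X t w] (r * pr (fun w => a <= X u w - X t w)).
Proof.
move=> t0 tu [W [W0 iW AW EW]]; have [i e] := Ex_coray a t0 tu iW.
exists (fun w => (a <= X u w - X t w)%R%:R * W w); split=> //.
- by move=> w; rewrite mulr_ge0.
- by move=> w [Aw ->]; rewrite mul1r AW.
- rewrite e; apply: ler_wpM2r => //; exact: Ex_ge0.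
Qed.

Lemma attempts (J : nat) (tau : nat -> R) (b : nat -> T -> bool) r : 0 <= tau 0%N -> 0 <= r ->
  (forall j, (j < J)%N -> step (tau j) (tau j.+1) (b j) r) ->
  ibound (tau J) [set w | forall j, (j < J)%N -> b j w] (r ^+ J).
Proof.
move=> t0 r0; elim: J => [|J IH] H.
  by exists (fun=> 1); split=> //; [exact: ind_cst|rewrite Ex_cst expr0].
have [W [W0 iW bW EW]] := IH (fun j jJ => H j (ltnW jJ)).
have [W' [W'0 iW' WW' EW']] := H J (ltnSn J) W W0 iW.
exists W'; split=> // [w Hb|].
  by apply: le_trans (WW' w (Hb J (ltnSn J))); apply: bW => j jJ; apply: Hb; exact: ltnW.
by apply: (le_trans EW'); rewrite exprS ler_wpM2l.
Qed.

Let al0 : 0 < alpha. Proof. by apply: lt_trans al1. Qed.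
Let root (s : R) := s `^ alpha^-1.

Lemma root_gt0 s : 0 < s -> 0 < root s. Proof. exact: powR_gt0. Qed.

Lemma rootM s s' : 0 <= s -> 0 <= s' -> root (s * s') = root s * root s'.
Proof. exact: powRM. Qed.

Lemma root_alpha s : 0 <= s -> root s `^ alpha = s.
Proof. by move=> s0; rewrite /root -powRrM mulVf ?gt_eqF// powRr1. Qed.

Lemma root_Nalpha s : 0 <= s -> root s `^ (- alpha) = s^-1.
Proof. by move=> s0; rewrite powRN root_alpha. Qed.

Lemma le_root s s' : 0 <= s -> s <= s' -> root s <= root s'.
Proof.
move=> s0 ss; apply: ge0_ler_powR; rewrite ?nnegrE ?invr_ge0 ?(ltW al0)//.
exact: le_trans ss.
Qed.

Lemma root_half_le (s s' : R) : 0 <= s -> s / 2 <= s' -> root s / 2 <= root s'.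
Proof.
move=> s0 ss; apply: (@le_trans _ _ (root (s / 2))); last by rewrite le_root// divr_ge0.
rewrite [leRHS]rootM ?invr_ge0// ler_wpM2l ?powR_ge0//.
rewrite /root -[X in X <= _]powRr1 ?invr_ge0//; apply: ger_powR.
  by rewrite invr_gt0 ltr0n invf_le1// ler1n.
by rewrite invf_le1// ltW.
Qed.

Lemma half_le_ln2 : 2^-1 <= ln 2 :> R.
Proof.
have := @le_ln1Dx R (- 2^-1); have -> : 1 + - 2^-1 = 2^-1 :> R by lra.
rewrite lnV ?posrE//; lra.
Qed.

Lemma pbound_pr b r : rint P (fun w => (b w)%:R) -> pr b <= r -> pbound P [set w | b w] r.
Proof. by move=> ib pb; apply: pbound_Ex ib _ _ pb => [w|w /= ->]. Qed.

(* Between consecutive times [t - s / A ^+ j] the path makes independent attempts to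
   rise; what happens after the attempt is negligible when [A] is large. *)
Lemma rise_attempts : exists kappa p C : R, [/\ 0 < kappa, 0 < p, p <= 1, 0 < C &
  forall (J : nat) (t s A dl : R), 1 <= kappa * root A -> 2 <= A -> 0 < s -> s <= t ->
    dl < kappa * root (s / A ^+ J) ->
    ibound t [set w | forall j, (j <= J)%N -> X t w - X (t - s / A ^+ j) w <= dl]
      ((1 - p) ^+ J + J%:R * (C / (kappa * root A) ^+ 2))].
Proof.
have [c [v0 [c0 v00 Hc]]] := upper_tail_ge mX lapX al1 al2.
(* At [gamma = 0] and level 0 this is a tail bound C / y^2 for a single fall, measured in units of
   length^(1/alpha). *)
have [C C0 HC] := dyadic_drop mX lapX al1 (gamma := 0) ltac:(by rewrite invr_gt0).
(* Large enough for a rise of 2 kappa s^(1/alpha) within a time at most s to lie in the range of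
   [upper_tail_ge]. *)
pose kappa := (Num.max 1 (v0^-1)) `^ alpha^-1.
have k1 : 0 < Num.max 1 (v0^-1) by rewrite lt_max ltr01.
have kap0 : 0 < kappa by rewrite powR_gt0.
have y2 (s : R) : 0 < s -> (2 * (kappa * root s)) `^ (- alpha) = (2 * kappa) `^ (- alpha) / s.
  by move=> s0; rewrite mulrA powRM ?root_Nalpha ?mulr_ge0 ?(ltW kap0) ?ltW ?root_gt0.
have kv : (2 * kappa) `^ (- alpha) <= v0.
  rewrite powRN powRM ?(ltW kap0)// -/(root _) root_alpha ?(ltW k1)//.
  rewrite -[leRHS]invrK lef_pV2 ?posrE ?mulr_gt0 ?powR_gt0 ?invr_gt0//.
  apply: (@le_trans _ _ (1 * Num.max 1 v0^-1)).
    by rewrite mul1r le_max lexx orbT.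
  rewrite ler_wpM2r ?(ltW k1)// -[leLHS](powRr0 2) ler_powR ?ler1n//; exact: ltW.
pose p := Num.min 1 (c * ((2 * kappa) `^ (- alpha) / 2)).
have pk0 : 0 < (2 * kappa) `^ (- alpha) by rewrite powR_gt0// mulr_gt0.
have p0 : 0 < p by rewrite lt_min ltr01/= mulr_gt0// divr_gt0.
have p1 : p <= 1 by rewrite ge_min lexx.
exists kappa, p, C; split=> // J t s A dl kA A2 s0 st hdl.
have A0 : 0 < A by lra.
have sj j : 0 < s / A ^+ j by rewrite divr_gt0// exprn_gt0.
have sjS j : s / A ^+ j = (s / A ^+ j.+1) * A.
  by rewrite exprS; have := exprn_gt0 j A0; move: (A ^+ j) => q q0; field; rewrite !gt_eqF.
have sle j : s / A ^+ j <= s.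
  by rewrite ler_pdivrMr ?exprn_gt0// ler_peMr ?(ltW s0)// exprn_ege1//; lra.
have sle2 j : s / A ^+ j.+1 <= s / A ^+ j / 2.
  by rewrite ler_pdivlMr// [leRHS]sjS ler_wpM2l// ltW.
have tau0 j : 0 <= t - s / A ^+ j by have := sle j; lra.
pose tau j := t - s / A ^+ j.
pose b j w := X (tau j.+1) w - X (tau j) w < 2 * (kappa * root (s / A ^+ j)).
have t0 : 0 <= t by lra.
have taut j : tau j <= t by rewrite gerBl ltW.
have B1 : ibound t [set w | forall j, (j < J)%N -> b j w] ((1 - p) ^+ J).
  apply: (ibound_mono (tau0 J) (taut J)); apply: (@attempts J tau) => [||j _]; [exact: tau0|by rewrite subr_ge0|].
  have tt : tau j <= tau j.+1 by rewrite lerD2l lerN2; have := sle2 j; have := sj j; lra.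
  apply: step_lt => //; first exact: tau0.
  have E : tau j.+1 - tau j = s / A ^+ j - s / A ^+ j.+1 by rewrite /tau; ring.
  have h1 : (tau j.+1 - tau j) * (2 * (kappa * root (s / A ^+ j))) `^ (- alpha) <= v0.
    rewrite y2// mulrCA; apply: le_trans kv; rewrite -[leRHS]mulr1 ler_wpM2l ?(ltW pk0)//.
    by rewrite ler_pdivrMr// mul1r E gerBl ltW.
  apply: le_trans (Hc _ _ _ (tau0 j) tt _ h1); last by rewrite !mulr_gt0 ?root_gt0.
  rewrite opprB addrC subrK; apply: (@le_trans _ _ (c * ((2 * kappa) `^ (- alpha) / 2))).
    by rewrite ge_min lexx orbT.
  rewrite ler_wpM2l ?(ltW c0)// y2// mulrCA ler_wpM2l ?(ltW pk0)//.
  by rewrite ler_pdivlMr// E; have := sle2 j; lra.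
(* After a rise by 2 kappa (s / A^j)^(1/alpha), only a fall by half of it could spoil the success.
   That is kappa A^(1/alpha) times the natural scale of the remaining time s / A^(j+1). *)
have B2 : ibound t [set w | exists2 j, (j < J)%N &
    (X (tau j.+1 + s / A ^+ j.+1 / 2 ^+ 0) w - X (tau j.+1) w < - (kappa * root A * (root (s / A ^+ j.+1) * (2 `^ (- 0)) ^+ 0)))]
    (J%:R * (C / (kappa * root A) ^+ 2)).
  apply: ibound_bigU => // j _; have E : tau j.+1 + s / A ^+ j.+1 / 2 ^+ 0 = t.
    by rewrite expr0 divr1 subrK.
  rewrite -[X in ibound X]E; apply: ibound_ray; first exact: tau0.
    by rewrite E.
  by apply: le_trans (HC _ _ _ 0%N _ (sj _) kA) _; rewrite ?tau0// expr0 mulr1.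
apply: ibound_sub (lexx _) (iboundU t0 B1 B2) => w Hw.
have [?|] := pselect (forall j, (j < J)%N -> b j w); first by left.
move=> /existsNP[j /not_implyP[jJ /negP nb]]; right; exists j => //.
move: nb; rewrite /b -leNgt => nb; have hj := Hw j (ltnW jJ).
rewrite !expr0 divr1 mulr1 {1}/tau subrK -mulrA -rootM ?(ltW A0) ?(ltW (sj _))//.
rewrite [A * _]mulrC -sjS.
have : kappa * root (s / A ^+ J) <= kappa * root (s / A ^+ j).
  rewrite ler_wpM2l ?(ltW kap0)// le_root ?(ltW (sj _))//.
  rewrite ler_wpM2l ?(ltW s0)// lef_pV2 ?posrE ?exprn_gt0// ler_weXn2l//; first lra.
  exact: ltnW.
move: nb hj; rewrite /tau; lra.
Qed.

(** Let R_j = (s A^(j+1))^(1/alpha). The block from t + s A^j to t + s A^(j+1) falls by R_j / 4 with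
    probability at least e^(-4) / 4, and the path has risen by R_j / 8 before it with probability
    O(1/A) only; a success leaves it lower by R_j / 8 >= y. The 64 bounds 8^alpha. *)
Lemma fall_attempts : exists C : R, 0 < C /\
  forall (J : nat) (t s A y : R), 2 <= A -> 0 < s -> 0 <= t -> y <= root s / 8 ->
    pbound P [set w | forall j, (j <= J)%N -> - y < X (t + s * A ^+ j) w - X t w]
      ((1 - expR (- 4) / 4) ^+ J + J%:R * (C / A)).
Proof.
exists (16 * expR 4 * 64); split; first by rewrite !mulr_gt0 ?expR_gt0.
move=> J t s A y A2 s0 t0 hy; have A0 : 0 < A by lra.
have sj j : 0 < s * A ^+ j by rewrite mulr_gt0// exprn_gt0.
have sjS j : s * A ^+ j.+1 = s * A ^+ j * A by rewrite exprSr mulrA.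
pose tau j := t + s * A ^+ j.
have tau0 j : 0 <= tau j by rewrite addr_ge0// ltW.
have s2 j : s * A ^+ j.+1 / 2 <= tau j.+1 - tau j.
  have := ler_wpM2l (ltW (sj j)) A2; rewrite -sjS /tau; lra.
have tt j : tau j < tau j.+1 by have := s2 j; have := sj j.+1; lra.
pose b j w := - (ln 2 * root (tau j.+1 - tau j)) <= X (tau j.+1) w - X (tau j) w.
have e4 : expR (- 4) / 4 <= 1 :> R.
  have : expR (- 4) <= 1 :> R by rewrite expR_le1; lra.
  lra.
have B1 : pbound P [set w | forall j, (j < J)%N -> b j w] ((1 - expR (- 4) / 4) ^+ J).
  apply: (@ibound_pbound (tau J)); apply: (@attempts J tau) => [||j _]; [exact: tau0|by rewrite subr_ge0|].
  apply: step_ge => //; first exact: ltW.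
  by rewrite opprB addrC subrK; apply: lower_tail_ge.
have B2 : pbound P [set w | exists2 j, (j < J)%N &
    root (s * A ^+ j.+1) / 8 <= X (tau j) w - X t w] (J%:R * (16 * expR 4 * 64 / A)).
  apply: pbound_bigU => j _; apply: pbound_pr; first exact: rint_coray.
  apply: (le_trans (upper_tail mX lapX al2 t0 _ _)).
  - by rewrite lerDl ltW.
  - by rewrite divr_gt0// root_gt0.
  - rewrite -[leRHS]mulrA; apply: ler_wpM2l; first by rewrite mulr_ge0// expR_ge0.
    rewrite powRM ?invr_ge0 ?(ltW (root_gt0 (sj _)))// root_Nalpha ?(ltW (sj _))//.
    rewrite sjS /tau addrAC subrr add0r; have := sj j; move: (s * A ^+ j) => q q0.
    have -> : q * ((q * A)^-1 * 8^-1 `^ (- alpha)) = 8^-1 `^ (- alpha) / A.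
      by field; rewrite !gt_eqF.
    rewrite ler_wpM2r ?invr_ge0 ?(ltW A0)//.
    rewrite -[8^-1]powR_inv1// -powRrM mulN1r opprK.
    rewrite (_ : 64 = 8 `^ 2%:R); last by rewrite powR_mulrn// expr2; lra.
    by rewrite ler_powR ?ler1n// ltW.
apply: pbound_sub (lexx _) (pboundU B1 B2) => w Hw.
have [?|] := pselect (forall j, (j < J)%N -> b j w); first by left.
move=> /existsNP[j /not_implyP[jJ /negP nb]]; right; exists j => //.
move: nb; rewrite /b -ltNge => nb; have := Hw j.+1 jJ; rewrite -/(tau j.+1).
have r1 : root (s * A ^+ j.+1) / 2 <= root (tau j.+1 - tau j).
  by apply: root_half_le => //; exact: ltW.
have l2 := half_le_ln2.
have r3 : root (s * A ^+ j.+1) / 4 <= ln 2 * root (tau j.+1 - tau j).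
  have -> : root (s * A ^+ j.+1) / 4 = 2^-1 * (root (s * A ^+ j.+1) / 2) by field.
  by apply: ler_pM => //; rewrite ?invr_ge0// divr_ge0// ltW// root_gt0.
have r4 : root s <= root (s * A ^+ j.+1).
  by rewrite le_root ?(ltW s0)// ler_peMr ?(ltW s0)// exprn_ege1//; lra.
lra.
Qed.

End attempts.

(** * Almost sure properties of the paths *)

Section ae_paths.
Context d (T : measurableType d) (R : realType) (P : probability T R).
Variables (alpha : R) (X : R -> T -> R).
Hypotheses (mX : forall t, measurable_fun setT (X t)) (lapX : stable_laplace P alpha X).
Hypotheses (al1 : 1 < alpha) (al2 : alpha < 2).
Hypothesis cX : {ae P, forall w, cadlag (fun t => X t w)}.
Local Notation root s := (s `^ alpha^-1).
Let al0 : 0 < alpha. Proof. by apply: lt_trans al1. Qed.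

Lemma expr_small (r e : R) : 0 <= r -> r < 1 -> 0 < e -> exists J : nat, r ^+ J < e.
Proof.
move=> r0 r1 e0; have h : `|r| < 1 by rewrite ger0_norm.
have /cvgrPdist_lt /(_ e e0)[N _ /(_ N (leqnn N))] := cvg_expr h.
by rewrite sub0r normrN ger0_norm ?exprn_ge0//; exists N.
Qed.

Lemma ae_unbounded_below : {ae P, forall w, forall M : R, exists2 s, 1 <= s & X s w < M}.
Proof.
have [C [C0 HC]] := fall_attempts mX lapX al1 al2.
have neg (n : nat) : P.-negligible [set w | forall s : R, 1 <= s -> - n%:R < X s w - X 1 w].
  apply: pbound_negligible => e e0; have e2 : 0 < e / 2 by rewrite divr_gt0.
  have [J HJ] : exists J : nat, (1 - expR (- 4) / 4) ^+ J < e / 2.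
    have h1 : expR (- 4) <= 1 :> R by rewrite expR_le1; lra.
    have h2 := expR_gt0 (- 4 : R).
    by apply: expr_small => //; lra.
  pose A := Num.max 2 (J%:R * C / (e / 2)).
  have A2 : 2 <= A by rewrite le_max lexx.
  pose s := (8 * n.+1%:R) `^ alpha : R.
  have s0 : 0 < s by rewrite powR_gt0// mulr_gt0.
  have hy : n%:R <= root s / 8.
    rewrite /s -powRrM mulfV ?gt_eqF// powRr1// mulrAC mulfV// mul1r ler_nat//.
  apply: pbound_sub (HC J 1 s A n%:R A2 s0 ler01 hy).
    move=> w Hw j jJ; apply: Hw; rewrite lerDl mulr_ge0 ?exprn_ge0 ?(ltW s0)//; lra.
  have A0 : 0 < A by lra.
  have : J%:R * (C / A) <= e / 2.
    by rewrite mulrA ler_pdivrMr// [leRHS]mulrC -ler_pdivrMr// le_max lexx orbT.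
  lra.
have := negligible_bigcup neg; apply: negligibleS => w /= /existsNP[M HM].
pose n := (Num.truncn `|X 1 w - M|).+1.
exists n => // s s1; rewrite ltNge; apply/negP => h; apply: HM; exists s => //.
have /andP[_ hn] := truncn_itv (normr_ge0 (X 1 w - M)).
have := ler_norm (X 1 w - M); rewrite -/n in hn.
have : s \in `[1, +oo[ by rewrite in_itv/= s1.
lra.
Qed.

(** [J] is chosen first, for the geometric term, then [A], for the errors of the [J] blocks. All
    choices are uniform in [t], as a union over grid points requires. *)
Lemma rise_small (e s : R) : 0 < e -> 0 < s -> exists J (A dl : R), [/\ 2 <= A, 0 < dl &
  forall t, s <= t ->
  ibound P alpha X t [set w | forall j, (j <= J)%N -> X t w - X (t - s / A ^+ j) w <= dl] e].
Proof.
move=> e0 s0; have [kappa [p [C [k0 p0 p1 C0 HC]]]] := rise_attempts mX lapX al1 al2.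
have e2 : 0 < e / 2 by rewrite divr_gt0.
have [J HJ] : exists J : nat, (1 - p) ^+ J < e / 2 by apply: expr_small => //; lra.
pose y := Num.max 1 (J%:R * C / (e / 2)).
have y1 : 1 <= y by rewrite le_max lexx.
pose A := Num.max 2 ((y / kappa) `^ alpha).
have A2 : 2 <= A by rewrite le_max lexx.
have A0 : 0 < A by lra.
have yA : y <= kappa * root A.
  rewrite mulrC -ler_pdivrMr//.
  have -> : y / kappa = root ((y / kappa) `^ alpha).
    rewrite -powRrM mulfV ?gt_eqF// powRr1// divr_ge0//; last exact: ltW.
    exact: le_trans y1.
  apply: ge0_ler_powR; rewrite ?nnegrE ?powR_ge0 ?invr_ge0 ?(ltW al0) ?(ltW A0)//.
  by rewrite le_max lexx orbT.
have rA : 0 < kappa * root A by apply: lt_le_trans yA; exact: lt_le_trans y1.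
have r0 : 0 < kappa * root (s / A ^+ J) by rewrite mulr_gt0// powR_gt0// divr_gt0// exprn_gt0.
exists J, A, (kappa * root (s / A ^+ J) / 2); split => //; first by rewrite divr_gt0.
move=> t st; have hd : kappa * root (s / A ^+ J) / 2 < kappa * root (s / A ^+ J) by lra.
apply: ibound_sub (HC J t s A _ (le_trans y1 yA) A2 s0 st hd) => //.
have : J%:R * (C / (kappa * root A) ^+ 2) <= e / 2.
  rewrite mulrA ler_pdivrMr ?exprn_gt0// [leRHS]mulrC -ler_pdivrMr//.
  apply: (@le_trans _ _ y); first by rewrite le_max lexx orbT.
  rewrite expr2; apply: (le_trans yA); rewrite ler_peMr ?(ltW rA)//.
  exact: le_trans y1 yA.
lra.
Qed.

Lemma ae_not_min1 : {ae P, forall w, exists2 u, 0 <= u <= 1 & X u w < X 1 w}.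
Proof.
apply: (@negligibleS _ _ _ _ [set w | forall u, 0 <= u <= 1 -> X 1 w <= X u w]).
  move=> w /= H u u01; rewrite leNgt; apply/negP => h; apply: H; exists u => //.
apply: pbound_negligible => e e0.
have [J [A [dl [A2 dl0 HJ]]]] := rise_small e0 ltr01.
apply: pbound_sub (ibound_pbound (HJ 1 (lexx _))) => // w Hw j _.
have A0 : 0 < A ^+ j by rewrite exprn_gt0//; lra.
have A1 : 1 <= A ^+ j by rewrite exprn_ege1//; lra.
have : X 1 w <= X (1 - 1 / A ^+ j) w.
  have h1 : 1 / A ^+ j <= 1 by rewrite ler_pdivrMr// mul1r.
  have h2 : 0 <= 1 / A ^+ j by rewrite divr_ge0// ltW.
  by apply: Hw; apply/andP; split; lra.
lra.
Qed.

Definition jump_from_inf (eta s0 K : R) (f : R -> R) :=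
  exists r l, [/\ s0 < r, r <= K, leftlim f r l, (forall u, 0 <= u < r -> l <= f u) & l + eta < f r].

(** The grid interval that contains [r] starts just before it, near the left limit [l], hence with
    almost no rise from any earlier time, and ends at or just after it, having gained at least eta /
    2. *)
Lemma jump_from_inf_grid (eta s0 K dl s A : R) (J : nat) (f : R -> R) : cadlag f -> 0 < eta -> 0 < s0 ->
  0 < s -> s < s0 -> 0 < dl -> 2 <= A -> 0 < K -> jump_from_inf eta s0 K f ->
  exists N0, forall N, (N0 <= N)%N -> exists2 i, (i < 2 ^ N)%N &
    (s <= dy 0 K N i) /\ ((forall j, (j <= J)%N -> f (dy 0 K N i) - f (dy 0 K N i - s / A ^+ j) <= dl) /\
     eta / 2 <= f (dy 0 K N i.+1) - f (dy 0 K N i)).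
Proof.
move=> cf e0 s00 s_gt0 ss dl0 A2 K0 [r [l [sr rK Hl Hinf Hj]]].
have r0 : 0 < r by apply: lt_trans sr.
pose ee := Num.min dl (eta / 4).
have ee0 : 0 < ee by rewrite lt_min dl0 divr_gt0.
have [d1 d10 H1] := Hl _ ee0.
have [d2 d20 H2] := cadlag_right cf (ltW r0) ee0.
pose dd := Num.min (Num.min d1 d2) (s0 - s).
have dd0 : 0 < dd by rewrite !lt_min d10 d20 subr_gt0.
exists (Num.truncn (K / dd)).+1 => N HN.
have N0 : 0 < 2 ^+ N :> R by rewrite exprn_gt0.
have Kdd : K / 2 ^+ N < dd.
  rewrite ltr_pdivrMr// mulrC -ltr_pdivrMr//.
  have /andP[_ h] := truncn_itv (divr_ge0 (ltW K0) (ltW dd0)).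
  apply: (lt_le_trans h); rewrite -natrX ler_nat.
  by apply: leq_trans HN (ltnW (ltn_expl _ _)).
have /(dyup_spec K0 N)[c1 /andP[c2 c3]] : 0 <= r <= 0 + K by rewrite (ltW r0) add0r.
case E : (dyup 0 K N r) c1 c2 c3 => [|i] c1 c2 c3.
  by move: c2; rewrite /dy mulr0 mul0r addr0 leNgt r0.
exists i => //; rewrite dy_succ in c2 c3 *; set t := dy 0 K N i in c2 c3 *.
have tr : t < r by lra.
have [dd1 dd2 dd3] : [/\ dd <= d1, dd <= d2 & dd <= s0 - s].
  by rewrite !ge_min !lexx !orbT.
have ee1 : ee <= dl by rewrite ge_min lexx.
have ee2 : ee <= eta / 4 by rewrite ge_min lexx orbT.
have st : s <= t by lra.
have tl : `|f t - l| < ee by apply: H1; apply/andP; split; lra.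
have th : `|f (t + K / 2 ^+ N) - f r| < ee by apply: H2; apply/andP; split; lra.
move: tl th; rewrite !ltr_distl => /andP[t1 t2] /andP[t3 t4].
split=> //; split; last by lra.
move=> j _; have A0 : 0 < A ^+ j by rewrite exprn_gt0//; lra.
have A1 : 1 <= A ^+ j by rewrite exprn_ege1//; lra.
have sA0 : 0 < s / A ^+ j by rewrite divr_gt0.
have sA : s / A ^+ j <= s by rewrite ler_pdivrMr// ler_peMr// ltW.
have := Hinf (t - s / A ^+ j); have -> : 0 <= t - s / A ^+ j < r by apply/andP; split; lra.
move=> /(_ isT); lra.
Qed.

(** On a grid interval of length K / 2^N, a gain of eta / 2 has probability O(2^-N) and is
    independent of the past, where the absence of a rise has probability at most e / C. The 2^N
    intervals together cost at most e, for arbitrary e. *)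
Lemma negligible_jump_from_inf (eta s0 K : R) : 0 < eta -> 0 < s0 -> 0 < K ->
  P.-negligible [set w | cadlag (fun t => X t w) /\ jump_from_inf eta s0 K (fun t => X t w)].
Proof.
move=> e0 s00 K0; apply: pbound_negligible => e e_gt0.
pose C := 16 * expR 4 * (eta / 2) `^ (- alpha) * K.
have C0 : 0 < C by rewrite !mulr_gt0 ?expR_gt0 ?powR_gt0// divr_gt0.
have eC : 0 < e / C by rewrite divr_gt0.
have s2 : 0 < s0 / 2 by rewrite divr_gt0.
have [J [A [dl [A2 dl0 HJ]]]] := rise_small eC s2.
pose B N i w := (s0 / 2 <= dy 0 K N i) /\
  ((forall j, (j <= J)%N -> X (dy 0 K N i) w - X (dy 0 K N i - s0 / 2 / A ^+ j) w <= dl) /\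
     eta / 2 <= X (dy 0 K N i.+1) w - X (dy 0 K N i) w).
apply: (@pbound_sub _ _ _ _ _ [set w | exists N0, forall N, (N0 <= N)%N ->
    [set w | exists2 i, (i < 2 ^ N)%N & B N i w] w] e e) => //.
  move=> w [cf Hj]; have h : s0 / 2 < s0 by lra.
  have [N0 HN0] := @jump_from_inf_grid eta s0 K dl (s0 / 2) A J (fun t => X t w)
    cf e0 s00 s2 h dl0 A2 K0 Hj.
  by exists N0.
apply: (@pbound_liminf _ _ _ _ _ 0%N) => N _.
have N0 : 0 < 2 ^+ N :> R by rewrite exprn_gt0.
have -> : e = (2 ^ N)%:R * (e / 2 ^+ N) by rewrite natrX mulrCA mulfV ?mulr1// gt_eqF.
apply: pbound_bigU => i iN.
have [st|ts] := leP (s0 / 2) (dy 0 K N i); last first.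
  apply: (@pbound_sub _ _ _ _ _ set0 0).
  - by move=> w [h]; lra.
  - by rewrite divr_ge0 ?ltW.
  - by exists set0; split=> //; rewrite measure0.
have t0 : 0 <= dy 0 K N i by lra.
have tt : dy 0 K N i <= dy 0 K N i.+1 by rewrite dy_succ lerDl divr_ge0 ?ltW.
have h := ibound_coray mX lapX (eta / 2) t0 tt (HJ _ st).
apply: pbound_sub (ibound_pbound h); first by move=> w [_].
apply: (@le_trans _ _ (e / C * (16 * expR 4 * (K / 2 ^+ N * (eta / 2) `^ (- alpha))))).
  rewrite ler_wpM2l ?(ltW eC)//.
  have eta2 : 0 < eta / 2 by rewrite divr_gt0.
  apply: le_trans (upper_tail mX lapX al2 t0 tt eta2) _.
  by rewrite dy_succ [dy _ _ _ _ + _]addrC addrK.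
rewrite le_eqVlt; apply/orP; left; apply/eqP; rewrite /C.
have := powR_gt0 (- alpha) (_ : 0 < eta / 2); rewrite divr_gt0// => /(_ isT).
have := expR_gt0 (4 : R); move: (_ `^ _) (expR 4) (2 ^+ N) N0 => a b c c0 b0 a0.
by field; rewrite !gt_eqF.
Qed.

Lemma ae_no_jump_from_inf : {ae P, forall w, no_jump_from_inf (fun t => X t w)}.
Proof.
have pos (n : nat) : 0 < n.+1%:R^-1 :> R by rewrite invr_gt0.
have h (n m k : nat) := @negligible_jump_from_inf (n.+1%:R^-1) (m.+1%:R^-1) k.+1%:R
  (pos n) (pos m) (ltr0Sn R k).
have := negligibleU cX (negligible_bigcup (fun n => negligible_bigcup (fun m =>
  negligible_bigcup (h n m)))).
apply: negligibleS => w /= HN.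
have [cf|ncf] := pselect (cadlag (fun t => X t w)); last by left.
right; move/existsNP: HN => [r /existsNP[l]].
move=> /not_implyP[r0 /not_implyP[Hl /not_implyP[Hinf Hj]]].
have lt : l < X r w by rewrite ltNge; apply/negP.
have inv (x : R) : 0 < x -> (Num.truncn x^-1).+1%:R^-1 < x.
  move=> x0; rewrite -[ltRHS]invrK ltf_pV2 ?posrE ?invr_gt0//.
  have x'0 : 0 <= x^-1 by rewrite invr_ge0 ltW.
  by have /andP[] := truncn_itv x'0.
have dl0 : 0 < X r w - l by rewrite subr_gt0.
exists (Num.truncn (X r w - l)^-1) => //; exists (Num.truncn r^-1) => //.
exists (Num.truncn r) => //; split=> //; exists r, l; split=> //.
- exact: inv.
- by have /andP[_ /ltW] := truncn_itv (ltW r0).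
- by rewrite -ltrBrDl; exact: inv.
Qed.

End ae_paths.

(** * Large loops near a time cell *)

Section loop_limit.
Variables (R : realType) (f : R -> R) (p l a0 a1 a2 : R).

(** Grid version of a large loop in the block: an increment of at least [a2] from [i] to [i.+1],
    after which the path never loses more than [a1] on the grid, yet ends the block more than [a0]
    lower. *)
Definition succ_at (N i : nat) := [/\ a2 <= f (dy p l N i.+1) - f (dy p l N i),
  f (p + l) - f (dy p l N i.+1) < - a0 &
  forall j, (i < j)%N -> (j <= 2 ^ N)%N -> f (dy p l N i.+1) - a1 <= f (dy p l N j)].

(** The jump is sought in the first half of the block, which leaves half of the time for the descent
    by [a0]. *)
Definition succ (N : nat) := exists2 i, (i < 2 ^ N.-1)%N & succ_at N i.

Hypotheses (cf : cadlag f) (p0 : 0 <= p) (l0 : 0 < l) (a10 : 0 <= a1) (a20 : 0 < a2).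

Lemma dy_le N i : (i <= 2 ^ N)%N -> dy p l N i <= p + l.
Proof.
move=> iN; rewrite /dy lerD2l ler_pdivrMr ?exprn_gt0// ler_wpM2l ?(ltW l0)//.
by rewrite -natrX ler_nat.
Qed.

Lemma step_small (e : R) : 0 < e -> exists N0 : nat, forall N, (N0 <= N)%N -> l / 2 ^+ N < e.
Proof.
move=> e0; exists (Num.truncn (l / e)).+1 => N HN.
rewrite ltr_pdivrMr ?exprn_gt0// mulrC -ltr_pdivrMr//.
have /andP[_ h] := truncn_itv (divr_ge0 (ltW l0) (ltW e0)).
apply: (lt_le_trans h); rewrite -natrX ler_nat.
by apply: leq_trans HN (ltnW (ltn_expl _ _)).
Qed.

(** The cluster point is the upper limit of the success times: [S] collects the times [x] at or
    after which successes occur on arbitrarily fine grids. *)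
Lemma succ_cluster : (forall N0, exists2 N, (N0 <= N)%N & succ N) ->
  exists2 r, p <= r <= p + l & forall e N0, 0 < e ->
    exists N i, [/\ (N0 <= N)%N, succ_at N i, p <= dy p l N i <= p + l & r - e < dy p l N i < r + e].
Proof.
move=> H.
have bnd N i : (i < 2 ^ N.-1)%N -> p <= dy p l N i <= p + l.
  move=> iN; rewrite dy_ge// dy_le//; apply: leq_trans (ltnW iN) _.
  by rewrite leq_exp2l// leq_pred.
pose S := [set x | forall N0, exists N i, [/\ (N0 <= N)%N, (i < 2 ^ N.-1)%N, succ_at N i & x <= dy p l N i]].
have Sp : S p.
  move=> N0; have [N N0N [i iN si]] := H N0; exists N, i; split=> //.
  by have /andP[] := bnd _ _ iN.
have Sub : ubound S (p + l).
  move=> x /(_ 0%N)[N [i [_ iN _ xi]]]; apply: (le_trans xi).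
  by have /andP[] := bnd _ _ iN.
have hS : has_sup S by split; [exists p|exists (p + l)].
exists (sup S).
  by apply/andP; split; [apply: ub_le_sup => //; exists (p + l)|apply: ge_sup => //; exists p].
move=> e N0 e0.
have [M HM] : exists M, forall N i, (M <= N)%N -> (i < 2 ^ N.-1)%N -> succ_at N i -> dy p l N i < sup S + e.
  apply: contrapT => /forallNP nM.
  have : S (sup S + e).
    move=> M; have /existsNP[N /existsNP[i]] := nM M.
    move=> /not_implyP[MN /not_implyP[iN /not_implyP[si /negP h]]].
    by exists N, i; split=> //; rewrite leNgt.
  move=> Sse; have : sup S + e <= sup S by apply: ub_le_sup => //; exists (p + l).
  lra.
have [x Sx xe] := sup_adherent e0 hS.
have [N [i [NN iN si xi]]] := Sx (N0 + M)%N.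
exists N, i; split=> //; first exact: leq_trans (leq_addr _ _) NN.
  exact: bnd.
by rewrite (lt_le_trans xe xi) HM// (leq_trans (leq_addl _ _) NN).
Qed.

(** The success intervals shrink towards the cluster point [r] and must straddle it: two times close
    to [r] on the same side have values within a2 / 4 of a common one-sided limit, too close for an
    increment [a2]. So the path jumps at [r], and the other clauses pass to the limit. *)
Lemma succ_limit : (forall N0, exists2 N, (N0 <= N)%N & succ N) ->
  exists r lf, [/\ 0 < r, p <= r <= p + l, leftlim f r lf, lf + a2 <= f r &
    f (p + l) + a0 <= f r /\ forall s, r <= s <= p + l -> f r - a1 <= f s].
Proof.
move=> /succ_cluster[r /andP[Prob rl] K]; have r0 : 0 <= r by apply: le_trans Prob.
have a4 : 0 < a2 / 4 by rewrite divr_gt0.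
have strad (e : R) (N0 : nat) : 0 < e -> exists N i, [/\ (N0 <= N)%N, succ_at N i,
    p <= dy p l N i <= p + l, r - e < dy p l N i < r & r <= dy p l N i.+1 < r + e].
  move=> e0.
  have [d2 d20 H2] := cadlag_right cf r0 a4.
  have [d1 d10 H1] : exists2 d1, 0 < d1 & 0 < r -> exists lf, forall u, r - d1 < u < r -> `|f u - lf| < a2 / 4.
    move: r0; rewrite le_eqVlt => /predU1P[<-|r0]; first by exists 1; rewrite ?ltr01// ltxx.
    have [lf Hlf] := cadlag_left cf r0; have [d1 d10 Hd] := Hlf _ a4.
    by exists d1 => // _; exists lf.
  pose e1 := Num.min e (Num.min d1 d2) / 2.
  have e10 : 0 < e1 by rewrite divr_gt0// !lt_min e0 d10.
  have [e1e [e1d1 e1d2]] : e1 * 2 <= e /\ e1 * 2 <= d1 /\ e1 * 2 <= d2.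
    by rewrite /e1 divfK// !ge_min !lexx !orbT.
  have [N1 HN1] := step_small e10.
  have [N [i [NN si bi /andP[h1 h2]]]] := K e1 (N0 + N1)%N e10.
  have hN : l / 2 ^+ N < e1 by apply: HN1; exact: leq_trans (leq_addl _ _) NN.
  have hN0 : 0 < l / 2 ^+ N by rewrite divr_gt0// exprn_gt0.
  have [s1 s2 s3] := si; rewrite dy_succ in s1 s2 s3.
  exists N, i; rewrite !dy_succ; split=> //; first exact: leq_trans (leq_addr _ _) NN.
    apply/andP; split; first by lra.
    rewrite ltNge; apply/negP => rt.
    have := H2 (dy p l N i); have -> : r <= dy p l N i < r + d2 by apply/andP; split; lra.
    have := H2 (dy p l N i + l / 2 ^+ N).
    have -> : r <= dy p l N i + l / 2 ^+ N < r + d2 by apply/andP; split; lra.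
    move=> /(_ isT) + /(_ isT); rewrite !ltr_distl; lra.
  apply/andP; split; last by lra.
  rewrite leNgt; apply/negP => tr.
  have r_gt0 : 0 < r by have /andP[bi1 _] := bi; have := le_trans p0 bi1; lra.
  have [lf Hlf] := H1 r_gt0.
  have := Hlf (dy p l N i); have -> : r - d1 < dy p l N i < r by apply/andP; split; lra.
  have := Hlf (dy p l N i + l / 2 ^+ N).
  have -> : r - d1 < dy p l N i + l / 2 ^+ N < r by apply/andP; split; lra.
  move=> /(_ isT) + /(_ isT); rewrite !ltr_distl; lra.
have r_gt0 : 0 < r.
  have [N [i [_ _ /andP[h1 _] /andP[_ h2] _]]] := strad 1 0%N ltr01.
  by apply: (le_lt_trans p0); exact: le_lt_trans h2.
have [lf Hlf] := cadlag_left cf r_gt0.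
have near (e : R) (N0 : nat) : 0 < e -> exists N i, [/\ (N0 <= N)%N, succ_at N i, dy p l N i.+1 < r + e,
    `|f (dy p l N i) - lf| < e & `|f (dy p l N i.+1) - f r| < e].
  move=> e0; have [d2 d20 H2] := cadlag_right cf r0 e0; have [d1 d10 H1] := Hlf _ e0.
  pose e1 := Num.min e (Num.min d1 d2).
  have e10 : 0 < e1 by rewrite !lt_min e0 d10.
  have [e1e [e1d1 e1d2]] : e1 <= e /\ e1 <= d1 /\ e1 <= d2 by rewrite !ge_min !lexx !orbT.
  have [N [i [NN si _ /andP[h1 h2] /andP[h3 h4]]]] := strad e1 N0 e10.
  exists N, i; split=> //; first by lra.
    by apply: H1; apply/andP; split; lra.
  by apply: H2; apply/andP; split; lra.
exists r, lf; split=> //; first by rewrite Prob.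
- apply/ler_addgt0Pr => e e0; have e2 : 0 < e / 2 by rewrite divr_gt0.
  have [N [i [_ [s1 s2 s3] _ h1 h2]]] := near (e / 2) 0%N e2.
  by move: h1 h2; rewrite !ltr_distl; lra.
split.
  apply/ler_addgt0Pr => e e0.
  have [N [i [_ [s1 s2 s3] _ h1 h2]]] := near e 0%N e0.
  by move: h1 h2; rewrite !ltr_distl; lra.
move=> s /andP[]; rewrite le_eqVlt => /predU1P[<- _|rs sl]; first by rewrite gerBl.
apply/ler_addgt0Pr => e e0.
have ps : p <= s <= p + l by rewrite sl (le_trans Prob (ltW rs)).
pose e1 := Num.min (e / 2) (s - r).
have e10 : 0 < e1 by rewrite lt_min divr_gt0// subr_gt0.
have [e1e e1s] : e1 <= e / 2 /\ e1 <= s - r by rewrite !ge_min !lexx !orbT.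
have [N0 HN0] := cadlag_dyup p0 l0 cf ps e10.
have [N [i [NN [s1 s2 s3] hr h1 h2]]] := near e1 N0 e10.
have [j1 /andP[j2 j3]] := dyup_spec l0 N ps.
have ij : (i < dyup p l N s)%N.
  rewrite ltnNge; apply/negP => ji; have := le_dy p l0 N (leq_trans ji (leqnSn i)); lra.
have := s3 _ ij j1; have := HN0 N NN; move: h2; rewrite !ltr_distl; lra.
Qed.

End loop_limit.

Section loop_step.
Context d (T : measurableType d) (R : realType) (P : probability T R).
Variables (alpha : R) (X : R -> T -> R).
Hypotheses (mX : forall t, measurable_fun setT (X t)) (lapX : stable_laplace P alpha X).
Hypotheses (al1 : 1 < alpha) (al2 : alpha < 2).
Local Notation ind := (ind P alpha X).
Local Notation Ex := (Expect P).
Local Notation pr := (Prob P).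
Local Notation drops := (drops X).
Local Notation root s := (s `^ alpha^-1).
Implicit Types (t u a r : R) (W : T -> R).
Let al0 : 0 < alpha. Proof. by apply: lt_trans al1. Qed.

Lemma ind_sum u n (F : nat -> T -> R) : 0 <= u -> (forall i, (i < n)%N -> ind u (F i)) ->
  ind u (fun w => \sum_(i < n) F i w).
Proof.
move=> u0; elim: n => [|n IH] H.
  by under eq_fun do rewrite big_ord0; exact: ind_cst.
have -> : (fun w => \sum_(i < n.+1) F i w) = (fun w => \sum_(i < n) F i w + 1 * F n w).
  by apply/funext => w; rewrite big_ord_recr/= mul1r.
by apply: ind_lin => //; [apply: IH => i ni; apply: H; exact: ltnW|exact: H].
Qed.

Lemma ind_drops W t p l z m i0 : 0 <= p -> 0 < l -> 0 <= t -> ind t W ->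
  (forall i, (i0 <= i)%N -> t <= dy p l m i) ->
  ind (p + l) (fun w => drops p l z m i0 w * W w) /\
  Ex (fun w => drops p l z m i0 w * W w) = Ex (drops p l z m i0) * Ex W.
Proof.
move=> p0 l0 t0 iW Ht.
pose b i w : R := ((i0 <= i)%N && (X (dy p l m i.+1) w - X (dy p l m i) w < - z))%:R.
have E1 : drops p l z m i0 = (fun w => \sum_(i < 2 ^ m) b i w) by [].
have d0 i : 0 <= dy p l m i by apply: le_trans p0 (dy_ge _ l0 _ _).
have pl0 : 0 <= p + l by rewrite addr_ge0// ltW.
have dd i : dy p l m i <= dy p l m i.+1 by apply: le_dy.
have ib i : (i < 2 ^ m)%N -> ind (p + l) (fun w => b i w * W w) /\ Ex (fun w => b i w * W w) = Ex (b i) * Ex W.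
  move=> im; rewrite /b; case: (leqP i0 i) => h /=; last first.
    split; first by under eq_fun do rewrite mul0r; exact: ind_cst.
    by under eq_fun do rewrite mul0r; rewrite !Ex_cst mul0r.
  have iW' := ind_mono mX lapX t0 (Ht i h) iW.
  split; last by rewrite (Ex_ind_ray mX lapX)// mulrC.
  apply: (ind_mono mX lapX (d0 i.+1)); first by rewrite dy_le.
  exact: ind_ray.
have E2 : (fun w => drops p l z m i0 w * W w) = (fun w => \sum_(i < 2 ^ m) b i w * W w).
  by apply/funext => w; rewrite E1 mulr_suml.
rewrite E2; split; first by apply: (ind_sum (F := fun i w => b i w * W w)) => // i /ib[].
rewrite (Ex_sum (F := fun i w => b i w * W w)); last by move=> i /ib[/ind_rint].
rewrite E1 (Ex_sum (F := b)); last by move=> i _; exact: rint_and_ray.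
by rewrite mulr_suml; apply: eq_bigr => i _; have [] := ib i (ltn_ord i).
Qed.

(* One possible jump time: with the first large increment, the attempt succeeds
   unless the later path fails to go down ([1 - G]) or drops too much ([V]). *)
Lemma loop_one (W : T -> R) (p l a0 a1 a2 theta q : R) (z : nat -> R) (N i : nat) :
  0 <= p -> 0 < l -> (i < 2 ^ N.-1)%N -> (0 < N)%N -> (forall m, 0 <= z m) ->
  2 * \sum_(0 <= m < N.+1) z m <= a1 ->
  q <= pr (fun w => a2 <= X (dy p l N i.+1) w - X (dy p l N i) w) ->
  theta + \sum_(m < N.+1) Ex (drops p l (z m) m ((i + 2 ^ (N - m)) %/ 2 ^ (N - m))%N) <=
    pr (fun w => X (p + l) w - X (dy p l N i.+1) w < - a0) ->
  (forall w, 0 <= W w) -> ind (dy p l N i) W ->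
  exists A B, [/\ forall w, 0 <= A w, forall w, 0 <= B w, ind (dy p l N i.+1) A, ind (p + l) B &
    [/\ Ex A <= (1 - q) * Ex W, Ex B <= (1 - theta) * (Ex W - Ex A) &
    forall w, ~ succ_at (fun t => X t w) p l a0 a1 a2 N i -> W w <= A w + B w]].
Proof.
move=> p0 l0 iN N0 z0 za1 hq htheta W0 iW.
set t := dy p l N i in iW hq *; set t' := dy p l N i.+1 in hq htheta *.
have t0 : 0 <= t by apply: le_trans p0 (dy_ge _ l0 _ _).
have tt : t <= t' by apply: le_dy.
have t'0 := le_trans t0 tt.
have iSN : (i < 2 ^ N)%N by apply: leq_trans iN _; rewrite leq_exp2l// leq_pred.
have te : t' <= p + l by apply: dy_le.
have e0 : 0 <= p + l := le_trans t'0 te.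
pose A w := (X t' w - X t w < a2)%R%:R * W w.
have iA : ind t' A by exact: ind_ray.
pose D w := (a2 <= X t' w - X t w)%R%:R * W w.
have [iD eD] : ind t' D /\ Ex D = Ex W * pr (fun w => a2 <= X t' w - X t w) by exact: Ex_coray.
have D0 w : 0 <= D w by rewrite mulr_ge0.
have eA : Ex A = Ex W - Ex D by rewrite (Ex_ind_ray mX lapX)// eD pr_coray// /Prob; ring.
pose G w := (- a0 <= X (p + l) w - X t' w)%R%:R * D w.
have [iG eG] : ind (p + l) G /\ Ex G = Ex D * pr (fun w => - a0 <= X (p + l) w - X t' w).
  exact: Ex_coray.
(* This is [i %/ 2 ^ (N - m) + 1], the first index of level [m] whose time is after the point [i] of
   level [N]. Drops are counted from there only, hence not before [t'], and are independent of
   [D]. *)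
pose i0 m := ((i + 2 ^ (N - m)) %/ 2 ^ (N - m))%N.
have i0P m j : (m <= N)%N -> (i0 m <= j)%N = (i < j * 2 ^ (N - m))%N.
  move=> mN; rewrite /i0; have h : (0 < 2 ^ (N - m))%N by rewrite expn_gt0.
  by rewrite -ltnS ltn_divLR// mulSn addnC ltn_add2l.
have dyE m j : (m <= N)%N -> dy p l m j = dy p l N (j * 2 ^ (N - m)).
  move=> mN; rewrite /dy natrM natrX -{2}(subnK mN) exprD.
  have h1 : 2 ^+ m != 0 :> R by rewrite expf_neq0.
  have h2 : 2 ^+ (N - m) != 0 :> R by rewrite expf_neq0.
  by move: (2 ^+ m) (2 ^+ (N - m)) h1 h2 => u v h1 h2; congr (_ + _); field; rewrite h1.
have i0t m j : (m <= N)%N -> (i0 m <= j)%N -> t' <= dy p l m j.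
  by move=> mN; rewrite i0P// dyE// => h; apply: le_dy.
have iV m : (m < N.+1)%N -> ind (p + l) (fun w => drops p l (z m) m (i0 m) w * D w) /\
    Ex (fun w => drops p l (z m) m (i0 m) w * D w) = Ex (drops p l (z m) m (i0 m)) * Ex D.
  by move=> mN; apply: (ind_drops _ p0 l0 t'0 iD) => j; exact: i0t.
pose V w := \sum_(m < N.+1) drops p l (z m) m (i0 m) w * D w.
have iVV : ind (p + l) V by apply: (ind_sum (F := fun m w => drops p l (z m) m (i0 m) w * D w)) => // m /iV[].
have eV : Ex V = (\sum_(m < N.+1) Ex (drops p l (z m) m (i0 m))) * Ex D.
  rewrite /V (Ex_sum (F := fun m w => drops p l (z m) m (i0 m) w * D w)); last by move=> m /iV[/ind_rint].
  by rewrite mulr_suml; apply: eq_bigr => m _; have [] := iV m (ltn_ord m).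
have V0 w : 0 <= V w by apply: sumr_ge0 => m _; rewrite mulr_ge0// drops_ge0.
have ExW0 : 0 <= Ex W by exact: Ex_ge0.
have ExD0 : 0 <= Ex D by exact: Ex_ge0.
exists A, (fun w => G w + 1 * V w); split.
- by move=> w; rewrite mulr_ge0.
- by move=> w; rewrite mul1r addr_ge0// mulr_ge0.
- exact: iA.
- exact: ind_lin.
split.
- by rewrite eA eD mulrBl mul1r lerD2l lerN2 [leRHS]mulrC ler_wpM2r.
- under eq_fun do rewrite mul1r.
  rewrite ExD; [|exact: ind_rint iG|exact: ind_rint iVV].
  have -> : Ex W - Ex A = Ex D by rewrite eA; ring.
  rewrite eG eV pr_coray//.
  rewrite [Ex D * _]mulrC -mulrDl; apply: ler_wpM2r => //.
  by move: htheta; rewrite -/(i0 _) -/t'; lra.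
move=> w ns; rewrite mul1r.
have [lt|ge] := ltP (X t' w - X t w) a2.
  by rewrite /A lt mul1r lerDl addr_ge0// mulr_ge0.
have DW : D w = W w by rewrite /D ge mul1r.
rewrite /A ltNge ge mul0r add0r.
have [gt|lt] := leP (- a0) (X (p + l) w - X t' w).
  by rewrite /G gt mul1r DW lerDl.
suff [m mN hm] : exists2 m, (m < N.+1)%N & 1 <= drops p l (z m) m (i0 m) w.
  apply: (@le_trans _ _ (V w)); last by rewrite lerDr mulr_ge0.
  rewrite /V (bigD1 (Ordinal mN))//=; apply: (@le_trans _ _ (drops p l (z m) m (i0 m) w * D w)).
    by rewrite DW -[leLHS]mul1r ler_wpM2r.
  by rewrite lerDl; apply: sumr_ge0 => j _; rewrite mulr_ge0// drops_ge0.
apply: contrapT => nex; apply: ns; split=> //.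
move=> j ij jN.
have ch : X (dy p l N i.+1) w - 2 * \sum_(0 <= m < N.+1) z m <= X (dy p l N j) w.
  apply: (@chain R (fun t => X t w) p l p0 l0 t' z 0 N (leq0n N) z0) => //.
    move=> m k /andP[_ mN] km; rewrite dyE// => hk.
    have lt1 : drops p l (z m) m (i0 m) w < 1.
      by rewrite ltNge; apply/negP => h; apply: nex; exists m.
    rewrite -dyE//; apply: (drops_lt1 lt1) => //; rewrite i0P//.
    rewrite ltnNge; apply/negP => h.
    have h1 : dy p l N (k * 2 ^ (N - m)) <= t by apply: le_dy.
    have h2 : t < t' by rewrite /t' dy_succ ltrDl divr_gt0// exprn_gt0.
    by have := le_lt_trans h1 h2; rewrite ltNge hk.
  by rewrite subn0; exact: leq_trans (leq_subr _ _) jN.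
by apply: le_trans ch; rewrite lerD2l lerN2.
Qed.

(** Decomposition at the first large increment: [A] carries the part where none has occurred yet,
    [B] the part where the first one was not followed by a success. The bound on [Ex B] telescopes,
    each step contributing a difference of successive [Ex A]. *)
Lemma loop_many (W : T -> R) (p l a0 a1 a2 theta q : R) (z : nat -> R) (N M : nat) :
  0 <= p -> 0 < l -> (M <= 2 ^ N.-1)%N -> (0 < N)%N -> (forall m, 0 <= z m) ->
  2 * \sum_(0 <= m < N.+1) z m <= a1 -> 0 <= q <= 1 -> 0 <= theta ->
  (forall i, (i < M)%N -> q <= pr (fun w => a2 <= X (dy p l N i.+1) w - X (dy p l N i) w)) ->
  (forall i, (i < M)%N ->
    theta + \sum_(m < N.+1) Ex (drops p l (z m) m ((i + 2 ^ (N - m)) %/ 2 ^ (N - m))%N) <=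
    pr (fun w => X (p + l) w - X (dy p l N i.+1) w < - a0)) ->
  (forall w, 0 <= W w) -> ind p W ->
  exists A B, [/\ forall w, 0 <= A w, forall w, 0 <= B w, ind (dy p l N M) A, ind (p + l) B &
    [/\ Ex A <= (1 - q) ^+ M * Ex W, Ex B <= (1 - theta) * (Ex W - Ex A) &
    forall w, (forall i, (i < M)%N -> ~ succ_at (fun t => X t w) p l a0 a1 a2 N i) -> W w <= A w + B w]].
Proof.
move=> p0 l0 MN N0 z0 za1 /andP[q0 q1] th0 hq hth W0 iW.
have e0 : 0 <= p + l by rewrite addr_ge0// ltW.
elim: M MN hq hth => [|M IH] MN hq hth.
  exists W, (fun=> 0); split=> //; first by rewrite /dy mulr0 mul0r addr0.
    exact: ind_cst.
  split; first by rewrite expr0 mul1r.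
    by rewrite Ex_cst subrr mulr0.
  by move=> w _; rewrite addr0.
have [A [B [A0 B0 iA iB [eA eB AB]]]] := IH (ltnW MN) (fun i h => hq i (ltnW h)) (fun i h => hth i (ltnW h)).
have [A' [B' [A'0 B'0 iA' iB' [eA' eB' AB']]]] :=
  loop_one p0 l0 MN N0 z0 za1 (hq M (ltnSn M)) (hth M (ltnSn M)) A0 iA.
exists A', (fun w => B w + 1 * B' w); split=> //.
- by move=> w; rewrite mul1r addr_ge0.
- exact: ind_lin.
split.
- apply: (le_trans eA'); rewrite exprS -mulrA ler_wpM2l// subr_ge0//.
- under eq_fun do rewrite mul1r.
  by rewrite ExD; [lra|exact: ind_rint iB|exact: ind_rint iB'].
- move=> w ns; have h1 := AB w (fun i h => ns i (ltnW h)); have h2 := AB' w (ns M (ltnSn M)).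
  lra.
Qed.

(** On a fine grid each of the 2^(N-1) candidate increments is large with probability at least c nu
    / 2^N, so one of them is, up to exp(- c nu / 2). After the first large one, a descent free of
    excessive drops has probability at least g - g/2. Hence [p0], uniform in the grid. *)
Lemma loop_step : exists kap kap1 p0 : R, exists N1 : nat,
  [/\ 0 < kap, 0 <= kap1, 0 < p0, p0 <= 1 & forall (p l : R) (N : nat), 0 <= p -> 0 < l -> (N1 <= N)%N ->
    step P alpha X p (p + l) (fun w => `[< ~ succ (fun t => X t w) p l (kap * root l) (kap1 * root l)
      ((kap1 + kap) * root l) N >]) (1 - p0)].
Proof.
pose gam := (2 * alpha)^-1.
have gam0 : 0 < gam by rewrite invr_gt0 mulr_gt0.
have gamal : gam < alpha^-1.
  by rewrite ltf_pV2 ?posrE ?mulr_gt0// mulr_natl mulr2n ltrDl.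
have [C C0 HC] := Ex_drops mX lapX al1 gamal.
have [c [v0 [c0 v00 Hc]]] := upper_tail_ge mX lapX al1 al2.
pose q2 := 2 `^ (- gam) : R.
have q20 : 0 < q2 by exact: q_gt0.
have q21 : q2 < 1 by exact: q_lt1.
pose g := expR (- 4) / 4 : R.
have g0 : 0 < g by rewrite divr_gt0// expR_gt0.
have g1 : g <= 1.
  have : expR (- 4) <= 1 :> R by rewrite expR_le1; lra.
  rewrite /g; lra.
(* Ensures y^2 >= 4 C / g, so that the expected number of excessive drops, at most 2 C / y^2, is at
   most g / 2. *)
pose y := 1 + 4 * C / g.
have Cg0 : 0 < 4 * C / g by rewrite divr_gt0// mulr_gt0.
have y1 : 1 <= y by rewrite /y; lra.
have y0 : 0 < y by lra.
pose kap1 := 2 * (y / (1 - q2)).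
have q2' : 0 < 1 - q2 by rewrite subr_gt0.
(* Next, kap is 1/4 because at least half of the block remains after the jump: ln 2 (l/2)^(1/alpha)
   >= l^(1/alpha) / 4. *)
have kap10 : 0 < kap1 by rewrite mulr_gt0// divr_gt0.
pose kap := 4^-1 : R; have kap0 : 0 < kap by rewrite invr_gt0.
pose kk := kap1 + kap; have kk0 : 0 < kk by rewrite addr_gt0.
pose nu := kk `^ (- alpha); have nu0 : 0 < nu by rewrite powR_gt0.
pose N1 := (Num.truncn ((nu + c * nu) / v0 + c * nu)).+2.
pose p0 := g / 2 * (1 - expR (- (c * nu / 2))).
have cn0 : 0 < c * nu by rewrite mulr_gt0.
have ex1 : expR (- (c * nu / 2)) < 1 by rewrite expR_lt1 oppr_lt0 divr_gt0.
have ex0 := expR_gt0 (- (c * nu / 2)).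
have p00 : 0 < p0 by rewrite mulr_gt0 ?divr_gt0// subr_gt0.
have p01 : p0 <= 1.
  rewrite /p0 -[leRHS]mulr1; apply: ler_pM; lra.
exists kap, kap1, p0, N1; split=> //; first exact: ltW.
move=> p l N p_ge0 l0 N1N W W0 iW.
have N0 : (0 < N)%N by apply: leq_trans N1N.
have rl0 : 0 < root l by rewrite powR_gt0.
have K0 : 0 < 2 ^+ N :> R by rewrite exprn_gt0.
have NK : (nu + c * nu) / v0 + c * nu <= 2 ^+ N.
  have h0 : 0 <= (nu + c * nu) / v0 + c * nu by rewrite addr_ge0 ?divr_ge0 ?addr_ge0 ?ltW.
  have /andP[_ h] := truncn_itv h0.
  apply: (le_trans (ltW h)); rewrite -natrX ler_nat.
  apply: leq_trans (ltnW (ltn_expl N (ltnSn 1))); apply: leq_trans N1N; exact: leqnSn.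
pose z m := y * (root l * q2 ^+ m).
have z0 m : 0 <= z m by rewrite !mulr_ge0 ?exprn_ge0 ?ltW.
have za1 : 2 * \sum_(0 <= m < N.+1) z m <= kap1 * root l.
  have -> : kap1 * root l = 2 * (y * (root l * (1 / (1 - q2)))) by rewrite /kap1; ring.
  rewrite /z -mulr_sumr -mulr_sumr !ler_wpM2l ?(ltW y0) ?(ltW rl0)//.
  by rewrite -[X in _ <= X / _](expr0 q2) geom_sum_le.
pose q := c * nu / 2 ^+ N.
have q01 : 0 <= q <= 1.
  rewrite divr_ge0 ?(ltW cn0) ?(ltW K0)//= ler_pdivrMr// mul1r.
  by apply: le_trans NK; rewrite lerDr divr_ge0 ?addr_ge0 ?ltW.
have len i : dy p l N i.+1 - dy p l N i = l / 2 ^+ N by rewrite dy_succ addrAC subrr add0r.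
have dy0 i : 0 <= dy p l N i by apply: le_trans p_ge0 (dy_ge _ l0 _ _).
have hq i : (i < 2 ^ N.-1)%N -> q <= pr (fun w => kk * root l <= X (dy p l N i.+1) w - X (dy p l N i) w).
  move=> iN.
  have E : (dy p l N i.+1 - dy p l N i) * (kk * root l) `^ (- alpha) = nu / 2 ^+ N.
    rewrite len powRM ?(ltW kk0) ?(ltW rl0)// -/nu -powRrM mulrN mulVf ?gt_eqF// powR_inv1 ?(ltW l0)//.
    by move: (2 ^+ N) K0 => K K0'; field; rewrite !gt_eqF.
  have hv : nu / 2 ^+ N <= v0.
    rewrite ler_pdivrMr// mulrC -ler_pdivrMr//; apply: le_trans NK.
    apply: (@le_trans _ _ ((nu + c * nu) / v0)); last by rewrite lerDl ltW.
    by rewrite ler_wpM2r ?invr_ge0 ?(ltW v00)// lerDl ltW.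
  rewrite -E in hv.
  have := Hc _ _ _ (dy0 i) (le_dy p l0 N (leqnSn i)) (mulr_gt0 kk0 rl0) hv.
  by rewrite E mulrA.
have hth i : (i < 2 ^ N.-1)%N ->
    g / 2 + \sum_(m < N.+1) Ex (drops p l (z m) m ((i + 2 ^ (N - m)) %/ 2 ^ (N - m))%N) <=
    pr (fun w => X (p + l) w - X (dy p l N i.+1) w < - (kap * root l)).
  move=> iN.
  have h1 : \sum_(m < N.+1) Ex (drops p l (z m) m ((i + 2 ^ (N - m)) %/ 2 ^ (N - m))%N) <= g / 2.
    apply: (@le_trans _ _ (\sum_(m < N.+1) C / y ^+ 2 * 2^-1 ^+ m)).
      by apply: ler_sum => m _; apply: HC.
    rewrite -mulr_sumr -(big_mkord xpredT (fun m => 2^-1 ^+ m)).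
    have gs := @geom_half_le R N.+1; apply: (@le_trans _ _ (C / y ^+ 2 * 2)).
      by rewrite ler_wpM2l// divr_ge0 ?(ltW C0)// exprn_ge0// ltW.
    rewrite mulrAC ler_pdivrMr ?exprn_gt0//.
    have : 4 * C / g <= y ^+ 2.
      by rewrite expr2 (@le_trans _ _ y)//; [rewrite /y; lra|rewrite ler_peMr// ltW].
    rewrite ler_pdivrMr//; lra.
  have te : l / 2 <= p + l - dy p l N i.+1.
    rewrite /dy; have : i.+1%:R / 2 ^+ N <= 2^-1 :> R.
      rewrite ler_pdivrMr//; apply: (@le_trans _ _ (2 ^ N.-1)%:R); first by rewrite ler_nat.
      by rewrite natrX -{2}(prednK N0) exprS mulrA mulVf// mul1r.
    move=> /(ler_wpM2l (ltW l0)); rewrite mulrA; lra.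
  have tlt : dy p l N i.+1 < p + l.
    by rewrite -subr_gt0 (lt_le_trans _ te)// divr_gt0.
  have := lower_tail_ge mX lapX al1 al2 (dy0 i.+1) tlt; rewrite -/g => h2.
  have h3 : pr (fun w => X (p + l) w - X (dy p l N i.+1) w < - (ln 2 * root (p + l - dy p l N i.+1))) <=
    pr (fun w => X (p + l) w - X (dy p l N i.+1) w < - (kap * root l)).
    apply: Ex_le; [exact: rint_ray|exact: rint_ray|move=> w].
    rewrite ler_nat; case: ltP => // h.
    suff -> : X (p + l) w - X (dy p l N i.+1) w < - (kap * root l) by [].
    have r1 : root l / 2 <= root (p + l - dy p l N i.+1).
      exact: (root_half_le al1 (ltW l0) te).
    have l2 := @half_le_ln2 R.
    have r3 : kap * root l <= ln 2 * root (p + l - dy p l N i.+1).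
      have -> : kap * root l = 2^-1 * (root l / 2) by rewrite /kap; field.
      by apply: ler_pM => //; rewrite ?invr_ge0// divr_ge0// ltW.
    by rewrite (lt_le_trans h)// lerN2.
  by rewrite (le_trans _ (le_trans h2 h3))// [leRHS](splitr g) lerD2l.
have th0 : 0 <= g / 2 by rewrite divr_ge0// ltW.
have [A [B [A0 B0 iA iB [eA eB AB]]]] := loop_many p_ge0 l0 (leqnn _) N0 z0 za1 q01 th0 hq hth W0 iW.
have e0 : 0 <= p + l by rewrite addr_ge0// ltW.
have M2 : dy p l N (2 ^ N.-1) <= p + l by apply: dy_le => //; rewrite leq_exp2l// leq_pred.
exists (fun w => A w + 1 * B w); split.
- by move=> w; rewrite mul1r addr_ge0.
- by apply: ind_lin => //; exact: (ind_mono mX lapX (dy0 _) M2).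
- by move=> w /asboolP ns; rewrite mul1r; apply: AB => i iN si; apply: ns; exists i.
under eq_fun do rewrite mul1r.
rewrite ExD; [|exact: ind_rint iA|exact: ind_rint iB].
have EW0 : 0 <= Ex W by exact: Ex_ge0.
have h1 : (1 - q) ^+ (2 ^ N.-1) <= expR (- (c * nu / 2)).
  apply: (le_trans (exp_le_expR _ q01)); rewrite ler_expR lerN2 natrX /q.
  rewrite -{2}(prednK N0) exprS; have := exprn_gt0 N.-1 (ltr0n R 2); move: (2 ^+ N.-1) => K K0'.
  by rewrite le_eqVlt; apply/orP; left; apply/eqP; field; rewrite gt_eqF.
have h2 : g / 2 * Ex A <= g / 2 * (expR (- (c * nu / 2)) * Ex W).
  rewrite ler_wpM2l//; apply: (le_trans eA); exact: ler_wpM2r.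
rewrite /p0; lra.
Qed.

End loop_step.

(** A loop opened by the jump at [r], with foot [lf] and top [f r], on which the cell [a, b] sits
    with [rho] to spare on both sides; by the time [q] the path has sunk [rho] below everything on
    [r, b]. Times outside [a - H, b + H] are then at distance at least [rho] from the cell along
    this loop. *)
Definition loop_at {R : realType} (f : R -> R) (a b H rho : R) := exists r lf q : R,
  [/\ 0 < r, a - H <= r <= a, leftlim f r lf, forall s, r <= s <= b -> lf + rho <= f s &
   [/\ f a + rho <= f r, b <= q <= b + H & forall s, r <= s <= b -> f q + rho <= f s]].

(** * Probability that a cell has no large loop around it *)

Section bad_bound.
Context d (T : measurableType d) (R : realType) (P : probability T R).
Variables (alpha : R) (X : R -> T -> R).
Hypotheses (mX : forall t, measurable_fun setT (X t)) (lapX : stable_laplace P alpha X).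
Hypotheses (al1 : 1 < alpha) (al2 : alpha < 2).
Local Notation Ex := (Expect P).
Local Notation root s := (s `^ alpha^-1).
Implicit Types (t u a r y : R).
Let al0 : 0 < alpha. Proof. by apply: lt_trans al1. Qed.

(** By chaining, such a drop forces a drop at some dyadic level, hence a count at least 1 on all
    finer grids, and [pbound_liminf] applies; with geometric thresholds the expected counts add up
    to O(1 / y^2). *)
Lemma drop_bound : exists C y0 : R, [/\ 0 < C, 0 < y0 & forall p l y, 0 <= p -> 0 < l -> y0 <= y ->
  pbound P [set w | cadlag (fun t => X t w) /\
    ~ (forall u t, p <= u -> u <= t -> t <= p + l -> X u w - y * root l <= X t w)] (C / y ^+ 2)].
Proof.
pose gam := (2 * alpha)^-1.
have gam0 : 0 < gam by rewrite invr_gt0 mulr_gt0.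
have gamal : gam < alpha^-1 by rewrite ltf_pV2 ?posrE ?mulr_gt0// mulr_natl mulr2n ltrDl.
have [C C0 HC] := Ex_drops mX lapX al1 gamal.
pose q2 := 2 `^ (- gam) : R.
have q20 : 0 < q2 by exact: q_gt0.
have q21 : q2 < 1 by exact: q_lt1.
have q2' : 0 < 1 - q2 by rewrite subr_gt0.
pose k := 2 / (1 - q2); have k0 : 0 < k by rewrite divr_gt0.
have C' : 0 < 2 * C * k ^+ 2 by rewrite mulr_gt0 ?exprn_gt0// mulr_gt0.
exists (2 * C * k ^+ 2), k; split=> //.
move=> p l y p0 l0 ky.
have y0 : 0 < y by exact: lt_le_trans ky.
pose v := y / k; have v1 : 1 <= v by rewrite ler_pdivlMr// mul1r.
have v0 : 0 < v by exact: lt_le_trans v1.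
have rl0 : 0 < root l by rewrite powR_gt0.
pose z m := v * (root l * q2 ^+ m).
have z0 m : 0 <= z m.
  apply: mulr_ge0; first exact: ltW.
  by rewrite mulr_ge0 ?(ltW rl0)// exprn_ge0// ltW.
apply: (@pbound_sub _ _ _ _ _ [set w | exists N0, forall N, (N0 <= N)%N ->
  [set w | 1 <= \sum_(m < N.+1) drops X p l (z m) m 0 w] w] (C / y ^+ 2 * (2 * k ^+ 2))).
- move=> w [cf Hn]; apply: contrapT => nE; apply: Hn => u t pu ut tl.
  have lt1 m : drops X p l (z m) m 0 w < 1.
    rewrite ltNge; apply/negP => h; apply: nE; exists m => N mN /=.
    rewrite (bigD1 (Ordinal (leq_ltn_trans mN (ltnSn N))))//=.
    by rewrite (le_trans h)// lerDl sumr_ge0// => j _; exact: drops_ge0.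
  have := @chaining R (fun t => X t w) p l p0 l0 cf p z 0%N (v * (root l / (1 - q2))) u t z0.
  have -> : 2 * (v * (root l / (1 - q2))) = y * root l.
    by rewrite /v /k; field; rewrite !gt_eqF.
  apply => //.
  + move=> N _; rewrite /z -!mulr_sumr !ler_wpM2l ?(ltW v0) ?(ltW rl0)//.
    have := @geom_sum_le R q2 0 N.+1 q20 q21; rewrite expr0 mul1r//.
  + by move=> m i _ im _; exact: drops_lt1.
  + by rewrite expr0 divr1; lra.
- by rewrite le_eqVlt; apply/orP; left; apply/eqP; field; rewrite gt_eqF.
apply: (@pbound_liminf _ _ _ _ _ 0%N) => N _.
have iD m : (m < N.+1)%N -> rint P (drops X p l (z m) m 0) by move=> _; exact: rint_drops.
apply: (@pbound_Ex _ _ _ _ _ (fun w => \sum_(m < N.+1) drops X p l (z m) m 0 w)).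
- exact: (rint_sum (F := fun m => drops X p l (z m) m 0)).
- by move=> w; apply: sumr_ge0 => m _; exact: drops_ge0.
- by [].
rewrite (Ex_sum (F := fun m => drops X p l (z m) m 0))//.
apply: (@le_trans _ _ (\sum_(m < N.+1) C / v ^+ 2 * 2^-1 ^+ m)).
  by apply: ler_sum => m _; apply: HC.
rewrite -mulr_sumr -(big_mkord xpredT (fun m => 2^-1 ^+ m)).
have gs := @geom_half_le R N.+1; apply: (@le_trans _ _ (C / v ^+ 2 * 2)).
  by rewrite ler_wpM2l// divr_ge0 ?(ltW C0)// exprn_ge0// ltW.
by rewrite le_eqVlt; apply/orP; left; apply/eqP; rewrite /v; field; rewrite !gt_eqF.
Qed.

(* [eta] bounds the moves of the path between the end [e] of the block containing the
   large jump and the cell [a, b]. *)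
Lemma loop_at_block (f : R -> R) (a b e l H rho eta K kap kap1 : R) (r lf q : R) :
  0 < r -> a - H <= r -> r <= e -> e <= a -> a <= b ->
  0 <= kap -> 0 <= kap1 -> leftlim f r lf ->
  lf + (kap1 + kap) <= f r -> f e + kap <= f r ->
  (forall s, r <= s <= e -> f r - kap1 <= f s) ->
  (forall s, e <= s <= b -> f e - eta <= f s) -> f a - f e <= eta ->
  eta + rho <= kap -> 0 <= eta -> kap1 + 2 * eta <= K ->
  b <= q <= b + H -> f q + K + rho <= f a ->
  loop_at f a b H rho.
Proof.
move=> r0 ar re ea ab k0 k10 Hlf h1 h2 h3 h4 h5 h6 eta0 hK hq h7.
exists r, lf, q.
have low s : r <= s <= b -> lf + rho <= f s /\ f a - K <= f s.
  move=> /andP[rs sb]; have [se|es] := leP s e.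
    by have := h3 s; rewrite rs se => /(_ isT); lra.
  have := h4 s; rewrite (ltW es) sb => /(_ isT).
  by have := h3 e; rewrite re lexx => /(_ isT); lra.
split=> //.
- by rewrite ar (le_trans re).
- by move=> s /low[].
split=> //; first by lra.
by move=> s /low[_]; lra.
Qed.

Lemma infinite_pigeon (J : nat) (S : nat -> nat -> Prop) :
  ~ (exists N0, forall N, (N0 <= N)%N -> forall j, (j < J)%N -> ~ S j N) ->
  exists2 j, (j < J)%N & forall N0, exists2 N, (N0 <= N)%N & S j N.
Proof.
elim: J => [|J IH] H; first by exfalso; apply: H; exists 0%N.
have [h|h] := pselect (forall N0, exists2 N, (N0 <= N)%N & S J N); first by exists J.
move/existsNP: h => [N1 HN1].
have [|j jJ Hj] := IH; last by exists j => //; exact: ltnW.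
move=> [N0 HN0]; apply: H; exists (N0 + N1)%N => N hN j; rewrite ltnS leq_eqVlt => /predU1P[->|jJ].
  by move=> SJ; apply: HN1; exists N => //; exact: leq_trans (leq_addl _ _) hN.
by apply: HN0 => //; exact: leq_trans (leq_addr _ _) hN.
Qed.

(** The blocks [e (j+1), e j] recede from the cell by factors A = 2^n. Outside [B1] one of the [n]
    blocks holds a large loop; excluding [B2] and [B3] prevents the much shorter time from there to
    the end of the cell from spoiling it; excluding [B4] bounds the rise over the cell, and
    excluding [B5] gives the later fall. The errors are O((n + 1) / A). *)
Lemma bad_bound : exists kap th C : R, exists n0 : nat, [/\ 0 < kap, 0 < th, th < 1, 0 < C &
  forall (n : nat) (h a : R), (n0 <= n)%N -> 0 < h -> h * (2 ^+ n) ^+ n <= a ->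
    pbound P [set w | cadlag (fun t => X t w) /\
       ~ loop_at (fun t => X t w) a (a + h) (h * (2 ^+ n) ^+ (2 * n).+1) (kap * root h)]
      (C * th ^+ n)].
Proof.
have [kap [kap1 [p0 [N1 [kap0 kap10 p00 p01 Hstep]]]]] := loop_step mX lapX al1 al2.
have [C2 [y0 [C20 y00 Hdrop]]] := drop_bound.
have [C3 [C30 Hfall]] := fall_attempts mX lapX al1 al2.
pose C1 := 16 * expR 4 : R.
have C10 : 0 < C1 by rewrite mulr_gt0// expR_gt0.
pose g := expR (- 4) / 4 : R.
have g0 : 0 < g by rewrite divr_gt0// expR_gt0.
have g1 : g < 1.
  have : expR (- 4) <= 1 :> R by rewrite expR_le1; lra.
  rewrite /g; lra.
(* The value 3/4 comes from n + 1 <= 2 (3/2)^n = 2 (3/4)^n A. *)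
pose th := Num.max (3 / 4) (Num.max (1 - p0) (1 - g)) : R.
have th0 : 0 < th by rewrite lt_max; apply/orP; left; lra.
have th1 : th < 1 by rewrite !gt_max; apply/andP; split; [lra|apply/andP; split; lra].
have thp : 1 - p0 <= th by rewrite !le_max lexx orbT.
have thg : 1 - g <= th by rewrite !le_max lexx !orbT.
have th34 : 3 / 4 <= th by rewrite !le_max lexx.
pose ke := (kap / 8) `^ (- alpha) : R.
have ke0 : 0 < ke by rewrite powR_gt0// divr_gt0.
pose C5 := C2 * (16 / kap) ^+ 2 + C1 * ke + C1 + C3.
have kk0 : 0 < 16 / kap by rewrite divr_gt0.
have C50 : 0 < C5 by rewrite !addr_gt0// mulr_gt0// exprn_gt0.
pose K1 := kap1 + kap.
have K10 : 0 <= K1 by rewrite addr_ge0// ltW.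
(* The two powers make admissible, in this order, the depth of the fall in [fall_attempts] and the
   threshold kap/16 A^(1/alpha) in [drop_bound]. *)
pose Amin := Num.max 2 (Num.max ((8 * (K1 + 1 + kap)) `^ alpha) ((16 * y0 / kap) `^ alpha)).
exists (kap / 8), th, (2 + 2 * C5), (Num.truncn Amin).+1; split=> //.
- by rewrite divr_gt0.
- by rewrite addr_gt0// mulr_gt0.
move=> n h a n0n h0 ha.
pose A : R := 2 ^+ n.
have AA : Amin <= A.
  have Am0 : 0 <= Amin by rewrite le_max ler0n.
  have /andP[_ hlt] := truncn_itv Am0; apply: (le_trans (ltW hlt)); rewrite /A -natrX ler_nat.
  exact: leq_trans n0n (ltnW (ltn_expl _ _)).
have A2 : 2 <= A by apply: le_trans AA; rewrite le_max lexx.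
have A0 : 0 < A by rewrite (lt_le_trans _ A2).
have A1 : 1 <= A by rewrite (le_trans _ A2)// ler1n.
have rA0 : 0 < root A by rewrite powR_gt0.
have rootle (x s : R) : 0 <= x -> x `^ alpha <= s -> x <= root s.
  move=> x0 xs; have -> : x = root (x `^ alpha) by rewrite -powRrM mulfV ?gt_eqF// powRr1.
  apply: ge0_ler_powR; rewrite ?nnegrE ?powR_ge0 ?invr_ge0 ?(ltW al0)//.
  exact: le_trans (powR_ge0 _ _) xs.
have rA1 : 8 * (K1 + 1 + kap) <= root A.
  apply: rootle; first by rewrite mulr_ge0// !addr_ge0// ltW.
  by apply: le_trans AA; rewrite !le_max lexx orbT.
have rA2 : y0 <= kap / 16 * root A.
  have : 16 * y0 / kap <= root A.
    apply: rootle; first by rewrite divr_ge0 ?mulr_ge0 ?ltW.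
    by apply: le_trans AA; rewrite !le_max lexx !orbT.
  rewrite ler_pdivrMr//; lra.
have rAA : A <= root A ^+ 2.
  rewrite -powR_mulrn ?powR_ge0// -powRrM -[X in X <= _]powRr1 ?(ltW A0)//.
  apply: ler_powR; first exact: A1.
  by rewrite mulrC ler_pdivlMr// mul1r ltW.
pose s j : R := h * A ^+ j.
have s0 j : 0 < s j by rewrite mulr_gt0// exprn_gt0.
have sS j : s j.+1 = s j * A by rewrite /s exprSr mulrA.
have sle i j : (i <= j)%N -> s i <= s j.
  move=> ij; rewrite ler_wpM2l ?(ltW h0)// ler_weXn2l//.
have s00 : s 0%N = h by rewrite /s expr0 mulr1.
have sa j : (j <= n)%N -> s j <= a by move=> jn; apply: le_trans ha; exact: sle.
have a0 : 0 < a by apply: lt_le_trans (sa 0%N (leq0n _)).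
pose e j := a - s j.
have e_ge0 j : (j <= n)%N -> 0 <= e j by move=> jn; rewrite subr_ge0; exact: sa.
pose l j := s j.+1 - s j.
have le2 j : s j.+1 / 2 <= l j.
  rewrite /l {2}(splitr (s j.+1)) -addrA lerDl subr_ge0 ler_pdivlMr// sS.
  by rewrite ler_wpM2l// ltW.
have l0 j : 0 < l j by rewrite (lt_le_trans _ (le2 j))// divr_gt0.
have el j : e j.+1 + l j = e j by rewrite /e /l; ring.
have rl j : root (s j.+1) / 2 <= root (l j).
  exact: (root_half_le al1 (ltW (s0 _)) (le2 j)).
have rs0 j : 0 < root (s j) by rewrite powR_gt0.
have rsS j : root (s j.+1) = root (s j) * root A by rewrite sS powRM ?(ltW (s0 _)) ?ltW.
have rsle i j : (i <= j)%N -> root (s i) <= root (s j).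
  by move=> ij; apply: ge0_ler_powR; rewrite ?nnegrE ?invr_ge0 ?(ltW (s0 _)) ?(ltW al0) ?sle.
pose eta j := kap / 4 * root (l j).
have eta0 j : 0 <= eta j by rewrite mulr_ge0 ?powR_ge0// divr_ge0// ltW.
have etal j : kap / 8 * root (s j.+1) <= eta j.
  have -> : kap / 8 * root (s j.+1) = kap / 4 * (root (s j.+1) / 2) by field.
  by rewrite ler_wpM2l// divr_ge0// ltW.
pose fail j w N := succ (fun t => X t w) (e j.+1) (l j) (kap * root (l j)) (kap1 * root (l j))
      ((kap1 + kap) * root (l j)) N.
have B1 : pbound P [set w | exists N0, forall N, (N0 <= N)%N ->
    [set w | forall j, (j < n)%N -> ~ fail j w N] w] (th ^+ n).
  apply: (@pbound_liminf _ _ _ _ _ N1) => N N1N.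
  (* Indices are reversed: [e] decreases in [j], whereas the trials must run forward in time. *)
  apply: (@pbound_sub _ _ _ _ _ [set w | forall i, (i < n)%N -> `[< ~ fail (n - i.+1)%N w N >]] ((1 - p0) ^+ n)).
  - by move=> w Hw i iN; apply/asboolP; apply: Hw; rewrite ltn_subrL; exact: leq_ltn_trans iN.
  - by rewrite lerXn2r ?nnegrE ?subr_ge0 ?(ltW th0) ?(ltW p01).
  apply: (@ibound_pbound _ _ _ P alpha X (e (n - n)%N)).
  apply: (attempts mX lapX (tau := fun i => e (n - i)%N)).
  - exact: e_ge0 (leq_subr _ _).
  - by rewrite subr_ge0.
  move=> i iN; have E : (n - i = (n - i.+1).+1)%N by rewrite subnSK.
  have ji : ((n - i.+1).+1 <= n)%N by rewrite -E leq_subr.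
  have := Hstep (e (n - i.+1).+1) (l (n - i.+1)%N) N (e_ge0 _ ji) (l0 _) N1N.
  by rewrite el E.
have B2 : pbound P [set w | exists2 j, (j < n)%N & cadlag (fun t => X t w) /\
   ~ (forall u t, e j <= u -> u <= t -> t <= e j + (s j + h) ->
        X u w - kap / 16 * root A * root (s j + h) <= X t w)] (n%:R * (C2 / (kap / 16 * root A) ^+ 2)).
  apply: pbound_bigU => j jn; apply: Hdrop => //; first exact: e_ge0 (ltnW jn).
  by rewrite addr_gt0.
have B3 : pbound P [set w | exists2 j, (j < n)%N & eta j <= X a w - X (e j) w] (n%:R * (C1 * ke / A)).
  apply: pbound_bigU => j jn; apply: pbound_pr; first exact: rint_coray.
  have ej : 0 < eta j by apply: lt_le_trans (etal j); rewrite mulr_gt0// divr_gt0.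
  apply: le_trans (upper_tail mX lapX al2 (e_ge0 _ (ltnW jn)) _ ej) _.
    by rewrite gerBl ltW.
  have -> : a - e j = s j by rewrite /e; ring.
  rewrite -[leRHS]mulrA ler_wpM2l ?(ltW C10)//.
  have : eta j `^ (- alpha) <= ke / s j.+1.
    rewrite powRN /ke powRN -invfM lef_pV2 ?posrE ?mulr_gt0 ?powR_gt0 ?divr_gt0 ?exprn_gt0//.
    have -> : (kap / 8) `^ alpha * s j.+1 = (kap / 8 * root (s j.+1)) `^ alpha.
      rewrite [in RHS]powRM ?powR_ge0 ?divr_ge0 ?(ltW kap0)// -powRrM mulVf ?gt_eqF// powRr1//.
      exact: ltW.
    apply: ge0_ler_powR; rewrite ?nnegrE ?(ltW al0)//.
    by rewrite mulr_ge0 ?powR_ge0// divr_ge0// ltW.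
  move=> /(ler_wpM2l (ltW (s0 j))) hh; apply: (le_trans hh); rewrite sS.
  have := s0 j; move: (s j) => q q0.
  by rewrite le_eqVlt; apply/orP; left; apply/eqP; field; rewrite !gt_eqF.
have B4 : pbound P [set w | root (s n) <= X (a + h) w - X a w] (C1 / A ^+ n).
  apply: pbound_pr; first exact: rint_coray.
  apply: le_trans (upper_tail mX lapX al2 (ltW a0) _ (rs0 n)) _; first by rewrite lerDl ltW.
  rewrite addrAC subrr add0r ler_wpM2l ?(ltW C10)//.
  rewrite -powRrM mulrN mulVf ?gt_eqF// powR_inv1 ?(ltW (s0 _))// /s.
  have := exprn_gt0 n A0; move: (A ^+ n) => q q0.
  by rewrite le_eqVlt; apply/orP; left; apply/eqP; field; rewrite !gt_eqF.
have ah0 : 0 <= a + h by rewrite addr_ge0 ?ltW.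
(* The fall is awaited at the times h A^(n + 1 + j) after the cell, j <= n, the last of which is the
   reach h A^(2 n + 1). Starting at A^(n + 1) allows a depth that dominates all earlier scales, of
   order (s n)^(1/alpha). *)
have B5 : pbound P [set w | forall j, (j <= n)%N ->
    - ((K1 + 1 + kap) * root (s n)) < X (a + h + s n.+1 * A ^+ j) w - X (a + h) w]
    ((1 - g) ^+ n + n%:R * (C3 / A)).
  apply: Hfall => //; rewrite rsS.
  have := ler_wpM2l (ltW (rs0 n)) rA1; lra.
have total : th ^+ n + n%:R * (C2 / (kap / 16 * root A) ^+ 2) + n%:R * (C1 * ke / A) + C1 / A ^+ n +
   ((1 - g) ^+ n + n%:R * (C3 / A)) <= (2 + 2 * C5) * th ^+ n.
  clear B1 B2 B3 B4 B5 fail etal eta0 eta rsle rsS rs0 rl el l0 le2 l e_ge0 e sa s00 sle sS s0 s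
    Hfall Hdrop Hstep rootle ah0 ha.
  have gn : (1 - g) ^+ n <= th ^+ n by rewrite lerXn2r ?nnegrE ?subr_ge0 ?(ltW th0)// ltW.
  have c2 : C2 / (kap / 16 * root A) ^+ 2 <= C2 * (16 / kap) ^+ 2 / A.
    have -> : C2 / (kap / 16 * root A) ^+ 2 = C2 * (16 / kap) ^+ 2 / root A ^+ 2.
      by field; rewrite !gt_eqF.
    apply: ler_wpM2l; first by apply: mulr_ge0; [exact: ltW|apply: exprn_ge0; exact: ltW].
    by rewrite lef_pV2 ?posrE ?exprn_gt0.
  have c1 : C1 / A ^+ n <= C1 / A.
    rewrite ler_wpM2l ?(ltW C10)// lef_pV2 ?posrE ?exprn_gt0//.
    rewrite -[X in X <= _]expr1 ler_weXn2l//.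
    exact: leq_trans n0n.
  have n1 : n.+1%:R / A <= 2 * th ^+ n.
    have b1 := @bernoulli_le R (- (2^-1)) n.
    have b2 : 1 + n%:R * 2^-1 <= (3 / 2) ^+ n :> R.
      elim: n {b1 n0n A AA A2 A0 A1 rA0 rA1 rA2 rAA gn c2 c1} => [|n IHn].
        by rewrite mul0r addr0 expr0.
      rewrite exprS -natr1; have : 0 <= n%:R :> R by [].
      have := ler_wpM2l (_ : 0 <= 3 / 2 :> R) IHn => /(_ ltac:(lra)); lra.
    have b3 : (3 / 4) ^+ n <= th ^+ n by rewrite lerXn2r ?nnegrE ?(ltW th0)//; lra.
    have b4 : n.+1%:R <= 2 * (3 / 2) ^+ n :> R by rewrite -natr1; lra.
    have b5 : (3 / 2) ^+ n = (3 / 4) ^+ n * A by rewrite /A -exprMn; congr (_ ^+ _); field.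
    rewrite ler_pdivrMr//; apply: (le_trans b4); rewrite b5.
    have := ler_wpM2r (ltW A0) b3; lra.
  have nn : n%:R <= n.+1%:R :> R by rewrite ler_nat.
  have m1 : n%:R * (C2 / (kap / 16 * root A) ^+ 2) <= C2 * (16 / kap) ^+ 2 * (n.+1%:R / A).
    have := ler_pM (ler0n _ n) _ nn c2 => /(_ ltac:(by rewrite divr_ge0 ?(ltW C20)// exprn_ge0// mulr_ge0 ?divr_ge0 ?ltW)).
    by move=> hh; apply: (le_trans hh); rewrite le_eqVlt; apply/orP; left; apply/eqP; ring.
  have nA : n%:R / A <= n.+1%:R / A by rewrite ler_wpM2r ?invr_ge0 ?(ltW A0).
  have m2 : n%:R * (C1 * ke / A) <= C1 * ke * (n.+1%:R / A).
    have := ler_wpM2l (ltW (mulr_gt0 C10 ke0)) nA; lra.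
  have m3 : n%:R * (C3 / A) <= C3 * (n.+1%:R / A).
    have := ler_wpM2l (ltW C30) nA; lra.
  have m4 : C1 / A <= C1 * (n.+1%:R / A).
    rewrite ler_wpM2l ?(ltW C10)// -[X in X <= _]mul1r ler_wpM2r ?invr_ge0 ?(ltW A0)//.
    by rewrite ler1n.
  have m5 := ler_wpM2l (ltW C50) n1.
  rewrite /C5 in m5 *; lra.
apply: pbound_sub total (pboundU (pboundU (pboundU (pboundU B1 B2) B3) B4) B5).
move=> w [cf nloop]; apply: contrapT.
move=> /not_orP[/not_orP[/not_orP[/not_orP[nB1 nB2] nB3] nB4] nB5]; apply: nloop.
have [j jn Hj] := infinite_pigeon nB1.
have a1_0 : 0 <= kap1 * root (l j) by rewrite mulr_ge0// powR_ge0.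
have a2_0 : 0 < (kap1 + kap) * root (l j) by rewrite mulr_gt0 ?powR_gt0// ltr_wpDl.
have [r [lf [r0 /andP[pr re] Hlf k1 [k2 k3]]]] :=
  @succ_limit R (fun t => X t w) (e j.+1) (l j) _ _ _ cf (e_ge0 _ jn) (l0 j) a1_0 a2_0 Hj.
rewrite el in re k2 k3.
have D2 : forall u t, e j <= u -> u <= t -> t <= e j + (s j + h) ->
        X u w - kap / 16 * root A * root (s j + h) <= X t w.
  by apply: contrapT => nD; apply: nB2; exists j.
have D3 : X a w - X (e j) w <= eta j.
  by rewrite leNgt; apply/negP => hl; apply: nB3; exists j => //; exact: ltW.
have D4 : X (a + h) w - X a w <= root (s n).
  by rewrite leNgt; apply/negP => hl; apply: nB4; exact: ltW.
have [i [iN D5]] : exists i, (i <= n)%N /\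
   X (a + h + s n.+1 * A ^+ i) w - X (a + h) w <= - ((K1 + 1 + kap) * root (s n)).
  apply: contrapT => hn; apply: nB5 => i iN; rewrite ltNge; apply/negP => hl.
  by apply: hn; exists i.
have ejE : e j + (s j + h) = a + h by rewrite /e; ring.
have sh : kap / 16 * root A * root (s j + h) <= eta j.
  apply: le_trans (etal j); rewrite rsS.
  have -> : kap / 8 * (root (s j) * root A) = kap / 16 * root A * (2 * root (s j)) by field.
  rewrite ler_wpM2l ?mulr_ge0 ?divr_ge0 ?(ltW kap0) ?(ltW rA0)//.
  apply: (@le_trans _ _ (root (2 * s j))).
    have sjh : s j + h <= 2 * s j.
      by rewrite mulr_natl mulr2n lerD2l -s00; exact: sle.
    have sj0 : 0 <= s j + h by rewrite addr_ge0// ltW.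
    apply: ge0_ler_powR; rewrite ?nnegrE ?invr_ge0 ?(ltW al0)//.
    exact: le_trans sjh.
  rewrite powRM ?(ltW (s0 _))// ler_wpM2r ?powR_ge0//.
  rewrite -[X in _ <= X]powRr1//; apply: ler_powR; first by rewrite ler1n.
  by rewrite invf_le1// ltW.
have lsn : root (l j) <= root (s n).
  apply: le_trans (rsle _ _ jn); apply: ge0_ler_powR; rewrite ?nnegrE ?invr_ge0 ?(ltW al0) ?(ltW (l0 _)) ?(ltW (s0 _))//.
  by rewrite gerBl ltW.
have rh : root h / 2 <= root (l j).
  apply: le_trans (rl j); rewrite ler_wpM2r ?invr_ge0//.
  by have := rsle 0%N j.+1 (leq0n _); rewrite s00.
have rh0 : 0 < root h by rewrite powR_gt0.
have rl0 : 0 < root (l j) by rewrite powR_gt0.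
have sn1H : s n.+1 * A ^+ i <= h * (2 ^+ n) ^+ (2 * n).+1.
  rewrite -/A /s -mulrA -exprD ler_wpM2l ?(ltW h0)// ler_weXn2l//.
  by rewrite addSn ltnS mul2n -addnn leq_add2l.
have snH : s n <= h * (2 ^+ n) ^+ (2 * n).+1.
  by rewrite -/A; apply: sle; rewrite mul2n -addnn -addSn leq_addl.
have q1 : kap * (root h / 2) <= kap * root (l j) by rewrite ler_wpM2l ?(ltW kap0).
have q2 : kap1 * root (l j) <= kap1 * root (s n) by rewrite ler_wpM2l.
have q3 : kap * root (l j) <= kap * root (s n) by rewrite ler_wpM2l ?(ltW kap0).
have q4 : root h <= root (s n) by have := rsle 0%N n (leq0n _); rewrite s00.
have q5 : kap * root h <= kap * root (s n) by rewrite ler_wpM2l ?(ltW kap0).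
have kr0 : 0 < kap * root h by rewrite mulr_gt0.
apply: (@loop_at_block (fun t => X t w) a (a + h) (e j) (l j) _ _ (eta j) (K1 * root (s n))
  (kap * root (l j)) (kap1 * root (l j)) r lf (a + h + s n.+1 * A ^+ i)) => //.
- rewrite (le_trans _ pr)// /e lerD2l lerN2; apply: le_trans snH; exact: sle.
- by rewrite gerBl ltW.
- by rewrite lerDl ltW.
- by rewrite mulr_ge0 ?powR_ge0 ?ltW.
- by rewrite -mulrDl.
- move=> t /andP[et ta]; apply: le_trans (D2 (e j) t (lexx _) et _); last by rewrite ejE.
  by rewrite lerD2l lerN2.
- by rewrite /eta; clear -q1 kr0; lra.
- by rewrite /eta /K1; clear -q1 q2 q3 kr0; lra.
- rewrite lerDl mulr_ge0 ?exprn_ge0 ?(ltW (s0 _)) ?(ltW A0)//=.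
  by rewrite lerD2l.
- by clear -D4 D5 q5 kr0; rewrite /K1 in D5 *; lra.
Qed.

End bad_bound.

(** * Dimension of the looptree *)

Section loops_of_path.
Variables (R : realType) (alpha gamma : R) (f : R -> R).
Hypotheses (gamma0 : 0 < gamma) (cf : cadlag f) (lh : lower_holder gamma f).
Hypothesis NJ : no_jump_from_inf f.
Hypothesis unb : forall M : R, exists2 s, 1 <= s & f s < M.
Hypothesis f1 : exists2 u, 0 <= u <= 1 & f u < f 1.
Local Notation g := (g1 f).
Local Notation zeta := (d1 f - g1 f).
Local Notation c := (zeta `^ (- alpha^-1)).

(** At that distance [t] is either before the jump [r] or after the fall [q], the two cases of
    [ltdist_loop]; [c] is the spatial scaling of the excursion. *)
Lemma loop_ltdist (a b H rho u t : R) : loop_at f a b H rho -> 0 < rho ->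
  0 <= u <= 1 -> 0 <= t <= 1 -> a <= g + u * zeta -> g + u * zeta < b ->
  H + (b - a) <= `|t - u| * zeta -> ((c * rho)%:E <= ltdist alpha f u t)%E.
Proof.
move=> [r [lf [q [r0 /andP[ar ra] Hlf k1 [k2 /andP[bq qb] k3]]]]] rho0 u01 t01 au ub tu.
have z0 : 0 < zeta := zeta_gt0 gamma0 cf lh NJ unb f1.
have g0 : 0 <= g := g_ge0 gamma0 cf lh NJ.
have gm := g_min gamma0 cf lh NJ unb f1.
have exc : excursion alpha f := path_excursion alpha gamma0 cf lh NJ unb f1.
have c0 : 0 < c by rewrite powR_gt0.
have /andP[u0 u1] := u01; have /andP[t0 t1] := t01.
have cr : 0 < c * rho by rewrite mulr_gt0.
have uz0 : 0 <= u * zeta by rewrite mulr_ge0// ltW.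
have ud : g + u * zeta <= d1 f.
  by have : u * zeta <= 1 * zeta; [rewrite ler_pM2r|lra].
(* The jump lies inside the excursion: were [r <= g], then [lf + rho <= f g], and just before [r]
   the path would be below its minimum [f g]. *)
have rg : g < r.
  rewrite ltNge; apply/negP => rg.
  have h1 := k1 g; rewrite rg /= in h1; have {}h1 := h1 ltac:(lra).
  have [s /andP[s0 sr]] := leftlim_approx Hlf r0 rho0.
  rewrite ltr_distl => /andP[_ h2].
  by have := gm s; rewrite (ltW s0) => /(_ ltac:(lra)); lra.
have UK x : g + (x - g) / zeta * zeta = x by field; rewrite gt_eqF.
have le_u x v : ((x - g) / zeta <= v) = (x <= g + v * zeta).
  by rewrite ler_pdivrMr// lerBlDl.
have le_u' x v : (v <= (x - g) / zeta) = (g + v * zeta <= x).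
  by rewrite ler_pdivlMr// lerBrDl.
have XE x : Xexc alpha f ((x - g) / zeta) = c * (f x - f g) by rewrite /Xexc UK.
pose r' := (r - g) / zeta.
have r'0 : 0 < r' by rewrite divr_gt0// subr_gt0.
have r'u : r' <= u by rewrite le_u (le_trans ra).
have [_ xm] : leftlim (Xexc alpha f) r' (c * (lf - f g)) /\ Xexcm alpha f r' = c * (lf - f g).
  by apply: (Xexcm_eq alpha gamma0 cf lh NJ unb f1) => //; rewrite UK.
have HI (x : R) : (forall s, r <= s <= b -> x + rho <= f s) ->
    c * (x - f g) + c * rho <= Iexc alpha f r' u.
  move=> hx; apply: I_glb => // v /andP[rv vu].
  rewrite -mulrDr /Xexc ler_pM2l//.
  have : x + rho <= f (g + v * zeta).
    apply: hx; rewrite -le_u rv /=; apply: ltW; apply: le_lt_trans ub.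
    by rewrite lerD2l ler_pM2r.
  lra.
apply: (ltdist_loop exc r'0 r'u u1 t01 (ltW cr)).
- by rewrite xm; exact: HI.
- apply: (@le_trans _ _ (Xexc alpha f ((a - g) / zeta) + c * rho)).
    rewrite lerD2r; apply: (I_le exc (ltW r'0)) => //.
      by rewrite le_u UK.
    by rewrite le_u.
  rewrite !XE -mulrDr ler_pM2l//; lra.
have [tu'|ut] := ltP t u; [apply/orP; left|apply/orP; right].
  rewrite ltNge le_u -ltNge.
  move: tu; rewrite ltr0_norm ?subr_lt0// opprB mulrBl; lra.
move: tu; rewrite ger0_norm ?subr_ge0// mulrBl => tu.
have h := HI (f q) k3.
rewrite /= lerBrDr; apply: le_trans h; rewrite lerD2r -XE; apply: (I_le exc) => //.
  by rewrite le_u' (le_trans (ltW ub)).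
by rewrite le_u; lra.
Qed.

End loops_of_path.

Section scales.
Variable R : realType.
Implicit Types (sig alpha : R) (L n : nat).

Definition mesh L n : R := (2 ^+ (L * n ^ 2))^-1.
Definition reach L n : R := mesh L n * (2 ^+ n) ^+ (2 * n).+1.

Lemma mesh_gt0 L n : 0 < mesh L n.
Proof. by rewrite invr_gt0 exprn_gt0. Qed.

Lemma mesh_le_reach L n : mesh L n <= reach L n.
Proof. by rewrite ler_peMr ?(ltW (mesh_gt0 _ _))// !exprn_ege1// ler1n. Qed.

Lemma reach_gt0 L n : 0 < reach L n.
Proof. exact: lt_le_trans (mesh_gt0 L n) (mesh_le_reach L n). Qed.

Lemma reach_le L n : (4 <= L)%N -> reach L n <= 2^-1 ^+ n.
Proof.
move=> L4; rewrite /reach /mesh -exprM exprVn.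
rewrite ler_pdivrMl ?exprn_gt0// ler_pdivlMr ?exprn_gt0// -exprD.
rewrite ler_weXn2l ?ler1n//.
have : (4 * n ^ 2 <= L * n ^ 2)%N by rewrite leq_mul2r L4 orbT.
apply: leq_trans.
rewrite expnS expn1; clear; nia.
Qed.

Lemma reach_powR L n : reach L n = 2 `^ (n%:R * (2 * n%:R + 1) - L%:R * n%:R ^+ 2).
Proof.
rewrite powRB//; last by rewrite pnatr_eq0 implybT.
rewrite /reach /mesh mulrC; congr (_ / _); last first.
  by rewrite -powR_mulrn// natrM natrX.
rewrite -exprM -powR_mulrn//.
by rewrite natrM -[(2 * n).+1%:R]natr1 natrM.
Qed.

Lemma mesh_powR L n : mesh L n = 2 `^ (- (L%:R * n%:R ^+ 2)).
Proof. by rewrite powRN /mesh -powR_mulrn// natrM natrX. Qed.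

(** [L sig <= L - 3] leaves - n^2 in the exponent, which absorbs the linear terms, among them those
    due to the shift from n to n + 1; completing the square gives [M]. *)
Lemma reach_le_mesh L sig : sig <= 1 -> 3 <= L%:R * (1 - sig) -> exists2 M : R, 0 < M &
  forall n, reach L n <= M * mesh L n.+1 `^ sig.
Proof.
move=> s1 HL; exists (2 `^ ((1 + 2 * L%:R) ^+ 2 + L%:R)); first by rewrite powR_gt0.
move=> n; rewrite reach_powR mesh_powR -powRrM -powRD; last by rewrite pnatr_eq0 implybT.
apply: ler_powR; first by rewrite ler1n.
have L0 : 0 <= L%:R :> R by [].
have n0 : 0 <= n%:R :> R by [].
rewrite -[n.+1%:R]natr1; move: (L%:R : R) (n%:R : R) L0 n0 HL => l m l0 m0 HL.
have h1 : l * sig * m ^+ 2 <= (l - 3) * m ^+ 2 by rewrite ler_wpM2r ?exprn_ge0//; lra.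
have h2 : l * sig * (2 * m + 1) <= l * (2 * m + 1).
  rewrite ler_wpM2r ?addr_ge0 ?mulr_ge0// -[leRHS]mulr1 ler_wpM2l//.
have h3 : 0 <= (m - (1 + 2 * l) / 2) ^+ 2 by exact: sqr_ge0.
have h4 : 0 <= (1 + 2 * l) ^+ 2 by exact: sqr_ge0.
lra.
Qed.

End scales.

Section bad_cells.
Variable R : realType.

Lemma lebesgue_itv_le (x y l : R) : 0 <= l -> y - x <= l ->
  (lebesgue_measure `[x, y[%classic <= l%:E)%E.
Proof.
move=> l0 yx; rewrite lebesgue_measure_itv/= lte_fin.
by case: ifPn => _; rewrite ?lee_fin// -EFinD lee_fin.
Qed.

Lemma lebesgue_bigcup_le (N : nat) (B : nat -> bool) (A : nat -> set R) (l : R) : 0 <= l ->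
  (forall k, measurable (A k)) -> (forall k, (lebesgue_measure (A k) <= l%:E)%E) ->
  exists2 U : set R, measurable U & (forall k, (k < N)%N -> B k -> A k `<=` U) /\
    (lebesgue_measure U <= (\sum_(k < N) l * (B k)%:R)%:E)%E.
Proof.
move=> l0 mA lA; pose A' k := if B k then A k else set0.
have mA' k : measurable (A' k) by rewrite /A'; case: ifP.
exists (\big[setU/set0]_(k < N) A' k); first by apply: bigsetU_measurable.
split=> [k kN Bk u Au|].
  by rewrite -bigcup_mkord; exists k => //; rewrite /A' Bk.
apply: le_trans (Boole_inequality lebesgue_measure (fun k _ => mA' k)) _.
rewrite -sumEFin; apply: lee_sum => k _; rewrite /A'; case: (B k).
  by rewrite /= mulr1.
by rewrite /= mulr0 measure0.
Qed.

Lemma avoid_tail (N : nat) (Bad : nat -> set R) (v : nat -> R) : (forall n, measurable (Bad n)) ->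
  (forall n, (lebesgue_measure (Bad n) <= (v n)%:E)%E) ->
  (\sum_(N <= n <oo) (v n)%:E < 1)%E ->
  exists2 G : set R, measurable G & [/\ G `<=` @unit_I R, (0 < lebesgue_measure G)%E &
    forall n u, (N <= n)%N -> G u -> ~ Bad n u].
Proof.
move=> mB lB hs; pose V := \bigcup_(n in ~` `I_N) Bad n.
have mV : measurable V by exact: bigcup_measurable.
have mI : measurable (@unit_I R) by exact: measurable_itv.
have lV : (lebesgue_measure V < 1)%E.
  apply: le_lt_trans hs.
  apply: le_trans (measure_sigma_subadditive_tail lebesgue_measure mB mV (@subset_refl _ V)) _.
  by apply: lee_nneseries => n *; [exact: measure_ge0|exact: lB].
exists (@unit_I R `\` V); first exact: measurableD.
split=> [u [] //||n u Nn [_ nV] Bu]; last first.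
  by apply: nV; exists n => //=; rewrite ltnNge; apply/negP; rewrite Nn.
rewrite lt_neqAle measure_ge0 andbT; apply/eqP => E.
have : (lebesgue_measure (@unit_I R) <= lebesgue_measure (@unit_I R `\` V) + lebesgue_measure V)%E.
  apply: le_trans (measureU2 lebesgue_measure (measurableD mI mV) mV).
  apply: le_measure; rewrite ?inE//; first by apply: measurableU => //; exact: measurableD.
  by move=> u Iu; have [?|?] := pselect (V u); [right|left].
by rewrite -E add0e lebesgue_measure_itv/= lte_fin ltr01 oppr0 adde0 leNgt lV.
Qed.

End bad_cells.

(** * Mass distribution on the good excursion times: the lower bound on the dimension *)

Section lower_dimension.
Variables (R : realType) (alpha gamma : R) (f : R -> R).
Hypotheses (gamma0 : 0 < gamma) (cf : cadlag f) (lh : lower_holder gamma f).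
Hypothesis NJ : no_jump_from_inf f.
Hypothesis unb : forall M : R, exists2 s, 1 <= s & f s < M.
Hypothesis f1 : exists2 u, 0 <= u <= 1 & f u < f 1.
Local Notation g := (g1 f).
Local Notation zeta := (d1 f - g1 f).
Local Notation c := (zeta `^ (- alpha^-1)).

Lemma hmeasure_lower (kap s : R) (L K n1 : nat) (B : nat -> nat -> bool) :
  d1 f < K%:R -> 0 < kap -> 0 < alpha -> 0 <= s -> s < alpha -> (4 <= L)%N ->
  3 <= L%:R * (1 - s / alpha) ->
  (forall n k, (n1 <= n)%N -> ((2 ^ n) ^ n <= k)%N -> (k < K * 2 ^ (L * n ^ 2))%N -> ~~ B n k ->
    loop_at f (k%:R * mesh R L n) (k%:R * mesh R L n + mesh R L n) (reach R L n)
      (kap * mesh R L n `^ alpha^-1)) ->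
  (\sum_(0 <= n <oo) (mesh R L n * (2 ^+ n) ^+ n +
     \sum_(k < K * 2 ^ (L * n ^ 2)) mesh R L n * (B n k)%:R)%:E < +oo)%E ->
  hmeasure (ltdist alpha f) s != 0%E.
Proof.
move=> dK kap0 al0 s0 sal L4 HL Hloop Hsum.
have z0 : 0 < zeta := zeta_gt0 gamma0 cf lh NJ unb f1.
have g0 : 0 <= g := g_ge0 gamma0 cf lh NJ.
have c0 : 0 < c by rewrite powR_gt0.
have h0 n : 0 < mesh R L n := mesh_gt0 R L n.
have H0 n : 0 < reach R L n := reach_gt0 R L n.
pose S n := mesh R L n * (2 ^+ n) ^+ n + \sum_(k < K * 2 ^ (L * n ^ 2)) mesh R L n * (B n k)%:R.
have S0 n : 0 <= S n.
  rewrite addr_ge0 ?mulr_ge0 ?exprn_ge0 ?(ltW (h0 _))//.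
  by apply: sumr_ge0 => k _; rewrite mulr_ge0// ltW.
have z2 : 0 < zeta / 2 by rewrite divr_gt0.
(* A length zeta / 2 in path time is 1/2 in excursion time: removing the bad sets from rank [N] on
   leaves positive measure in [0,1]. *)
have [N HN] := nneseries_tail S0 z2 Hsum.
pose cell n k : set R := `[(k%:R * mesh R L n - g) / zeta, (k%:R * mesh R L n + mesh R L n - g) / zeta[%classic.
have lcell n k : (lebesgue_measure (cell n k) <= (mesh R L n / zeta)%:E)%E.
  apply: lebesgue_itv_le; first by rewrite divr_ge0 ?ltW.
  by rewrite -mulrBl ler_wpM2r ?invr_ge0 ?(ltW z0)//; lra.
have hz n : 0 <= mesh R L n / zeta by rewrite divr_ge0 ?ltW.
have exU n : exists U : set R, [/\ measurable U, 
    forall k, (k < K * 2 ^ (L * n ^ 2))%N -> B n k -> cell n k `<=` U &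
    (lebesgue_measure U <= (\sum_(k < K * 2 ^ (L * n ^ 2)) mesh R L n / zeta * (B n k)%:R)%:E)%E].
  have mc k : measurable (cell n k) by exact: measurable_itv.
  have [U mU [U1 U2]] := lebesgue_bigcup_le (K * 2 ^ (L * n ^ 2)) (B n) (hz n) mc (lcell n).
  by exists U.
have [U HU] := choice exU.
pose E n : set R := `[- g / zeta, (mesh R L n * (2 ^+ n) ^+ n - g) / zeta[%classic.
have mE n : measurable (E n) by exact: measurable_itv.
have mU n : measurable (U n) by have [] := HU n.
have [G mG [GI G0 GB]] : exists2 G : set R, measurable G & [/\ G `<=` @unit_I R,
    (0 < lebesgue_measure G)%E & forall n u, (N <= n)%N -> G u -> ~ (E n `|` U n) u].
  apply: (@avoid_tail R N (fun n => E n `|` U n) (fun n => zeta^-1 * S n)).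
  - by move=> n; exact: measurableU.
  - move=> n; apply: le_trans (measureU2 lebesgue_measure (mE n) (mU n)) _.
    rewrite mulrDr EFinD; apply: leeD.
      apply: lebesgue_itv_le; first by rewrite !mulr_ge0 ?invr_ge0 ?exprn_ge0 ?(ltW z0) ?(ltW (h0 _)).
      by rewrite -mulrBl opprK subrK mulrC.
    have [_ _ /le_trans] := HU n; apply; rewrite lee_fin mulr_sumr.
    by rewrite le_eqVlt; apply/orP; left; apply/eqP; apply: eq_bigr => k _; ring.
  - under eq_eseriesr do rewrite EFinM.
    rewrite nneseriesZl; last by move=> n _; rewrite lee_fin.
    apply: (@le_lt_trans _ _ (zeta^-1%:E * (zeta / 2)%:E)%E).
      by apply: lee_wpmul2l => //; rewrite lee_fin invr_ge0 ltW.
    rewrite -EFinM lte_fin mulrA mulVf ?gt_eqF// mul1r invf_lt1//; lra.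
pose m0 := (maxn N n1).
have sa1 : s / alpha <= 1 by rewrite ler_pdivrMr// mul1r ltW.
have [M M0 HM] := reach_le_mesh sa1 HL.
have ck0 : 0 < c * kap by rewrite mulr_gt0.
(* The factor 2 pays for the width of the cell, as the mesh is at most the reach. *)
pose H m := 2 * reach R L (m + m0) / zeta.
pose rho m := c * (kap * mesh R L (m + m0) `^ alpha^-1).
apply: (@hmeasure_gt0 R _ s G (4 / zeta * M / (c * kap) `^ s) H rho) => //.
- by rewrite !mulr_gt0 ?invr_gt0 ?powR_gt0.
- by move=> m; rewrite divr_gt0 ?mulr_gt0.
- by move=> m; rewrite !mulr_gt0 ?powR_gt0.
- rewrite -(mulr0 (2 / zeta)) (_ : H = fun m => 2 / zeta * reach R L (m + m0)); last first.
    by apply/funext => m; rewrite /H; field; rewrite gt_eqF.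
  apply: cvgMr; rewrite (cvg_shiftn m0 (reach R L)).
  apply: (@squeeze_cvgr _ _ _ _ (fun=> 0) (fun n => 2^-1 ^+ n)).
  + by apply: nearW => n; rewrite (ltW (H0 n)) reach_le.
  + exact: cvg_cst.
  + by apply: cvg_expr; rewrite ger0_norm ?invr_ge0// invf_lt1// ltr1n.
- rewrite -(mulr0 (c * kap)) (_ : rho = fun m => c * kap * (mesh R L (m + m0) `^ alpha^-1)); last first.
    by apply/funext => m; rewrite /rho mulrA.
  apply: cvgMr; rewrite (cvg_shiftn m0 (fun n => mesh R L n `^ alpha^-1)).
  apply: (@squeeze_cvgr _ _ _ _ (fun=> 0) (fun n => (2^-1 `^ alpha^-1) ^+ n)).
  + apply: nearW => n; rewrite powR_ge0/= -powR_mulrn ?powR_ge0// -powRrM.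
    rewrite [alpha^-1 * _]mulrC powRrM powR_mulrn ?invr_ge0//.
    apply: ge0_ler_powR; rewrite ?nnegrE ?invr_ge0 ?exprn_ge0 ?invr_ge0 ?(ltW al0) ?(ltW (h0 _))//.
    exact: le_trans (mesh_le_reach R L n) (reach_le R n L4).
  + exact: cvg_cst.
  + apply: cvg_expr; rewrite ger0_norm ?powR_ge0//.
    by rewrite -[2^-1]powR_inv1// -powRrM mulN1r; apply: q_lt1; rewrite invr_gt0.
- move=> m; rewrite /H /rho addSn.
  rewrite [c * (_ * _)]mulrA [(c * kap * _) `^ s]powRM ?powR_ge0 ?(ltW ck0)// -powRrM [alpha^-1 * s]mulrC.
  have := HM (m + m0)%N; move: (reach R L _) (mesh R L _ `^ _) => x y xy.
  have -> : 4 / zeta * M / (c * kap) `^ s * ((c * kap) `^ s * y) = 4 / zeta * (M * y).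
    by field; rewrite !gt_eqF// powR_gt0.
  have -> : 2 * (2 * x / zeta) = 4 / zeta * x by field; rewrite gt_eqF.
  by rewrite ler_pM2l// divr_gt0.
move=> m u t Gu It; have Iu := GI u Gu.
have u01 : 0 <= u <= 1 by move: Iu; rewrite /unit_I/= in_itv.
have t01 : 0 <= t <= 1 by move: It; rewrite /unit_I/= in_itv.
pose n := (m + m0)%N; have Nn : (N <= n)%N.
  by rewrite (leq_trans (leq_maxl N n1))// leq_addl.
have n1n : (n1 <= n)%N by rewrite (leq_trans (leq_maxr N n1))// leq_addl.
have nB := GB n u Nn Gu.
rewrite /H /rho -/n ler_pdivrMr// => tu.
have hn := h0 n; have mr := mesh_le_reach R L n.
pose v := g + u * zeta; have /andP[u0 u1] := u01.
have v0 : 0 <= v by rewrite addr_ge0// mulr_ge0// ltW.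
have vd : v <= d1 f.
  by have : u * zeta <= 1 * zeta; [rewrite ler_pM2r|rewrite /v; lra].
have vh : 0 <= v / mesh R L n by rewrite divr_ge0// ltW.
have /andP[k1 k2] := truncn_itv vh; set k := Num.truncn _ in k1 k2.
rewrite ler_pdivlMr// in k1; rewrite ltr_pdivrMr// -natr1 mulrDl mul1r in k2.
have ucell : cell n k u.
  by rewrite /cell/= in_itv/= ler_pdivrMr// ltr_pdivlMr// lerBlDl ltrBrDl k1 k2.
apply: (@loop_ltdist R alpha gamma f gamma0 cf lh NJ unb f1 (k%:R * mesh R L n)
  (k%:R * mesh R L n + mesh R L n) (reach R L n)) => //.
- have kN : (k < K * 2 ^ (L * n ^ 2))%N.
    rewrite -(ltr_nat R) natrM natrX -(ltr_pM2r hn) /mesh mulfK ?gt_eqF ?exprn_gt0//.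
    by rewrite (le_lt_trans _ dK)// (le_trans k1).
  apply: Hloop => //.
  + rewrite leqNgt; apply/negP => kA; apply: nB; left.
    rewrite /E/= in_itv/= ler_pdivrMr// ltr_pdivlMr//; apply/andP; split.
      by have : 0 <= u * zeta; [rewrite mulr_ge0// ltW|lra].
    rewrite ltrBrDl (lt_le_trans k2)// -[X in _ + X]mul1r -mulrDl natr1 mulrC.
    by rewrite ler_wpM2l ?(ltW hn)// -!natrX ler_nat.
  + apply/negP => Bk; apply: nB; right; have [_ + _] := HU n.
    by move=> /(_ k kN Bk); apply.
- by rewrite mulr_gt0// powR_gt0.
- by rewrite addrAC subrr add0r; lra.
Qed.

End lower_dimension.

Section main.
Context d (T : measurableType d) (R : realType) (P : probability T R).
Variables (alpha : R) (X : R -> T -> R).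
Hypotheses (mX : forall t, measurable_fun setT (X t)) (lapX : stable_laplace P alpha X).
Hypotheses (al1 : 1 < alpha) (al2 : alpha < 2).
Hypothesis cX : {ae P, forall w, cadlag (fun t => X t w)}.
Let al0 : 0 < alpha. Proof. by apply: lt_trans al1. Qed.

Lemma rint_mem (B : set T) : measurable B -> rint P (fun w => (w \in B)%:R).
Proof.
move=> mB; apply: (@rint_bounded _ _ _ _ _ 1).
  by rewrite (_ : (fun w => _) = \1_B)//; exact: measurable_indic.
by move=> w; case: (w \in B); rewrite ?normr0 ?normr1.
Qed.

Lemma Ex_mem (B : set T) (r : R) : measurable B -> (P B <= r%:E)%E ->
  Expect P (fun w => (w \in B)%:R) <= r.
Proof.
move=> mB; rewrite -lee_fin -Ex_EFin; last exact: rint_mem.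
by rewrite -[X in P X]setIT -integral_indic.
Qed.

(* The first summand accounts for the cells with [k < (2 ^ n) ^ n], too close to time 0
   for the scales explored by [bad_bound]. *)
Definition many_loops (L K : nat) (f : R -> R) := exists kap n1 (B : nat -> nat -> bool), [/\ 0 < kap,
  forall n k, (n1 <= n)%N -> ((2 ^ n) ^ n <= k)%N -> (k < K * 2 ^ (L * n ^ 2))%N -> ~~ B n k ->
    loop_at f (k%:R * mesh R L n) (k%:R * mesh R L n + mesh R L n) (reach R L n)
      (kap * mesh R L n `^ alpha^-1) &
  (\sum_(0 <= n <oo) (mesh R L n * (2 ^+ n) ^+ n +
     \sum_(k < K * 2 ^ (L * n ^ 2)) mesh R L n * (B n k)%:R)%:E < +oo)%E].

(** There are K / mesh cells, each bad with probability O(th^n), so the expected total length of the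
    bad ones is O(K th^n) and [ae_summable] applies. The outer bounds of [bad_bound] are first
    turned into measurable sets [B n k], whose indicators can be summed. *)
Lemma ae_many_loops (L K : nat) : (4 <= L)%N ->
  {ae P, forall w, cadlag (fun t => X t w) -> many_loops L K (fun t => X t w)}.
Proof.
move=> L4; have [kap [th [C [n0 [kap0 th0 th1 C0 Hbad]]]]] := bad_bound mX lapX al1 al2.
have h0 n : 0 < mesh R L n := mesh_gt0 R L n.
have exB (nk : nat * nat) : exists B : set T, [/\ measurable B, (P B <= (C * th ^+ nk.1)%:E)%E &
    (n0 <= nk.1)%N -> ((2 ^ nk.1) ^ nk.1 <= nk.2)%N -> forall w, cadlag (fun t => X t w) -> ~ B w ->
    loop_at (fun t => X t w) (nk.2%:R * mesh R L nk.1) (nk.2%:R * mesh R L nk.1 + mesh R L nk.1)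
      (reach R L nk.1) (kap * mesh R L nk.1 `^ alpha^-1)].
  case: nk => n k /=.
  have [/andP[n0n nk]|nnk] := boolP ((n0 <= n) && ((2 ^ n) ^ n <= k))%N; last first.
    exists set0; split=> //; first by rewrite measure0 lee_fin mulr_ge0 ?exprn_ge0 ?ltW.
    by move=> n0n nk; rewrite n0n nk in nnk.
  have hk : mesh R L n * (2 ^+ n) ^+ n <= k%:R * mesh R L n.
    by rewrite mulrC ler_wpM2r ?(ltW (h0 n))// -!natrX ler_nat.
  have [B [mB HB PB]] := Hbad n _ _ n0n (h0 n) hk.
  exists B; split=> // _ _ w cw nBw; apply: contrapT => nl.
  by apply: nBw; apply: HB.
have [B0 HB0] := choice exB; pose B n k := B0 (n, k).
have mB n k : measurable (B n k) by have [] := HB0 (n, k).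
have PB n k : (P (B n k) <= (C * th ^+ n)%:E)%E by have [] := HB0 (n, k).
pose S n w := mesh R L n * (2 ^+ n) ^+ n + \sum_(k < K * 2 ^ (L * n ^ 2)) mesh R L n * (w \in B n k)%:R.
pose q := Num.max 2^-1 th.
have q0 : 0 < q by rewrite lt_max th0 orbT.
have q1 : q < 1 by rewrite gt_max th1 andbT invf_lt1// ltr1n.
have iF n : forall k, (k < K * 2 ^ (L * n ^ 2))%N -> rint P (fun w => mesh R L n * (w \in B n k)%:R).
  by move=> k _; apply: rintZ; exact: rint_mem.
have iS n : rint P (S n).
  apply: rintD; first exact: rint_cst.
  exact: (rint_sum (F := fun k w => mesh R L n * (w \in B n k)%:R) (iF n)).
have S0 n w : 0 <= S n w.
  rewrite addr_ge0 ?mulr_ge0 ?exprn_ge0 ?(ltW (h0 _))//.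
  by apply: sumr_ge0 => k _; rewrite mulr_ge0// ltW.
have ES n : Expect P (S n) <= (1 + K%:R * C) * q ^+ n.
  rewrite ExD; [|exact: rint_cst|exact: (rint_sum (F := fun k w => mesh R L n * (w \in B n k)%:R) (iF n))].
  rewrite Ex_cst (Ex_sum (F := fun k w => mesh R L n * (w \in B n k)%:R) (iF n)) mulrDl mul1r.
  apply: lerD.
    apply: (@le_trans _ _ (reach R L n)).
      rewrite ler_wpM2l ?(ltW (h0 n))// ler_weXn2l ?exprn_ege1 ?ler1n//.
      by rewrite leqW// leq_pmull.
    apply: (le_trans (reach_le R n L4)); rewrite lerXn2r ?nnegrE ?invr_ge0 ?(ltW q0)//.
    by rewrite le_max lexx.
  apply: (@le_trans _ _ (\sum_(k < K * 2 ^ (L * n ^ 2)) mesh R L n * (C * th ^+ n))).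
    apply: ler_sum => k _; rewrite ExZ; last exact: rint_mem.
    by rewrite ler_wpM2l ?(ltW (h0 n))// Ex_mem.
  rewrite sumr_const card_ord -[leLHS]mulr_natl natrM natrX.
  have -> : K%:R * 2 ^+ (L * n ^ 2) * (mesh R L n * (C * th ^+ n)) = K%:R * C * th ^+ n.
    by rewrite mulrA -[K%:R * _ * _]mulrA divff ?gt_eqF ?exprn_gt0// mulr1 mulrA.
  rewrite ler_wpM2l ?mulr_ge0 ?(ltW C0)// lerXn2r ?nnegrE ?(ltW th0) ?(ltW q0)//.
  by rewrite le_max lexx orbT.
have c0 : 0 <= 1 + K%:R * C by rewrite addr_ge0 ?mulr_ge0 ?(ltW C0).
have := ae_summable iS S0 ES (nneseries_geom_lty c0 q0 q1).
apply: filterS => w Hw cw; exists kap, n0, (fun n k => w \in B n k); split=> //.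
move=> n k n0n nk _ /negP; rewrite inE => nB.
by have [_ _ H] := HB0 (n, k); exact: H.
Qed.

Lemma ae_looptree : {ae P, forall w, looptree_compact_dim alpha (fun t => X t w)}.
Proof.
(* A sequence increasing to 1/alpha, so that countably many null sets cover all exponents. *)
pose gam (k : nat) : R := (alpha + k.+1%:R^-1)^-1.
have gd k : 0 < alpha + k.+1%:R^-1 by rewrite addr_gt0 ?invr_gt0.
have gam0 k : 0 < gam k by rewrite invr_gt0.
have gam_al k : gam k < alpha^-1 by rewrite ltf_pV2 ?posrE// ltrDl invr_gt0.
have H1 := ae_foralln (fun k => ae_lower_holder mX lapX al1 cX (gam0 k) (gam_al k)).
have H2 := ae_foralln (fun L => ae_foralln (fun K => @ae_many_loops (L + 4) K (leq_addl _ _))).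
have H3 := ae_unbounded_below mX lapX al1 al2.
have H4 := ae_not_min1 mX lapX al1 al2.
have H5 := ae_no_jump_from_inf mX lapX al1 al2 cX.
near=> w.
have cf : cadlag (fun t => X t w) by near: w.
have lh : forall k, lower_holder (gam k) (fun t => X t w) by near: w.
have unb : forall M : R, exists2 s, 1 <= s & X s w < M by near: w.
have f1 : exists2 u, 0 <= u <= 1 & X u w < X 1 w by near: w.
have NJ : no_jump_from_inf (fun t => X t w) by near: w.
have loops : forall L K, cadlag (fun t => X t w) -> many_loops (L + 4) K (fun t => X t w) by near: w.
set f := fun t => X t w in cf lh unb f1 NJ loops *.
have exc := path_excursion alpha (gam0 0%N) cf (lh 0%N) NJ unb f1.
split; [exact: ltdist_pseudo_dist|exact: ltdist_compact|].
apply: hdim_eq; first exact: ltW.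
- move=> s als; have [k ks] : exists k : nat, k.+1%:R^-1 < s - alpha.
    have sa : 0 < s - alpha by rewrite subr_gt0.
    have /cvgrPdist_lt /(_ _ sa)[N _ /(_ N (leqnn N))] := @cvg_invS R.
    by rewrite sub0r normrN gtr0_norm ?invr_gt0// => ?; exists N.
  have [C C0 HC] := Xexc_holder alpha (gam0 k) cf (lh k) NJ unb f1.
  apply: (hmeasure_upper exc C0 (gam0 k) _ _ _ HC).
  + by apply: lt_trans (gam_al k) _; rewrite invf_lt1.
  + by rewrite mulrC ltr_pdivlMr// mul1r -ltrBrDl.
  + exact: (Xexc1 alpha (gam0 0%N) cf (lh 0%N) NJ unb f1).
- move=> s s0 sal; have sa : 0 < 1 - s / alpha by rewrite subr_gt0 ltr_pdivrMr// mul1r.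
  (* Large enough for 3 <= (L + 4) (1 - s/alpha), the condition under which the reach is bounded by
     the power s/alpha of the next mesh. *)
  pose L := (Num.truncn (3 / (1 - s / alpha))).+1.
  pose K := (Num.truncn (d1 f)).+1.
  have [kap [n1 [B [kap0 Hl Hs]]]] := loops L K cf.
  have d0 : 0 <= d1 f := le_trans ler01 (d_ge1 (gam0 0%N) cf (lh 0%N) NJ unb).
  have /andP[_ dK] := truncn_itv d0.
  apply: (hmeasure_lower (gam0 0%N) cf (lh 0%N) NJ unb f1 dK kap0 al0 s0 sal _ _ Hl Hs).
    exact: leq_addl.
  rewrite -ler_pdivrMr// natrD.
  have s3 : 0 <= 3 / (1 - s / alpha) by rewrite divr_ge0// ltW.
  have /andP[_ lt] := truncn_itv s3; rewrite -/L in lt; lra.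
Unshelve. all: by end_near.
Qed.

End main.

Theorem theorem1p1 (R : realType) (d : measure_display) (T : measurableType d)
  (P : probability T R) (alpha : R) (X : R -> T -> R) :
  1 < alpha < 2 ->
  (forall t, measurable_fun setT (X t)) ->
  {ae P, forall w, cadlag (fun t => X t w) /\ X 0 w = 0} ->
  stable_laplace P alpha X ->
  {ae P, forall w, looptree_compact_dim alpha (fun t => X t w)}.
Proof.
move=> /andP[al1 al2] mX cX lapX; apply: ae_looptree => //.
by apply: filterS cX => w [].
Qed.
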